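(* Let $q>0$, $0<v_1<v_2$, $0<w_1<w_2$, $v_2<w_2$ be such that $v_1+p(q/v_1)\ge w_2$, $v_2+p(q/v_2)\le w_2$, $v+p(q/v)\ge w_1$ for every $v\in[v_1,v_2]$, and $\bar v+p(q/\bar v)<w_2$ for some $\bar v\in[v_1,v_2]$. Assume $\lambda_1(\rho_{\min},v_{\min})<0$. Let $(\rho_0,v_0)$ be a fixed function in $L^1(\mathbb R)\cap BV(\mathbb R)$ with values in $\mathcal D_{v_1,v_2,w_1,w_2}$. Then the constrained Cauchy problem $$\begin{cases}\partial_t\rho+\partial_x(\rho v)=0,\\ \partial_t[\rho(v+p(\rho))]+\partial_x[\rho v(v+p(\rho))]=0,\\ \rho(t,0)\,v(t,0)\le q,\\ (\rho,v)(0,x)=(\rho_0,v_0)(x)\end{cases}$$ has a weak solution $(\rho,v)$ defined for every $t\ge0$.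
   Context: The pressure $p\in C^2([0,\infty),[0,\infty))$ satisfies $p(0)=0$, $p'(\rho)>0$ for $\rho>0$, $p''(\rho)\ge0$ for $\rho\ge0$. $\lambda_1(\rho,v)=v-\rho p'(\rho)$. $\mathcal D_{v_1,v_2,w_1,w_2}=\{(\rho,v)\in(0,\infty)\times(0,\infty): v_1\le v\le v_2,\ w_1\le v+p(\rho)\le w_2\}$. The point $(\rho_{\min},v_{\min})\in\mathcal D_{v_1,v_2,w_1,w_2}$ is the solution of the system $v+p(\rho)=w_1$, $v=v_2$. $BV(\mathbb R)$ denotes the functions of bounded total variation on $\mathbb R$. With $u=(\rho,\rho(v+p(\rho)))$ and $f=(\rho v,\rho v(v+p(\rho)))$, a weak solution of the system is a function with $u,f\in L^1_{\mathrm{loc}}$ and $\int_0^\infty\!\int_{\mathbb R}[u\cdot\partial_t\phi+f\cdot\partial_x\phi]\,dx\,dt=0$ for all $\phi\in C^1_c((0,\infty)\times\mathbb R,\mathbb R^2)$. A weak solution of the constrained Cauchy problem is a weak solution of the system such that for a.e. $t>0$ the left and right traces at $x=0$ satisfy $\rho(t,0\pm)v(t,0\pm)\le q$, and such that $(\rho,v)(0,x)=(\rho_0,v_0)(x)$ for a.e. $x\in\mathbb R$, with $(\rho,v)(t,\cdot)\to(\rho_0,v_0)$ in $L^1_{\mathrm{loc}}(\mathbb R)$ as $t\to0^+$.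
   Formalization: The initial datum is assumed in L^1_loc(R) ∩ BV(R) instead of L^1(R) ∩ BV(R): values in D force v_0 ≥ v_1 > 0 on all of R, so no such datum lies in L^1(R) and the hypothesis as printed is never met. *)

(* Defs.v *)
From HB Require Import structures.
From mathcomp Require Import all_boot all_order all_algebra.
From mathcomp Require Import all_classical all_reals all_analysis.

Set Implicit Arguments.
Unset Strict Implicit.
Unset Printing Implicit Defensive.

Import Order.TTheory GRing.Theory Num.Theory.
Import numFieldNormedType.Exports.

Local Open Scope classical_set_scope.
Local Open Scope ring_scope.

(* Difference quotients use points of [0, +oo) only, so that the derivative is
   two-sided on (0, +oo) and one-sided at 0, and the values of [f] on the
   negative half-line are irrelevant. *)
Definition is_derive_nonneg (R : realType) (f df : R -> R) : Prop :=
  forall x, 0 <= x ->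
    (f y - f x) / (y - x) @[y --> within [set y | 0 <= y] x^'] --> df x.

(* [p] is in C^2([0, +oo), [0, +oo)) with first and second derivatives [dp] and
   [ddp] there, together with the assumptions made on the pressure. *)
Definition pressure (R : realType) (p dp ddp : R -> R) : Prop :=
  [/\ forall r, 0 <= r -> 0 <= p r,
      [/\ is_derive_nonneg p dp, is_derive_nonneg dp ddp &
          {within [set r | 0 <= r], continuous ddp}],
      p 0 = 0,
      forall r, 0 < r -> 0 < dp r &
      forall r, 0 <= r -> 0 <= ddp r].

Definition lambda1 (R : realType) (dp : R -> R) (r v : R) : R := v - r * dp r.

Definition domain (R : realType) (p : R -> R) (v1 v2 w1 w2 : R) : set (R * R) :=
  [set z | [/\ 0 < z.1, 0 < z.2, v1 <= z.2 <= v2 & w1 <= z.2 + p z.1 <= w2]].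

(* A datum with values in [domain] has v >= v1 > 0 and so is never integrable on
   the whole line: [BV] bounds the variation only, and integrability of the
   data is to be imposed locally. *)
Definition BV (R : realType) (f : R -> R) : Prop :=
  exists M : R, forall a b : R, a <= b -> (total_variation a b f <= M%:E)%E.

(* The conserved quantities u = (u1, u2) and the flux f = (f1, f2). *)
Definition u1 (R : realType) (r v : R) : R := r.
Definition u2 (R : realType) (p : R -> R) (r v : R) : R := r * (v + p r).
Definition f1 (R : realType) (r v : R) : R := r * v.
Definition f2 (R : realType) (p : R -> R) (r v : R) : R := r * v * (v + p r).

(* The open half-plane; points are pairs (t, x). *)
Definition halfplane (R : realType) : set (R * R) := [set z | 0 < z.1].
Arguments halfplane : clear implicits.

(* The library's [locally_integrable] only covers functions on R. *)
Definition locally_integrable2 (R : realType) (g : R * R -> R) : Prop :=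
  forall K : set (R * R), compact K -> K `<=` halfplane R ->
    (lebesgue_measure \x lebesgue_measure)%E.-integrable K (EFin \o g).

Definition dt (R : realType) (phi : R * R -> R) (z : R * R) : R :=
  'D_((1, 0) : R * R) phi z.
Definition dx (R : realType) (phi : R * R -> R) (z : R * R) : R :=
  'D_((0, 1) : R * R) phi z.

(* C^1_c((0, +oo) x R), each function being extended by 0 to R x R. *)
Definition C1c (R : realType) (phi : R * R -> R) : Prop :=
  [/\ forall z, differentiable phi z,
      continuous (dt phi), continuous (dx phi) &
      exists K : set (R * R), [/\ compact K, K `<=` halfplane R &
        forall z, ~ K z -> phi z = 0]].

(* Density and velocity are nonnegative; in particular [p] is only evaluated on
   [0, +oo). *)
Definition weak_solution (R : realType) (p : R -> R) (rho v : R -> R -> R) : Prop :=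
  [/\ forall t x, 0 <= t -> 0 <= rho t x /\ 0 <= v t x,
      locally_integrable2 (fun z => u1 (rho z.1 z.2) (v z.1 z.2)) /\
      locally_integrable2 (fun z => u2 p (rho z.1 z.2) (v z.1 z.2)),
      locally_integrable2 (fun z => f1 (rho z.1 z.2) (v z.1 z.2)) /\
      locally_integrable2 (fun z => f2 p (rho z.1 z.2) (v z.1 z.2)) &
      forall phi1 phi2 : R * R -> R, C1c phi1 -> C1c phi2 ->
        (\int[lebesgue_measure]_(t in `]0%R, +oo[) \int[lebesgue_measure]_x
          (u1 (rho t x) (v t x) * dt phi1 (t, x)
           + u2 p (rho t x) (v t x) * dt phi2 (t, x)
           + (f1 (rho t x) (v t x) * dx phi1 (t, x)
              + f2 p (rho t x) (v t x) * dx phi2 (t, x)))%:E = 0)%E].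

Definition cvg_L1loc (R : realType) (g : R -> R -> R) (g0 : R -> R) : Prop :=
  (\forall t \near 0^'+, locally_integrable setT (g t)) /\
  forall K : set R, compact K ->
    (\int[lebesgue_measure]_(x in K) `|g t x - g0 x|%:E)%E @[t --> 0^'+] --> 0%E.

(* The traces are the one-sided limits of rho(t, .) and v(t, .) at x = 0; their
   existence is part of the condition. *)
Definition constrained_solution (R : realType) (p : R -> R) (q : R)
    (rho0 v0 : R -> R) (rho v : R -> R -> R) : Prop :=
  [/\ weak_solution p rho v,
      {ae lebesgue_measure, forall t : R, 0 < t ->
        exists rl vl rr vr : R,
          [/\ rho t x @[x --> 0^'-] --> rl /\ v t x @[x --> 0^'-] --> vl,
              rho t x @[x --> 0^'+] --> rr /\ v t x @[x --> 0^'+] --> vr,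
              rl * vl <= q & rr * vr <= q]},
      {ae lebesgue_measure, forall x : R, rho 0 x = rho0 x /\ v 0 x = v0 x} &
      cvg_L1loc rho rho0 /\ cvg_L1loc v v0].

(* Main.v *)
Require Import Defs.
From HB Require Import structures.
From mathcomp Require Import all_boot all_order all_algebra.
From mathcomp Require Import all_classical all_reals all_analysis.
From mathcomp Require Import measurable_realfun.
From mathcomp Require Import ring lra.

Import Order.TTheory GRing.Theory Num.Theory.
Import numFieldNormedType.Exports.

Local Open Scope classical_set_scope.
Local Open Scope ring_scope.


(** A solution can be written down. The flux constraint bounds the traces at
    [x = 0] from above only, and a weak solution need not satisfy an entropy
    condition, so the road may be closed at [x = 0] by a red light that is on at
    every positive time. The cars behind it drive freely until they reach a
    queue of stopped cars, the cars beyond it drive away and leave a vacuum, and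
    at every positive time both traces of the flux at [x = 0] are 0.

    Cars are labelled by their initial positions. Each car [s] keeps the marker
    w0(s) = v0(s) + p(rho0(s)), so at speed [v] its density is
    p^-1(w0(s) - v), and the gap ahead of it is the initial one multiplied by
    k(v, s) = rho0(s) / p^-1(w0(s) - v). The point (rho_min, v_min) of the domain
    gives [v2 < w1], which keeps these densities positive, and the convexity of
    the pressure makes [k] strongly convex in [v] ([spacing_ratioP]). Free
    driving is then the Hamilton-Jacobi equation X_a = k(X_t, a) for the position
    X(t, a) of car [a] at time [t], solved by the Lax-Oleinik formula
      X(t, a) = min_b max_v (b + v t - int_a^b k(v, s) ds),
    in which k(v0(s), s) = 1 encodes the initial velocity. The positions are
    bi-Lipschitz and increasing in [a]; inverting them gives the label of the car
    at a given point. The flow with the light has as its label the maximum of the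
    free label and of the label of the queue ([flow_label]).

    Both balance laws are instances of one fact. If N is a primitive [prim g] of
    the label, with [g] equal to rho0 or to rho0 w0, then N_x is the density of
    the transported quantity and N_t is minus its flux, so the balance law says
    that the pair (N_t, N_x) is a gradient. It holds in the sense of
    distributions as soon as the pair belongs to the Frechet subdifferential of
    the Lipschitz function N at almost every point ([weak_gradient]).
    Subgradients are what the construction provides: the strict maximum over the
    speeds lets a smooth function touch X from above ([touching]), hence one
    touches the label from below ([label_subgrad]), and this survives the maximum
    with the queue label and the composition with [prim g] ([flow_subgrad]).

    Bounded variation enters twice. It leaves at most countably many
    discontinuities of the data ([BV_continuous]); the argument above fails only
    on the paths of the corresponding cars, a null set, and away from them the
    solution tends to the data as t tends to 0 ([flow_velocity_start],
    [flow_density_start]). It also gives the data a left limit at every point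
    ([BV_left_limit]), which provides the trace of the density in the queue: the
    queue near the light consists of cars that started just behind it. *)


(** * Integration over the plane *)

Section PlaneIntegral.
Context {R : realType}.
Notation mu := (@lebesgue_measure R).
Notation mu2 := (mu \x mu)%E.
Notation P := (measurableTypeR R * measurableTypeR R)%type.

Lemma lebesgue_measure_shift (a : R) (A : set R) : measurable A ->
  pushforward mu (fun x : measurableTypeR R => x + a : measurableTypeR R) A = mu A.
Proof.
move=> mA.
have mshift : measurable_fun setT (fun x : measurableTypeR R => x + a : measurableTypeR R).
  by apply: measurable_funD => //; exact: measurable_cst.
apply/esym.
pose mphi_mixin := isMeasurableFun.Build _ _ _ _ _ mshift.
pose phi : {mfun measurableTypeR R >-> measurableTypeR R} := HB.pack (fun x : measurableTypeR R => x + a : measurableTypeR R) mphi_mixin.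
apply: (@lebesgue_measure_unique R (pushforward mu phi)) => //= _ [[u v]] _ <-.
rewrite /pushforward /=.
have -> : (fun x : R => x + a) @^-1` `]u, v]%classic = `]u - a, v - a]%classic.
  by apply/seteqP; split => x /=; rewrite !in_itv/= ltrBlDr lerBrDr.
rewrite !lebesgue_measure_itv/= !lte_fin ltrD2r.
by case: ifP => // _; rewrite -!EFinB; congr EFin; ring.
Qed.

Lemma measurable_shift2 (a : R * R) :
  measurable_fun [set: P] ((fun z : R * R => z + a) : P -> P).
Proof.
apply/(@measurable_fun_pairP _ _ _ P (measurableTypeR R) (measurableTypeR R)); split.
- rewrite (_ : _ \o _ = (fun z : R * R => z.1 + a.1))//.
  by apply: measurable_funD => //; exact: measurable_cst.
- rewrite (_ : _ \o _ = (fun z : R * R => z.2 + a.2))//.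
  by apply: measurable_funD => //; exact: measurable_cst.
Qed.

Lemma mu2_shift (a : R * R) (A : set P) : measurable A ->
  pushforward mu2 ((fun z : R * R => z + a) : P -> P) A = mu2 A.
Proof.
move=> mA; apply/esym.
pose mphi_mixin := isMeasurableFun.Build _ _ _ _ _ (measurable_shift2 a).
pose phi : {mfun P >-> P} := HB.pack ((fun z : R * R => z + a) : P -> P) mphi_mixin.
apply: (@product_measure_unique _ _ _ _ _ mu mu (pushforward mu2 phi)) => //= B C mB mC.
rewrite /pushforward /=.
have -> : (fun z : R * R => z + a) @^-1` (B `*` C) =
   ((fun x => x + a.1) @^-1` B) `*` ((fun x => x + a.2) @^-1` C).
  by [].
have m1 (c : R) (D : set R) : measurable D -> measurable ((fun x => x + c) @^-1` D).
  move=> mD; rewrite -[X in measurable X]setTI.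
  have mf : measurable_fun [set: R] (fun x : R => x + c) by apply: measurable_funD => //; exact: measurable_cst.
  exact: mf.
rewrite product_measure1E; [|exact: m1|exact: m1].
by rewrite -(lebesgue_measure_shift a.1 _ mB) -(lebesgue_measure_shift a.2 _ mC).
Qed.

Definition box (m : R) : set P := [set z | `|z.1| <= m /\ `|z.2| <= m].

Lemma boxE m : box m = `[- m, m]%classic `*` `[- m, m]%classic.
Proof.
by apply/seteqP; split => z /=; rewrite /box/= !in_itv/= !ler_norml.
Qed.

Lemma measurable_box m : measurable (box m).
Proof. by rewrite boxE; apply: measurableX; exact: measurable_itv. Qed.

Lemma box_fin m : (mu2 (box m) < +oo)%E.
Proof.
have mI : (mu (`[(- m)%R, m%R]%classic) < +oo)%E.
  by rewrite lebesgue_measure_itv/=; case: ifP => _; rewrite -?EFinB ltry.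
have -> : mu2 (box m) = ((mu (`[(- m)%R, m%R]%classic)) * (mu (`[(- m)%R, m%R]%classic)))%E.
  rewrite boxE; apply: product_measure1E; exact: measurable_itv.
by apply: lte_mul_pinfty => //; rewrite ge0_fin_numE.
Qed.

Lemma box_le {m n} z : m <= n -> box m z -> box n z.
Proof. by move=> mn [h1 h2]; split; apply: le_trans mn. Qed.

(** Bounded measurable functions with bounded support. The class is stable under
    translations and under multiplication by bounded measurable functions, and
    the plane integral is finite and linear on it. *)
Definition bsupp (f : R * R -> R) : Prop :=
  measurable_fun [set: P] f /\ exists m, (forall z, `|f z| <= m) /\ (forall z, ~ box m z -> f z = 0).

Lemma integrable_box (c m : R) : mu2.-integrable setT (fun z => (c * \1_(box m) z)%:E).
Proof.
have -> : (fun z => (c * \1_(box m) z)%:E) = (fun z => c%:E * (EFin \o \1_(box m)) z)%E.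
  by apply/funext => z; rewrite EFinM.
apply: integrableZl => //; apply/integrableP; split.
  apply/measurable_EFinP; apply: measurable_indic; exact: measurable_box.
under eq_integral do rewrite /= ger0_norm//.
by rewrite integral_indic//= ?setIT; [exact: box_fin|exact: measurable_box].
Qed.

Lemma bsupp_integrable f : bsupp f -> mu2.-integrable setT (EFin \o f).
Proof.
move=> [mf [m [fm f0]]].
apply: (le_integrable measurableT _ _ (integrable_box m m)).
  exact/measurable_EFinP.
move=> z _ /=; rewrite lee_fin indicE.
have m0 : 0 <= m by apply: le_trans (fm 0).
have [zb|zb] := boolP (z \in box m); first by rewrite mulr1 [leRHS]ger0_norm.
by rewrite f0 ?normr0// => /mem_set; apply/negP.
Qed.

Lemma bsuppD f g : bsupp f -> bsupp g -> bsupp (fun z => f z + g z).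
Proof.
move=> [mf [m [fm f0]]] [mg [n [gn g0]]]; split; first exact: measurable_funD.
have m0 : 0 <= m by apply: le_trans (fm 0).
have n0 : 0 <= n by apply: le_trans (gn 0).
exists (m + n); split.
  by move=> z; rewrite (le_trans (ler_normD _ _))// lerD.
move=> z zb; rewrite f0 ?g0 ?addr0// => h; apply: zb; apply: box_le h; lra.
Qed.

Lemma bsuppM (f g : R * R -> R) (c : R) : bsupp f -> measurable_fun [set: P] g ->
  (forall z, `|g z| <= c) -> bsupp (fun z => g z * f z).
Proof.
move=> [mf [m [fm f0]]] mg gc; split; first exact: measurable_funM.
have m0 : 0 <= m by apply: le_trans (fm 0).
have c0 : 0 <= c by apply: le_trans (gc 0).
exists (m + c * m); split.
  by move=> z; rewrite normrM (@le_trans _ _ (c * m)) ?ler_pM// lerDr.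
move=> z zb; rewrite f0 ?mulr0// => h; apply: zb; apply: box_le h.
by rewrite lerDl mulr_ge0.
Qed.

Lemma bsuppZ f c : bsupp f -> bsupp (fun z => c * f z).
Proof. by move=> h; apply: (@bsuppM f (fun _ => c) `|c|). Qed.

Lemma bsuppB f g : bsupp f -> bsupp g -> bsupp (fun z => f z - g z).
Proof.
move=> bf bg; rewrite (_ : (fun z => _) = (fun z => f z + (- 1) * g z)).
  by apply: bsuppD => //; exact: bsuppZ.
by apply/funext => z; rewrite mulN1r.
Qed.

Lemma bsupp_shift f a : bsupp f -> bsupp (fun z => f (z + a)).
Proof.
move=> [mf [m [fm f0]]]; split.
  by apply: (measurableT_comp mf); exact: measurable_shift2.
have m0 : 0 <= m by apply: le_trans (fm 0).
exists (m + `|a.1| + `|a.2|); split.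
  by move=> z; apply: (le_trans (fm _)); rewrite -addrA lerDl addr_ge0.
move=> z zb; apply: f0 => -[/= h1 h2]; apply: zb; split.
  have := ler_normB (z.1 + a.1) a.1; rewrite addrK => /le_trans; apply.
  by have := normr_ge0 a.2; lra.
have := ler_normB (z.2 + a.2) a.2; rewrite addrK => /le_trans; apply.
by have := normr_ge0 a.1; lra.
Qed.

Definition int2 (f : R * R -> R) : R := (\int[mu2]_z f z)%R.

Lemma int2D f g : bsupp f -> bsupp g -> int2 (fun z => f z + g z) = int2 f + int2 g.
Proof. by move=> bf bg; rewrite /int2 RintegralD//; exact: bsupp_integrable. Qed.

Lemma int2B f g : bsupp f -> bsupp g -> int2 (fun z => f z - g z) = int2 f - int2 g.
Proof. by move=> bf bg; rewrite /int2 RintegralB//; exact: bsupp_integrable. Qed.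

Lemma int2Z f c : bsupp f -> int2 (fun z => c * f z) = c * int2 f.
Proof. by move=> bf; rewrite /int2 RintegralZl//; exact: bsupp_integrable. Qed.

Lemma le_int2 f g : bsupp f -> bsupp g -> (forall z, f z <= g z) -> int2 f <= int2 g.
Proof. by move=> bf bg h; apply: le_Rintegral => //; exact: bsupp_integrable. Qed.

Lemma int2_shift f a : bsupp f -> int2 (fun z => f (z + a)) = int2 f.
Proof.
move=> bf; rewrite /int2 /Rintegral; congr fine.
pose shift := (fun z : R * R => z + a) : P -> P.
have := @integral_pushforward _ _ _ _ R shift (measurable_shift2 a) mu2 setT (EFin \o f).
move=> /(_ _ _ measurableT) E; apply: etrans; first (apply/esym; apply: E).
- by apply/measurable_EFinP; case: bf.
- exact: (bsupp_integrable _ (bsupp_shift f a bf)).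
- by apply: eq_measure_integral => [|? A mA _]; [exact: measurable_shift2|exact: mu2_shift]. 
Qed.

Lemma ae2S (A B : R * R -> Prop) : (forall z, A z -> B z) ->
  {ae mu2, forall z, A z} -> {ae mu2, forall z, B z}.
Proof. by move=> AB; apply: negligibleS => z /=; apply: contra_not; exact: AB. Qed.

Lemma int2_dominated (f_ : (R * R -> R)^nat) (f : R * R -> R) (c m : R) :
  (forall n, measurable_fun [set: P] (f_ n)) -> measurable_fun [set: P] f ->
  (forall n z, `|f_ n z| <= c) -> (forall n z, ~ box m z -> f_ n z = 0) ->
  {ae mu2, forall z, f_ ^~ z @ \oo --> f z} ->
  int2 (f_ n) @[n --> \oo] --> int2 f.
Proof.
move=> mf_ mf fc f0 ff.
have [|||||i1 _ i3] := @dominated_convergence _ _ _ mu2 setT measurableT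
  (fun n => EFin \o f_ n) (EFin \o f) (fun z => (c * \1_(box m) z)%:E).
- by move=> n; exact/measurable_EFinP.
- exact/measurable_EFinP.
- by apply: ae2S ff => z h _; apply: cvg_EFin => //; exact: nearW.
- exact: integrable_box.
- apply: aeW => z n _ /=; rewrite lee_fin indicE.
  have [zb|zb] := boolP (z \in box m); first by rewrite mulr1.
  by rewrite f0 ?normr0 ?mulr0// => /mem_set; apply/negP.
move: i3; rewrite /= (_ : (\int[mu2]_x (f x)%:E)%E = (int2 f)%:E); last first.
  by rewrite /int2 /Rintegral fineK//; apply: integrable_fin_num.
by move/fine_cvg.
Qed.

End PlaneIntegral.

(** * Measurability in the plane *)

Section PlaneMeasurable.
Context {R : realType}.
Notation P := (measurableTypeR R * measurableTypeR R)%type.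

(** The sigma-algebra of the plane is the one of products, so it contains
    rectangles; an open set is the countable union of the rational rectangles it
    contains. *)
Lemma open_plane_measurable (U : set (R * R)) : open U -> measurable (U : set P).
Proof.
move=> oU.
pose rect (q : rat * rat * rat * rat) : set P :=
  `]ratr q.1.1.1, ratr q.1.1.2[%classic `*` `]ratr q.1.2, ratr q.2[%classic.
have -> : (U : set P) = \bigcup_(q in [set q | rect q `<=` U]) rect q.
  apply/seteqP; split => [z Uz|z [q qU qz]]; last exact: qU.
  move: (oU); rewrite openE => /(_ z Uz); rewrite /interior => /nbhs_ballP[e /= e0 eU].
  have lte (u : R) : u - e < u by rewrite ltrBlDr ltrDl.
  have gte (u : R) : u < u + e by rewrite ltrDl.
  have [q1] := rat_in_itvoo (lte z.1); rewrite in_itv/= => /andP[q11 q12].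
  have [q2] := rat_in_itvoo (gte z.1); rewrite in_itv/= => /andP[q21 q22].
  have [q3] := rat_in_itvoo (lte z.2); rewrite in_itv/= => /andP[q31 q32].
  have [q4] := rat_in_itvoo (gte z.2); rewrite in_itv/= => /andP[q41 q42].
  exists (q1, q2, q3, q4); last by split => /=; rewrite in_itv/=; apply/andP; split.
  move=> y [/=]; rewrite !in_itv/= => /andP[y1 y2] /andP[y3 y4].
  apply: eU; split; rewrite /ball/= ltr_norml; apply/andP; split; lra.
rewrite bigcup_mkcond.
apply: countable_bigcupT_measurable.
  exact: countableP.
move=> q; case: ifP => _; last exact: measurable0.
by apply: measurableX; exact: measurable_itv.
Qed.

Lemma measurable_plane_gt (f : R * R -> R) :
  (forall a, measurable ([set z | a < f z] : set P)) -> measurable_fun [set: P] f.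
Proof.
move=> h mD; apply: (measurability _ (RGenOInfty.measurableE R)) => //.
move=> /= _ [_ [a ->] <-]; rewrite preimage_itvoy setTI; exact: h.
Qed.

Lemma measurable_plane_lt (f : R * R -> R) :
  (forall a, measurable ([set z | f z < a] : set P)) -> measurable_fun [set: P] f.
Proof.
move=> h; rewrite (_ : f = (fun z => - (- f z))); last by apply/funext => z; rewrite opprK.
apply: measurable_funN; apply: measurable_plane_gt => a.
rewrite (_ : [set z | _] = [set z | f z < - a]); first exact: h.
by apply/seteqP; split => z /=; rewrite ltrNr.
Qed.

Lemma continuous_plane_measurable (f : R * R -> R) : continuous f ->
  measurable_fun [set: P] f.
Proof.
move=> cf; apply: measurable_plane_gt => a; apply: open_plane_measurable.
rewrite (_ : [set z | _] = f @^-1` [set x | a < x])//.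
by apply: open_comp => [z _|]; [exact: cf|exact: open_gt].
Qed.

End PlaneMeasurable.

(** * Weak limits of difference quotients *)

Section WeakQuotient.
Context {R : realType}.
Notation mu := (@lebesgue_measure R).
Notation mu2 := (mu \x mu)%E.
Notation P := (measurableTypeR R * measurableTypeR R)%type.

Definition step (a : R * R) (n : nat) : R * R := n.+1%:R^-1 *: a.
Definition diff_quot (a : R * R) (N : R * R -> R) (n : nat) (z : R * R) : R :=
  n.+1%:R * (N (z + step a n) - N z).

Lemma measurable_diff_quot a N n : measurable_fun [set: P] N ->
  measurable_fun [set: P] (diff_quot a N n).
Proof.
move=> mN; apply: measurable_funM; first exact: measurable_cst.
apply: measurable_funB => //.
by apply: (measurableT_comp mN); exact: measurable_shift2.
Qed.

Lemma near_step (Q : R -> Prop) : (\forall h \near (0:R)^'+, Q h) ->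
  \forall n \near \oo, Q (n.+1%:R^-1).
Proof.
rewrite /at_right near_withinE => /nbhs_ballP[e /= e0 H].
have := near_infty_natSinv_lt (PosNum e0); apply: filterS => n /= ne.
have n0 : (0 : R) < n.+1%:R^-1 by rewrite invr_gt0 ltr0n.
by apply: H => //; rewrite /ball/= sub0r normrN gtr0_norm.
Qed.

Variables (a : R * R) (N g : R * R -> R) (L : R).
Hypothesis NL : forall z h, `|N (z + h *: a) - N z| <= L * `|h|.
Hypothesis mN : measurable_fun [set: P] N.
Hypothesis mg : measurable_fun [set: P] g.
Hypothesis gL : forall z, `|g z| <= L.

(** A lower bound on the values of [N] on both sides of [z]: forward difference
    quotients are asymptotically at least [g z], backward ones at most [g z]. *)
Definition lower_slope (z : R * R) : Prop := forall e, 0 < e ->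
  \forall h \near (0:R)^'+, N z + h * (g z - e) <= N (z + h *: a) /\
     N z - h * (g z + e) <= N (z - h *: a).

Lemma diff_quot_bound n z : `|diff_quot a N n z| <= L.
Proof.
rewrite /diff_quot normrM ger0_norm//.
have := NL z n.+1%:R^-1; rewrite -/(step a n) => h.
have n0 : (0 : R) < n.+1%:R by rewrite ltr0n.
have := ler_wpM2l (ltW n0) h.
rewrite [`|_^-1|]ger0_norm ?invr_ge0// mulrCA mulfV ?mulr1//; exact: lt0r_neq0.
Qed.

Let L0 : 0 <= L. Proof. exact: le_trans (gL 0). Qed.

Lemma cvg_pos_part (u : nat -> R) (c : R) :
  (forall e, 0 < e -> \forall n \near \oo, u n <= e) ->
  (Num.max (u n) 0 * c) @[n --> \oo] --> (0 : R).
Proof.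
move=> h; rewrite -[X in _ --> X](mul0r c).
apply: cvgM; last exact: cvg_cst.
apply/cvgrPdist_le => e e0; have := h e e0; apply: filterS => n un.
rewrite sub0r normrN ger0_norm ?le_max ?lexx ?orbT//.
by rewrite ge_max un ltW.
Qed.

(** The lower bound controls the forward quotient from below at [z], and from
    above at [z - step a n], where it is the backward quotient at [z].
    Translation invariance of the integral converts the second bound into one on
    the integral of the forward quotient itself, so the two bounds meet in the
    limit. *)
Lemma diff_quot_cvg_ge0 (psi : R * R -> R) : bsupp psi -> continuous psi ->
  (forall z, 0 <= psi z) ->
  {ae mu2, forall z, psi z != 0 -> lower_slope z} ->
  int2 (fun z => diff_quot a N n z * psi z) @[n --> \oo] --> int2 (fun z => g z * psi z).
Proof.
move=> bpsi cpsi psi0 aez.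
have bq n : bsupp (fun z => diff_quot a N n z * psi z).
  apply: (bsuppM _ _ L) => //; [exact: measurable_diff_quot|exact: diff_quot_bound].
have bg : bsupp (fun z => g z * psi z) by apply: (bsuppM _ _ L).
have mpsi : measurable_fun [set: P] psi by case: bpsi.
have [m [psim psiout]] := bpsi.2.
(* [E] and [E'] are the defects of the lower and of the upper bound; [D] is the
   price of translating [psi] by one step. *)
pose E n z := Num.max (g z - diff_quot a N n z) 0 * psi z.
pose E' n z := Num.max (diff_quot a N n (z - step a n) - g z) 0 * psi z.
pose D n z := L * `|psi (z + step a n) - psi z|.
have mqs n : measurable_fun [set: P] (fun z => diff_quot a N n (z - step a n)).
  by apply: (measurableT_comp (measurable_diff_quot a N n mN)); exact: measurable_shift2.
have mxE (f : R * R -> R) : measurable_fun [set: P] f ->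
    measurable_fun [set: P] (fun z => Num.max (f z) 0).
  by move=> mf; apply: measurable_maxr => //; exact: measurable_cst.
have mE n : measurable_fun [set: P] (fun z => Num.max (g z - diff_quot a N n z) 0).
  by apply: mxE; apply: measurable_funB => //; exact: measurable_diff_quot.
have mE' n : measurable_fun [set: P] (fun z => Num.max (diff_quot a N n (z - step a n) - g z) 0).
  by apply: mxE; apply: measurable_funB.
have m2L (u v : R) : `|u| <= L -> `|v| <= L -> `|Num.max (u - v) 0| <= 2 * L.
  move=> uL vL; rewrite ger0_norm ?le_max ?lexx ?orbT// ge_max mulr_ge0// andbT.
  by move: uL vL; rewrite !ler_norml => /andP[? ?] /andP[? ?]; lra.
have bE n : bsupp (E n).
  apply: (bsuppM _ _ (2 * L)) => // z; apply: m2L => //; exact: diff_quot_bound.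
have bE' n : bsupp (E' n).
  apply: (bsuppM _ _ (2 * L)) => // z; apply: m2L => //; exact: diff_quot_bound.
have bD n : bsupp (D n).
  apply: bsuppZ; have [mB [k [kB Bout]]] := bsuppB _ _ (bsupp_shift _ (step a n) bpsi) bpsi.
  split; first exact: measurableT_comp.
  exists k; split => [z|z /Bout ->]; first by rewrite normr_id.
  by rewrite normr0.
have E0 : int2 (E n) @[n --> \oo] --> (0:R).
  have -> : (0:R) = int2 (fun=> 0) by rewrite /int2 Rintegral_cst// mul0r.
  apply: (int2_dominated _ _ (2 * L * m) m) => //.
  - by move=> n; case: (bE n).
  - move=> n z; rewrite normrM ler_pM// m2L//; exact: diff_quot_bound.
  - by move=> n z /psiout; rewrite /E => ->; rewrite mulr0.
  apply: ae2S aez => z /= hz.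
  have [p0|/hz {hz}hz] := eqVneq (psi z) 0.
    by rewrite /E p0; under eq_fun do rewrite mulr0; exact: cvg_cst.
  apply: cvg_pos_part => e e0.
  have := near_step _ (hz e e0); apply: filterS => n /= [h1 _].
  have n0 : (0 : R) < n.+1%:R by rewrite ltr0n.
  rewrite /diff_quot /step.
  move: h1; rewrite -lerBrDl -ler_pdivlMl ?invr_gt0// invrK; lra.
have E'0 : int2 (E' n) @[n --> \oo] --> (0:R).
  have -> : (0:R) = int2 (fun=> 0) by rewrite /int2 Rintegral_cst// mul0r.
  apply: (int2_dominated _ _ (2 * L * m) m) => //.
  - by move=> n; case: (bE' n).
  - move=> n z; rewrite normrM ler_pM// m2L//; exact: diff_quot_bound.
  - by move=> n z /psiout; rewrite /E' => ->; rewrite mulr0.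
  apply: ae2S aez => z /= hz.
  have [p0|/hz {hz}hz] := eqVneq (psi z) 0.
    by rewrite /E' p0; under eq_fun do rewrite mulr0; exact: cvg_cst.
  apply: cvg_pos_part => e e0.
  have := near_step _ (hz e e0); apply: filterS => n /= [_ h1].
  have n0 : (0 : R) < n.+1%:R by rewrite ltr0n.
  rewrite /diff_quot subrK /step.
  have : N z - N (z - n.+1%:R^-1 *: a) <= n.+1%:R^-1 * (g z + e).
    by rewrite lerBlDl -lerBlDr.
  rewrite -ler_pdivrMl ?invr_gt0// invrK; lra.
have D0 : int2 (D n) @[n --> \oo] --> (0:R).
  have -> : (0:R) = int2 (fun=> 0) by rewrite /int2 Rintegral_cst// mul0r.
  apply: (int2_dominated _ _ (L * (m + m)) (m + `|a.1| + `|a.2|)) => //.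
  - by move=> n; case: (bD n).
  - move=> n z; rewrite /D normrM (ger0_norm L0) normr_id ler_wpM2l//.
    by rewrite (le_trans (ler_normB _ _))// lerD.
  - move=> n z zb; rewrite /D.
    have step1 : `|(n.+1%:R^-1 : R)| <= 1.
      by rewrite ger0_norm ?invr_ge0// invf_le1 ?ler1n ?ltr0n.
    have [ha1 ha2] := (normr_ge0 a.1, normr_ge0 a.2).
    have m0 : 0 <= m by apply: le_trans (psim 0).
    have sa (u v : R) : `|u + n.+1%:R^-1 * v| <= m -> `|u| <= m + `|v|.
      move=> uv; have := ler_normB (u + n.+1%:R^-1 * v) (n.+1%:R^-1 * v).
      rewrite addrK normrM => /le_trans; apply; apply: lerD => //.
      by rewrite ler_piMl.
    rewrite !psiout ?subrr ?normr0 ?mulr0//.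
      by move=> zb'; apply: zb; apply: box_le zb'; lra.
    move=> [/= /sa h1 /sa h2]; apply: zb; split => /=; [apply: (le_trans h1)|apply: (le_trans h2)]; lra.
  apply: aeW => z; rewrite /D.
  suff : psi (z + step a n) @[n --> \oo] --> psi z.
    move=> H; have H2 : psi (z + step a n) - psi z @[n --> \oo] --> psi z - psi z.
      by apply: cvgB => //; exact: cvg_cst.
    have := cvg_norm H2; rewrite subrr normr0 => H3.
    by have := cvgM (cvg_cst L) (H3 _); rewrite mulr0; apply.
  apply: (cvg_comp (fun n => z + step a n) psi); last exact: cpsi.
  have H : (n.+1%:R^-1 : R) *: a @[n --> \oo] --> (0:R) *: a.
    by apply: cvgZr_tmp; exact: (@cvg_harmonic R).
  by have := cvgD (cvg_cst z) H; rewrite scale0r addr0; apply.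
have key n : `|int2 (fun z => diff_quot a N n z * psi z) - int2 (fun z => g z * psi z)| <=
   int2 (E n) + int2 (E' n) + int2 (D n).
  have e1 : int2 (fun z => g z * psi z) - int2 (fun z => diff_quot a N n z * psi z) <= int2 (E n).
    rewrite -int2B//; apply: le_int2 => //; first exact: bsuppB.
    by move=> z; rewrite -mulrBl /E ler_wpM2r// le_max lexx.
  have bqs : bsupp (fun z => diff_quot a N n (z - step a n) * psi z).
    by apply: (bsuppM _ _ L) => // z; exact: diff_quot_bound.
  have bqs' : bsupp (fun z => diff_quot a N n z * psi (z + step a n)).
    apply: (bsuppM _ _ L) => //; [exact: bsupp_shift|exact: measurable_diff_quot|exact: diff_quot_bound].
  have e2 : int2 (fun z => diff_quot a N n (z - step a n) * psi z) - int2 (fun z => g z * psi z) <= int2 (E' n).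
    rewrite -int2B//; apply: le_int2 => //; first exact: bsuppB.
    by move=> z; rewrite -mulrBl /E' ler_wpM2r// le_max lexx.
  have e3 : int2 (fun z => diff_quot a N n (z - step a n) * psi z) = int2 (fun z => diff_quot a N n z * psi (z + step a n)).
    rewrite -(int2_shift _ (step a n) bqs); congr int2; apply/funext => z.
    by rewrite addrK.
  have e4 : int2 (fun z => diff_quot a N n z * psi z) - int2 (fun z => diff_quot a N n z * psi (z + step a n)) <= int2 (D n).
    rewrite -int2B//; apply: le_int2 => //; first exact: bsuppB.
    move=> z; rewrite -mulrBr /D; apply: (le_trans (ler_norm _)).
    by rewrite normrM distrC ler_wpM2r// diff_quot_bound.
  have E0' : 0 <= int2 (E n).
    by apply: Rintegral_ge0 => z _; rewrite /E mulr_ge0// le_max lexx orbT.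
  have E'0' : 0 <= int2 (E' n).
    by apply: Rintegral_ge0 => z _; rewrite /E' mulr_ge0// le_max lexx orbT.
  have D0' : 0 <= int2 (D n).
    by apply: Rintegral_ge0 => z _; rewrite /D mulr_ge0.
  by rewrite ler_norml; apply/andP; split; lra.
apply/cvgrPdist_le => e e0.
have S0 : int2 (E n) + int2 (E' n) + int2 (D n) @[n --> \oo] --> (0:R).
  by rewrite -[X in _ --> X](addr0 0) -[X in X + 0](addr0 0); apply: cvgD => //; exact: cvgD.
move/cvgrPdist_le : S0 => /(_ e e0); apply: filterS => n.
rewrite sub0r normrN => h; rewrite distrC (le_trans (key n))//.
exact: le_trans (ler_norm _) h.
Qed.

Lemma continuous_posneg (psi : R * R -> R) : continuous psi ->
  continuous (fun z => Num.max (psi z) 0).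
Proof.
move=> c z; apply: (@continuous_comp _ _ _ psi (fun x => Num.max x 0)); first exact: c.
by apply: continuous_max => //; exact: cvg_cst.
Qed.

Lemma bsupp_max (psi : R * R -> R) : bsupp psi -> bsupp (fun z => Num.max (psi z) 0).
Proof.
move=> [mf [m [fm f0]]]; split; first by apply: measurable_maxr => //; exact: measurable_cst.
exists m; split => [z|z /f0 ->]; last by rewrite maxxx.
by rewrite ger0_norm ?le_max ?lexx ?orbT// ge_max (le_trans _ (fm z)) ?(le_trans _ (fm z)) ?ler_norm.
Qed.

Lemma diff_quot_cvg (psi : R * R -> R) : bsupp psi -> continuous psi ->
  {ae mu2, forall z, psi z != 0 -> lower_slope z} ->
  int2 (fun z => diff_quot a N n z * psi z) @[n --> \oo] --> int2 (fun z => g z * psi z).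
Proof.
move=> bpsi cpsi aez.
pose p1 z := Num.max (psi z) 0; pose p2 z := Num.max (- psi z) 0.
have pE z : psi z = p1 z - p2 z.
  by rewrite /p1 /p2; case: (lerP (psi z) 0) => h; case: (lerP (- psi z) 0) => h'; lra.
have bN : bsupp (fun z => - psi z).
  by rewrite (_ : (fun z => _) = (fun z => -1 * psi z)); [exact: bsuppZ|apply/funext => z; rewrite mulN1r].
have b1 : bsupp p1 by exact: bsupp_max.
have b2 : bsupp p2 by exact: bsupp_max.
have c1 : int2 (fun z => diff_quot a N n z * p1 z) @[n --> \oo] --> int2 (fun z => g z * p1 z).
  apply: diff_quot_cvg_ge0 => //; first exact: continuous_posneg.
    by move=> z; rewrite le_max lexx orbT.
  apply: ae2S aez => z h p0; apply: h; apply: contra_neq p0 => p0.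
  by rewrite /p1 p0 maxxx.
have c2 : int2 (fun z => diff_quot a N n z * p2 z) @[n --> \oo] --> int2 (fun z => g z * p2 z).
  apply: diff_quot_cvg_ge0 => //.
  - by apply: continuous_posneg => z; apply: continuousN; exact: cpsi.
  - by move=> z; rewrite le_max lexx orbT.
  apply: ae2S aez => z h p0; apply: h; apply: contra_neq p0 => p0.
  by rewrite /p2 p0 oppr0 maxxx.
have bq (h : R * R -> R) n : bsupp h -> bsupp (fun z => diff_quot a N n z * h z).
  by move=> bh; apply: (bsuppM _ _ L) => //; [exact: measurable_diff_quot|exact: diff_quot_bound].
have bgg (h : R * R -> R) : bsupp h -> bsupp (fun z => g z * h z) by move=> bh; apply: (bsuppM _ _ L).
rewrite (_ : (fun n => _) = (fun n => int2 (fun z => diff_quot a N n z * p1 z) - int2 (fun z => diff_quot a N n z * p2 z))); last first.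
  apply/funext => n; rewrite -int2B; [|exact: bq|exact: bq].
  by congr int2; apply/funext => z; rewrite -mulrBr -pE.
rewrite (_ : int2 _ = int2 (fun z => g z * p1 z) - int2 (fun z => g z * p2 z)); last first.
  rewrite -int2B; [|exact: bgg|exact: bgg].
  by congr int2; apply/funext => z; rewrite -mulrBr -pE.
exact: cvgB.
Qed.

End WeakQuotient.

(** * Test functions *)

Section TestFunction.
Context {R : realType}.
Notation mu := (@lebesgue_measure R).
Notation mu2 := (mu \x mu)%E.
Notation P := (measurableTypeR R * measurableTypeR R)%type.
Implicit Types phi : R * R -> R.

Definition et : R * R := (1, 0).
Definition ex : R * R := (0, 1).

Lemma addetE (z : R * R) (h : R) : z + h *: et = (z.1 + h, z.2).
Proof.
apply: injective_projections.
  by change (z.1 + h * 1 = z.1 + h); rewrite mulr1.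
by change (z.2 + h * 0 = z.2); rewrite mulr0 addr0.
Qed.

Lemma addexE (z : R * R) (h : R) : z + h *: ex = (z.1, z.2 + h).
Proof.
apply: injective_projections.
  by change (z.1 + h * 0 = z.1); rewrite mulr0 addr0.
by change (z.2 + h * 1 = z.2 + h); rewrite mulr1.
Qed.

Lemma plane_compact_box (K : set (R * R)) : compact K -> exists2 m, 0 <= m & K `<=` box m.
Proof.
move=> cK.
have b1 (f : R * R -> R) : continuous f -> exists M, forall z, K z -> `|f z| <= M.
  move=> cf; have : compact (f @` K).
    by apply: continuous_compact => //; apply: continuous_subspaceT.
  move=> /compact_bounded[M [_ hM]]; exists (M + 1) => z Kz.
  by apply: (hM (M + 1)); [rewrite ltrDl|exists z].
have [M1 h1] := b1 fst (fun z => cvg_fst).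
have [M2 h2] := b1 snd (fun z => cvg_snd).
exists (`|M1| + `|M2|); first by rewrite addr_ge0.
move=> z Kz; split.
  by rewrite (le_trans (h1 z Kz))// (le_trans (ler_norm _))// lerDl.
by rewrite (le_trans (h2 z Kz))// (le_trans (ler_norm _))// lerDr.
Qed.

Lemma bsupp_compact (f : R * R -> R) (K : set (R * R)) : continuous f -> compact K ->
  (forall z, ~ K z -> f z = 0) -> bsupp f.
Proof.
move=> cf cK f0; split; first exact: continuous_plane_measurable.
have [m m0 Km] := plane_compact_box _ cK.
have : compact (f @` K).
  by apply: continuous_compact => //; apply: continuous_subspaceT.
move=> /compact_bounded[M [_ hM]].
have M1 z : K z -> `|f z| <= M + 1.
  by move=> Kz; apply: (hM (M + 1)); [rewrite ltrDl|exists z].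
exists (`|M + 1| + m); split.
  move=> z; have [Kz|/f0 ->] := pselect (K z).
    by rewrite (le_trans (M1 z Kz))// (le_trans (ler_norm _))// lerDl.
  by rewrite normr0 addr_ge0.
move=> z zb; apply: f0 => /Km h; apply: zb; apply: box_le h; by rewrite lerDr.
Qed.

Lemma derive_outside phi (K : set (R * R)) v : closed K ->
  (forall z, ~ K z -> phi z = 0) -> forall z, ~ K z -> 'D_v phi z = 0.
Proof.
move=> cK phi0 z zK.
have oK : open (~` K) by rewrite openC.
have nz : \forall y \near z, (~` K) y by apply: open_nbhs_nbhs; split.
rewrite (near_eq_derive (g := cst 0)) ?derive_cst//.
by apply: filterS nz => y /phi0.
Qed.

Lemma is_derive_line phi v z : (forall y, differentiable phi y) ->
  forall s : R, is_derive s (1:R) (fun s => phi (z + s *: v)) ('D_v phi (z + s *: v)).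
Proof.
move=> dphi s.
have dv : derivable phi (z + s *: v) v by exact: diff_derivable.
have E : (fun h : R => h^-1 *: (((fun s => phi (z + s *: v)) \o shift s) (h *: (1:R)) - phi (z + s *: v)))
       = (fun h : R => h^-1 *: ((phi \o shift (z + s *: v)) (h *: v) - phi (z + s *: v))).
  apply/funext => h /=; congr (_ *: (phi _ - _)).
  by rewrite -[h *: 1]/(h * 1) mulr1 scalerDl addrCA addrC -addrA.
apply: DeriveDef; first by rewrite /derivable E.
by rewrite /derive E.
Qed.

Lemma step_diff_quot_cvg phi v z : (forall y, differentiable phi y) ->
  diff_quot v phi n (z - step v n) @[n --> \oo] --> 'D_v phi z.
Proof.
move=> dphi.
have dv : (fun h : R => h^-1 *: ((phi \o shift z) (h *: v) - phi z)) @ 0^' --> 'D_v phi z.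
  by have : derivable phi z v by exact: diff_derivable.
have /cvgr_dnbhsP := dv.
move=> /(_ (fun n => - n.+1%:R^-1)) H.
rewrite (_ : (fun n => _) = (fun n : nat => (- (n.+1%:R : R)^-1)^-1 *: ((phi \o shift z) (- (n.+1%:R : R)^-1 *: v) - phi z))).
  apply: H; split.
    by move=> n; rewrite oppr_eq0 invr_eq0 pnatr_eq0.
  by rewrite -[X in _ --> X]oppr0; apply: cvgN; exact: (@cvg_harmonic R).
apply/funext => n; rewrite /diff_quot subrK /step /= invrN invrK scaleNr.
rewrite scaleNr [- (_ *: _) + z]addrC -scalerN opprB //.
Qed.

(** The mean value theorem along a line bounds the quotients uniformly in [n],
    as dominated convergence requires. *)
Lemma step_diff_quot_bound phi v C n z : (forall y, differentiable phi y) ->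
  (forall y, `|'D_v phi y| <= C) -> `|diff_quot v phi n (z - step v n)| <= C.
Proof.
move=> dphi DC.
set h : R := n.+1%:R^-1.
have n0 : (0 : R) < n.+1%:R by rewrite ltr0n.
have h0 : 0 < h by rewrite invr_gt0.
pose f s := phi (z - step v n + s *: v).
have df := is_derive_line phi v (z - step v n) dphi.
have cf : {within `[0, h], continuous f}.
  apply: continuous_subspaceT => s; apply: differentiable_continuous.
  by apply/derivable1_diffP; case: (df s).
have [c _ E] := @MVT R f (fun s => 'D_v phi (z - step v n + s *: v)) 0 h h0
   (fun s _ => df s) cf.
rewrite /diff_quot; move: E; rewrite /f scale0r addr0 subr0 -/(step v n) => ->.
by rewrite mulrCA mulfV ?mulr1// lt0r_neq0.
Qed.

Lemma C1c_past phi z : C1c phi -> z.1 <= 0 -> dt phi z = 0 /\ dx phi z = 0.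
Proof.
move=> [_ _ _ [K [cK Khalf phi0]]] z0.
have clK : closed K by apply: compact_closed => //; exact: norm_hausdorff.
have zK : ~ K z by move=> /Khalf; rewrite /halfplane/= ltNge z0.
by split; exact: (derive_outside _ K).
Qed.

Lemma C1c_bsupp phi : C1c phi -> [/\ bsupp phi, bsupp (dt phi) & bsupp (dx phi)].
Proof.
move=> [dphi cdt cdx [K [cK _ phi0]]].
have clK : closed K by apply: compact_closed => //; exact: norm_hausdorff.
split.
- by apply: bsupp_compact phi0 => // z; apply: differentiable_continuous.
- by apply: (bsupp_compact _ K) => //; exact: derive_outside.
- by apply: (bsupp_compact _ K) => //; exact: derive_outside.
Qed.

End TestFunction.

Lemma lipschitz_plane_continuous {R : realType} (N : R * R -> R) (L : R) :
  (forall z z', `|N z' - N z| <= L * (`|z'.1 - z.1| + `|z'.2 - z.2|)) -> continuous N.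
Proof.
move=> NL z; apply/cvgrPdist_lt => e e0.
have L1 : 0 < `|L| + 1 by rewrite ltr_wpDl.
have d0 : 0 < e / (2 * (`|L| + 1)) by rewrite divr_gt0// mulr_gt0.
apply: filterS (nbhsx_ballx z _ d0) => y [/= h1 h2].
rewrite /ball/= in h1 h2.
rewrite distrC (le_lt_trans (NL z y))// -(distrC z.1) -(distrC z.2).
apply: (@le_lt_trans _ _ ((`|L| + 1) * (`|z.1 - y.1| + `|z.2 - y.2|))).
  rewrite ler_wpM2r ?addr_ge0// (le_trans (ler_norm _))// lerDl//.
rewrite mulrC -ltr_pdivlMr//.
have -> : e / (`|L| + 1) = e / (2 * (`|L| + 1)) + e / (2 * (`|L| + 1)).
  by field; rewrite gt_eqF.
exact: ltrD.
Qed.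

(** * Subgradients are weak gradients *)

Section WeakGradient.
Context {R : realType}.
Notation mu := (@lebesgue_measure R).
Notation mu2 := (mu \x mu)%E.
Notation P := (measurableTypeR R * measurableTypeR R)%type.

(** Frechet subgradients: the lower half of the definition of
    differentiability. *)
Definition subgrad (N : R * R -> R) (z : R * R) (gt gx : R) : Prop :=
  forall e, 0 < e -> exists2 d, 0 < d &
    forall t x, `|t - z.1| < d -> `|x - z.2| < d ->
      N z + gt * (t - z.1) + gx * (x - z.2) - e * (`|t - z.1| + `|x - z.2|) <= N (t, x).

Variables (N gt gx : R * R -> R) (L : R).
Hypothesis NL : forall z z', `|N z' - N z| <= L * (`|z'.1 - z.1| + `|z'.2 - z.2|).
Hypothesis mgt : measurable_fun [set: P] gt.
Hypothesis mgx : measurable_fun [set: P] gx.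
Hypothesis gtL : forall z, `|gt z| <= L.
Hypothesis gxL : forall z, `|gx z| <= L.
Hypothesis Nsub : {ae mu2, forall z, 0 < z.1 -> subgrad N z (gt z) (gx z)}.

Let L0 : 0 <= L. Proof. exact: le_trans (gxL 0). Qed.

Lemma bsupp_lipschitz f : bsupp f -> bsupp (fun z => N z * f z).
Proof.
move=> [mf [m [fm f0]]]; split.
  by apply: measurable_funM => //; apply: continuous_plane_measurable; exact: lipschitz_plane_continuous NL.
have m0 : 0 <= m by apply: le_trans (fm 0).
have C0 : 0 <= (`|N 0| + L * (m + m)) by rewrite addr_ge0// mulr_ge0// addr_ge0.
exists (m + (`|N 0| + L * (m + m)) * m); split => z.
  have [[zb1 zb2]|zb] := pselect (box m z); last first.
    by rewrite f0// mulr0 normr0 addr_ge0// mulr_ge0.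
  rewrite normrM (@le_trans _ _ ((`|N 0| + L * (m + m)) * m)) ?lerDr//.
  apply: ler_pM => //.
  have -> : N z = N 0 + (N z - N 0) by rewrite addrC subrK.
  rewrite (le_trans (ler_normD _ _))// lerD2l (le_trans (NL 0 z))//.
  by rewrite ler_wpM2l// !subr0 lerD.
move=> zb; rewrite f0 ?mulr0// => h; apply: zb; apply: box_le h.
by rewrite lerDl mulr_ge0.
Qed.

(** Summation by parts in both directions: each side is the mixed second
    difference, with steps [s] and [t], of the correlation of [N] with [phi],
    and such a difference is symmetric in its steps. *)
Lemma swap_steps phi (s t : R * R) : bsupp phi ->
  int2 (fun z => (N (z + s) - N z) * (phi z - phi (z - t))) =
  int2 (fun z => (N (z + t) - N z) * (phi z - phi (z - s))).
Proof.
move=> bphi; pose J (a : R * R) := int2 (fun z => N z * phi (z - a)).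
have bJ a : bsupp (fun z => N z * phi (z - a)).
  by apply: bsupp_lipschitz; exact: bsupp_shift.
suff H (a b : R * R) : int2 (fun z => (N (z + a) - N z) * (phi z - phi (z - b))) =
    (J a - J (a + b)) - (J 0 - J b).
  by rewrite !H [t + s]addrC; ring.
have bS (c : R * R) : bsupp (fun z => N (z + a) * phi (z - c)).
  have := bsupp_shift _ a (bJ (c + a)).
  rewrite (_ : (fun z => _) = (fun z => N (z + a) * phi (z - c)))//.
  by apply/funext => z; congr (_ * phi _); rewrite opprD addrACA subrr addr0.
have JS (c : R * R) : int2 (fun z => N (z + a) * phi (z - c)) = J (c + a).
  rewrite /J -(int2_shift _ a (bJ _)); congr int2; apply/funext => z.
  by congr (_ * phi _); rewrite opprD addrACA subrr addr0.
have <- : J (0 + a) = J a by rewrite add0r.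
rewrite [a + b]addrC -!JS /J.
rewrite -int2B// -int2B// -int2B; [|exact: bsuppB|exact: bsuppB].
by congr int2; apply/funext => z; rewrite !subr0; ring.
Qed.

(** A subgradient field of a Lipschitz function is curl free in the sense of
    distributions. This follows from [swap_steps] with steps along the two axes:
    a subgradient is a lower slope in each direction, so the difference
    quotients of [N] converge weakly to it, while those of [phi] converge
    boundedly to its partial derivatives. *)
Lemma weak_gradient phi : C1c phi ->
  int2 (fun z => gx z * dt phi z) = int2 (fun z => gt z * dx phi z).
Proof.
move=> cphi1; have [bphi bdt bdx] := C1c_bsupp phi cphi1.
case: cphi1 => [dphi cdt cdx [K [cK Khalf phi0]]].
have clK : closed K by apply: compact_closed => //; exact: norm_hausdorff.
have dt0 z : ~ K z -> dt phi z = 0 by exact: derive_outside.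
have dx0 z : ~ K z -> dx phi z = 0 by exact: derive_outside.
have mN : measurable_fun [set: P] N by apply: continuous_plane_measurable; exact: lipschitz_plane_continuous NL.
have NLt z h : `|N (z + h *: et) - N z| <= L * `|h|.
  have := NL z (z + h *: et); rewrite addetE /= subrr normr0 addr0.
  by rewrite addrAC subrr add0r.
have NLx z h : `|N (z + h *: ex) - N z| <= L * `|h|.
  have := NL z (z + h *: ex); rewrite addexE /= subrr normr0 add0r.
  by rewrite addrAC subrr add0r.
have lt : {ae mu2, forall z, dx phi z != 0 -> lower_slope et N gt z}.
  apply: ae2S Nsub => z hz p0.
  have Kz : K z by apply: contrapT => /dx0 p; rewrite p eqxx in p0.
  move=> e e0; have [d d0 hd] := hz (Khalf _ Kz) e e0.
  near=> h.
  have h0 : 0 < h by near: h; exact: nbhs_right_gt.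
  have hd' : h < d by near: h; exact: nbhs_right_lt.
  have x0 : `|z.2 - z.2| < d by rewrite subrr normr0.
  rewrite addetE (_ : z - h *: et = (z.1 - h, z.2)); last by rewrite -scaleNr addetE.
  split.
    have := hd (z.1 + h) z.2; rewrite addrAC subrr add0r gtr0_norm// => /(_ hd' x0).
    by rewrite subrr normr0; apply: le_trans; rewrite le_eqVlt; apply/orP; left; apply/eqP; ring.
  have := hd (z.1 - h) z.2; rewrite addrAC subrr add0r normrN gtr0_norm// => /(_ hd' x0).
  by rewrite subrr normr0; apply: le_trans; rewrite le_eqVlt; apply/orP; left; apply/eqP; ring.
have lx : {ae mu2, forall z, dt phi z != 0 -> lower_slope ex N gx z}.
  apply: ae2S Nsub => z hz p0.
  have Kz : K z by apply: contrapT => /dt0 p; rewrite p eqxx in p0.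
  move=> e e0; have [d d0 hd] := hz (Khalf _ Kz) e e0.
  near=> h.
  have h0 : 0 < h by near: h; exact: nbhs_right_gt.
  have hd' : h < d by near: h; exact: nbhs_right_lt.
  have x0 : `|z.1 - z.1| < d by rewrite subrr normr0.
  rewrite addexE (_ : z - h *: ex = (z.1, z.2 - h)); last by rewrite -scaleNr addexE.
  split.
    have := hd z.1 (z.2 + h) x0; rewrite addrAC subrr add0r gtr0_norm// => /(_ hd').
    by rewrite subrr normr0; apply: le_trans; rewrite le_eqVlt; apply/orP; left; apply/eqP; ring.
  have := hd z.1 (z.2 - h) x0; rewrite addrAC subrr add0r normrN gtr0_norm// => /(_ hd').
  by rewrite subrr normr0; apply: le_trans; rewrite le_eqVlt; apply/orP; left; apply/eqP; ring.
have Ct := diff_quot_cvg _ _ _ _ NLt mN mgt gtL _ bdx cdx lt.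
have Cx := diff_quot_cvg _ _ _ _ NLx mN mgx gxL _ bdt cdt lx.
(* Replacing the derivative of [phi] by its difference quotients, translated so
   that the steps can be swapped, does not change the limit. *)
have rep (a b : R * R) (g : R) : bsupp ('D_b phi) ->
    (forall z h, `|N (z + h *: a) - N z| <= L * `|h|) ->
    int2 (fun z => diff_quot a N n z * 'D_b phi z) @[n --> \oo] --> g ->
    int2 (fun z => diff_quot a N n z * diff_quot b phi n (z - step b n)) @[n --> \oo] --> g.
  move=> bD NLa cg.
  have [mD [m [Dm D0]]] := bD.
  have mq (c : R * R) (M : R * R -> R) n : measurable_fun [set: P] M -> measurable_fun [set: P] (diff_quot c M n).
    exact: measurable_diff_quot.
  have mphi : measurable_fun [set: P] phi by case: bphi.
  have bq n : bsupp (fun z => diff_quot a N n z * 'D_b phi z).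
    by apply: (bsuppM _ _ L) => //; [exact: mq|exact: diff_quot_bound].
  have bp n : bsupp (fun z => diff_quot b phi n (z - step b n)).
    apply: bsupp_shift; apply: bsuppZ; apply: bsuppB => //; exact: bsupp_shift.
  have bqp n : bsupp (fun z => diff_quot a N n z * diff_quot b phi n (z - step b n)).
    by apply: (bsuppM _ _ L) => //; [exact: mq|exact: diff_quot_bound].
  have [k [phik phi0k]] := bphi.2.
  pose B := k + m + `|b.1| + `|b.2|.
  have k0 : 0 <= k by apply: le_trans (phik 0).
  have m0 : 0 <= m by apply: le_trans (Dm 0).
  have [hb1 hb2] := (normr_ge0 b.1, normr_ge0 b.2).
  have Z : int2 (fun z => diff_quot a N n z * ('D_b phi z - diff_quot b phi n (z - step b n))) @[n --> \oo] --> (0 : R).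
    have -> : (0:R) = int2 (fun=> 0) by rewrite /int2 Rintegral_cst// mul0r.
    apply: (int2_dominated _ _ (L * (m + m)) B).
    - move=> n; apply: measurable_funM; first exact: mq.
      by apply: measurable_funB => //; case: (bp n).
    - exact: measurable_cst.
    - move=> n z; rewrite normrM ler_pM//; first exact: diff_quot_bound.
      by rewrite (le_trans (ler_normB _ _))// lerD// step_diff_quot_bound.
    - move=> n z zb.
      rewrite D0; last by move=> zb'; apply: zb; apply: box_le zb'; rewrite /B; lra.
      rewrite /diff_quot subrK phi0k; last by move=> zb'; apply: zb; apply: box_le zb'; rewrite /B; lra.
      rewrite phi0k ?subrr ?mulr0 ?subr0 ?mulr0//.
      have step1 : `|(n.+1%:R^-1 : R)| <= 1.
        by rewrite ger0_norm ?invr_ge0// invf_le1 ?ler1n ?ltr0n.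
      have sa (u v : R) : `|u - n.+1%:R^-1 * v| <= k -> `|u| <= k + `|v|.
        move=> uv; have := ler_normD (u - n.+1%:R^-1 * v) (n.+1%:R^-1 * v).
        rewrite subrK normrM => /le_trans; apply; apply: lerD => //.
        by rewrite ler_piMl.
      move=> [/= /sa h1 /sa h2]; apply: zb; rewrite /B; split => /=; [apply: (le_trans h1)|apply: (le_trans h2)]; lra.
    apply: aeW => z.
    have Dz := step_diff_quot_cvg phi b z dphi.
    apply/cvgrPdist_le => e e0.
    have e1 : 0 < e / (L + 1) by rewrite divr_gt0// ltr_wpDl.
    move/cvgrPdist_le : Dz => /(_ _ e1); apply: filterS => n h.
    rewrite sub0r normrN normrM.
    apply: (@le_trans _ _ (L * (e / (L + 1)))); first by apply: ler_pM => //; exact: diff_quot_bound.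
    by rewrite mulrCA ger_pMr// ler_pdivrMr ?mul1r ?lerDl// ltr_wpDl.
  have -> : g = g - 0 by rewrite subr0.
  rewrite (_ : (fun n => _) = (fun n => int2 (fun z => diff_quot a N n z * 'D_b phi z) -
     int2 (fun z => diff_quot a N n z * ('D_b phi z - diff_quot b phi n (z - step b n))))); last first.
    apply/funext => n; rewrite -int2B; [|exact: bq|].
      by congr int2; apply/funext => z; rewrite -mulrBr; congr (_ * _); ring.
    apply: (bsuppM _ _ L) => //; [exact: bsuppB|exact: mq|exact: diff_quot_bound].
  exact: cvgB.
have {}Ct := rep _ _ _ bdx NLt Ct.
have {}Cx := rep _ _ _ bdt NLx Cx.
have E : (fun n => int2 (fun z => diff_quot ex N n z * diff_quot et phi n (z - step et n))) =
         (fun n => int2 (fun z => diff_quot et N n z * diff_quot ex phi n (z - step ex n))).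
  apply/funext => n.
  have F (a b : R * R) : (fun z => diff_quot a N n z * diff_quot b phi n (z - step b n)) =
      (fun z => (n.+1%:R * n.+1%:R) * ((N (z + step a n) - N z) * (phi z - phi (z - step b n)))).
    by apply/funext => z; rewrite /diff_quot subrK; ring.
  have bF (a b : R * R) : bsupp (fun z => (N (z + step a n) - N z) * (phi z - phi (z - step b n))).
    apply: (bsuppM _ _ (L * (`|(step a n).1| + `|(step a n).2|))).
    - by apply: bsuppB => //; exact: bsupp_shift.
    - by apply: measurable_funB => //; apply: (measurableT_comp mN); exact: measurable_shift2.
    - move=> z; apply: (le_trans (NL z (z + step a n))) => /=.
      by rewrite [z.1 + _]addrC [z.2 + _]addrC !addrK.
  by rewrite !F !int2Z// swap_steps.
rewrite E in Cx.
exact: cvg_unique Cx Ct.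
Unshelve. all: by end_near.
Qed.

End WeakGradient.

(** * Oriented integrals *)

Lemma measurable_funV_gt0 d (T : measurableType d) (R : realType) (f : T -> R) :
  measurable_fun setT f -> (forall x, 0 < f x) -> measurable_fun setT (fun x => (f x)^-1).
Proof.
move=> mf f0.
have -> : (fun x => (f x)^-1) = (fun x : R => x^-1) \o f by [].
apply: (@measurable_comp _ _ _ _ _ _ (`]0, +oo[%classic : set R)) => //.
  by move=> _ [x _ <-] /=; rewrite in_itv/= f0.
apply: subspace_continuous_measurable_fun => //; apply: continuous_in_subspaceT => x.
rewrite inE/= in_itv/= andbT => x0.
by apply: inv_continuous; rewrite gt_eqF.
Qed.

Section Primitive.
Context {R : realType}.
Notation mu := (@lebesgue_measure R).
Notation T := (measurableTypeR R).
Implicit Types g h : R -> R.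

Definition bmeas g : Prop := measurable_fun [set: T] g /\ exists C, forall s, `|g s| <= C.

(** At most one of the two intervals has positive length, so this is the
    oriented integral from 0 to [a]. It is locked to keep the integrals folded
    during conversion. *)
Definition prim : (R -> R) -> R -> R := locked (fun g a =>
  (\int[mu]_(s in `[0, a]) g s)%R - (\int[mu]_(s in `[a, 0]) g s)%R).

Lemma primE g a : prim g a =
  (\int[mu]_(s in `[0, a]) g s)%R - (\int[mu]_(s in `[a, 0]) g s)%R.
Proof. by rewrite /prim -lock. Qed.

Definition pint g a b : R := prim g b - prim g a.

Lemma bmeas_integrable g a b : bmeas g -> mu.-integrable `[a, b] (EFin \o g).
Proof.
move=> [mg [C gC]].
have mI : (mu (`[a, b]%classic : set R) < +oo)%E.
  by rewrite lebesgue_measure_itv/=; case: ifP => _; rewrite -?EFinB ltry.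
apply: measurable_bounded_integrable => //.
- by apply: measurable_funTS.
- exists C; split; first by rewrite num_real.
  by move=> M CM s _ /=; rewrite (le_trans (gC s))// ltW.
Qed.

Lemma int_split g a b c : bmeas g -> a <= b -> b <= c ->
  (\int[mu]_(s in `[a, c]) g s)%R = (\int[mu]_(s in `[a, b]) g s)%R + (\int[mu]_(s in `[b, c]) g s)%R.
Proof.
move=> bg ab bc; apply/eqP; rewrite addrC -subr_eq; apply/eqP.
rewrite Rintegral_itvB//; last by apply: bmeas_integrable.
rewrite Rintegral_itv_obnd_cbnd//.
apply: integrableS (bmeas_integrable g b c bg) => //.
by apply: subset_itvr; rewrite bnd_simp.
Qed.

Lemma int_point g a : (\int[mu]_(s in `[a, a]) g s)%R = 0.
Proof. by rewrite set_itv1 Rintegral_set1. Qed.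

Lemma int_empty g a b : b < a -> (\int[mu]_(s in `[a, b]) g s)%R = 0.
Proof. by move=> ba; rewrite set_itv_ge ?Rintegral_set0// bnd_simp -ltNge. Qed.

Lemma pintE g a b : bmeas g -> a <= b -> pint g a b = (\int[mu]_(s in `[a, b]) g s)%R.
Proof.
move=> bg ab; rewrite /pint !primE.
have H c : 0 <= c -> (\int[mu]_(s in `[c, 0]) g s)%R = 0.
  rewrite le_eqVlt => /predU1P[<-|]; [exact: int_point|exact: int_empty].
have H' c : c <= 0 -> (\int[mu]_(s in `[0, c]) g s)%R = 0.
  rewrite le_eqVlt => /predU1P[->|]; [exact: int_point|exact: int_empty].
have [a0|a0] := leP 0 a.
  by rewrite (H a a0) (H b (le_trans a0 ab)) (int_split g 0 a b)//; ring.
have [b0|b0] := leP 0 b.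
  rewrite (H b b0) (H' a (ltW a0)) (int_split g a 0 b)//; last exact: ltW.
  by ring.
by rewrite (H' a (ltW a0)) (H' b (ltW b0)) (int_split g a b 0)//; [ring|exact: ltW].
Qed.

Lemma pint_opp g a b : pint g a b = - pint g b a.
Proof. by rewrite /pint; ring. Qed.

Lemma pint_le g h a b : bmeas g -> bmeas h -> a <= b ->
  (forall s, a <= s <= b -> g s <= h s) -> pint g a b <= pint h a b.
Proof.
move=> bg bh ab gh; rewrite !pintE//; apply: le_Rintegral => //; exact: bmeas_integrable.
Qed.

Lemma bmeas_cst c : bmeas (cst c).
Proof. by split; [exact: measurable_cst|exists `|c|]. Qed.

Lemma bmeasD g h : bmeas g -> bmeas h -> bmeas (fun s => g s + h s).
Proof.
move=> [mg [C gC]] [mh [D hD]]; split; first exact: measurable_funD.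
by exists (C + D) => s; rewrite (le_trans (ler_normD _ _))// lerD.
Qed.

Lemma bmeasM g h : bmeas g -> bmeas h -> bmeas (fun s => g s * h s).
Proof.
move=> [mg [C gC]] [mh [D hD]]; split; first exact: measurable_funM.
by exists (C * D) => s; rewrite normrM ler_pM.
Qed.

Lemma pint_cst c a b : pint (cst c) a b = c * (b - a).
Proof.
wlog ab : a b / a <= b.
  by move=> H; have [/H//|/ltW/H E] := leP a b; rewrite pint_opp E -mulrN opprB.
rewrite pintE//; last exact: bmeas_cst.
have mI : (mu (`[a, b]%classic : set R) = (b - a)%:E)%E.
  rewrite lebesgue_measure_itv/= lte_fin; case: ltP => // ba.
  by congr EFin; apply/eqP; rewrite eq_sym subr_eq0 eq_le ba ab.
by rewrite Rintegral_cst//; congr (_ * _); rewrite -[RHS]/(fine (b - a)%:E) -mI.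
Qed.

Lemma pintD g h a b : bmeas g -> bmeas h ->
  pint (fun s => g s + h s) a b = pint g a b + pint h a b.
Proof.
move=> bg bh; wlog ab : a b / a <= b.
  by move=> H; have [/H//|/ltW/H E] := leP a b; rewrite pint_opp E opprD -!pint_opp.
rewrite !pintE//; last exact: bmeasD.
by rewrite RintegralD//; exact: bmeas_integrable.
Qed.

Lemma pintZ c g a b : bmeas g -> pint (fun s => c * g s) a b = c * pint g a b.
Proof.
move=> bg; wlog ab : a b / a <= b.
  by move=> H; have [/H//|/ltW/H E] := leP a b; rewrite pint_opp E -mulrN -pint_opp.
rewrite !pintE//; last by apply: bmeasM => //; exact: bmeas_cst.
by rewrite RintegralZl//; exact: bmeas_integrable.
Qed.

Lemma pint_ge g m a b : bmeas g -> a <= b -> (forall s, a <= s <= b -> m <= g s) ->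
  m * (b - a) <= pint g a b.
Proof. by move=> bg ab h; rewrite -pint_cst; apply: pint_le => //; exact: bmeas_cst. Qed.

Lemma pint_leM g m a b : bmeas g -> a <= b -> (forall s, a <= s <= b -> g s <= m) ->
  pint g a b <= m * (b - a).
Proof. by move=> bg ab h; rewrite -pint_cst; apply: pint_le => //; exact: bmeas_cst. Qed.

Lemma pint_near g (l e a b : R) : bmeas g ->
  (forall s, Num.min a b <= s <= Num.max a b -> `|g s - l| <= e) ->
  `|pint g a b - l * (b - a)| <= e * `|b - a|.
Proof.
move=> bg; wlog ab : a b / a <= b.
  move=> H h; have [/H|/ltW/H E] := leP a b; first exact.
  rewrite pint_opp -(opprB a b) mulrN -opprD normrN normrN.
  by apply: E => s; rewrite minC maxC; exact: h.
rewrite min_l// max_r// => h.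
have ab0 : 0 <= b - a by rewrite subr_ge0.
rewrite (ger0_norm ab0) ler_norml; apply/andP; split.
  rewrite -mulNr lerBrDr -mulrDl; apply: pint_ge => // s /h.
  by rewrite ler_norml => /andP[? ?]; lra.
rewrite lerBlDr -mulrDl; apply: pint_leM => // s /h.
by rewrite ler_norml => /andP[? ?]; lra.
Qed.

End Primitive.

(** * The Lax-Oleinik formula for car positions *)

(** The data of a follow-the-leader flow with cars labelled by their initial
    positions. When car [s] drives at speed [a], the gap ahead of it is [k a s]
    times the initial one. Faster cars need larger gaps ([sp_mono]), strongly
    convexly so ([sp_conv]), and the initial speed [v0 s] corresponds to the
    initial gap ([sp_k0]). *)
Record spacing {R : realType} (k : R -> R -> R) (v0 : R -> R)
    (v1 vm k1 k2 m c L : R) : Prop := Spacing {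
  sp_v1 : 0 < v1;
  sp_vm : 0 < vm;
  sp_k1 : 0 < k1;
  sp_m : 0 < m;
  sp_c : 0 < c;
  sp_meas : forall a, 0 <= a <= vm -> measurable_fun [set: measurableTypeR R] (k a);
  sp_bound : forall a s, 0 <= a <= vm -> k1 <= k a s <= k2;
  sp_mono : forall a b s, 0 <= a -> a <= b -> b <= vm ->
    m * (b - a) <= k b s - k a s <= L * (b - a);
  sp_conv : forall l a b s, 0 <= l <= 1 -> 0 <= a <= vm -> 0 <= b <= vm ->
    k ((1 - l) * a + l * b) s + c * (l * (1 - l)) * (a - b) ^+ 2 <=
    (1 - l) * k a s + l * k b s;
  sp_v0 : forall s, v1 <= v0 s <= vm;
  sp_k0 : forall s, k (v0 s) s = 1 }.

Arguments sp_v1 {R k v0 v1 vm k1 k2 m c L} _.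
Arguments sp_vm {R k v0 v1 vm k1 k2 m c L} _.
Arguments sp_k1 {R k v0 v1 vm k1 k2 m c L} _.
Arguments sp_m {R k v0 v1 vm k1 k2 m c L} _.
Arguments sp_c {R k v0 v1 vm k1 k2 m c L} _.
Arguments sp_meas {R k v0 v1 vm k1 k2 m c L} _.
Arguments sp_bound {R k v0 v1 vm k1 k2 m c L} _.
Arguments sp_mono {R k v0 v1 vm k1 k2 m c L} _.
Arguments sp_conv {R k v0 v1 vm k1 k2 m c L} _.
Arguments sp_v0 {R k v0 v1 vm k1 k2 m c L} _.
Arguments sp_k0 {R k v0 v1 vm k1 k2 m c L} _.

Section LaxOleinik.
Context {R : realType}.
Context {k : R -> R -> R} {v0 : R -> R} {v1 vm k1 k2 m c L : R}.
Hypothesis hk : spacing k v0 v1 vm k1 k2 m c L.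

Let v1p : 0 < v1 := sp_v1 hk.
Let vmp : 0 < vm := sp_vm hk.
Let k1p : 0 < k1 := sp_k1 hk.
Let mp : 0 < m := sp_m hk.
Let cp : 0 < c := sp_c hk.
Let kmeas := sp_meas hk.
Let kbnd := sp_bound hk.
Let kmono := sp_mono hk.
Let kconv := sp_conv hk.
Let v0b := sp_v0 hk.
Let kv0 := sp_k0 hk.

Let in0 : 0 <= (0:R) <= vm. Proof. by rewrite lexx ltW. Qed.
Let inm : 0 <= vm <= vm. Proof. by rewrite lexx ltW. Qed.
Let k2p : 0 < k2.
Proof. by have /andP[h1 h2] := kbnd 0 0 in0; apply: lt_le_trans k1p (le_trans h1 h2). Qed.
Let mL : m <= L.
Proof.
have /andP[h1 h2] := kmono 0 vm 0 (lexx _) (ltW vmp) (lexx _).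
by move: (le_trans h1 h2); rewrite subr0 ler_pM2r.
Qed.
Let Lp : 0 < L. Proof. exact: lt_le_trans mp mL. Qed.

Lemma spacing_bmeas a : 0 <= a <= vm -> bmeas (k a).
Proof.
move=> ha; split; first exact: kmeas.
exists k2 => s; have /andP[h1 h2] := kbnd _ s ha.
by rewrite ger0_norm// (le_trans (ltW k1p) h1).
Qed.

Lemma pint_k_bound v a b : 0 <= v <= vm -> a <= b ->
  k1 * (b - a) <= pint (k v) a b <= k2 * (b - a).
Proof.
move=> hv ab; apply/andP; split; [apply: pint_ge|apply: pint_leM] => //; try exact: spacing_bmeas.
  by move=> s _; case/andP: (kbnd _ s hv).
by move=> s _; case/andP: (kbnd _ s hv).
Qed.

Lemma pint_k_mono v v' a b : 0 <= v -> v <= v' -> v' <= vm -> a <= b ->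
  m * (v' - v) * (b - a) <= pint (k v') a b - pint (k v) a b <= L * (v' - v) * (b - a).
Proof.
move=> v0' vv' v'm ab.
have hv : 0 <= v <= vm by rewrite v0' (le_trans vv').
have hv' : 0 <= v' <= vm by rewrite v'm (le_trans v0').
have E : pint (k v') a b - pint (k v) a b = pint (fun s => k v' s + (- 1) * k v s) a b.
  rewrite pintD; [|exact: spacing_bmeas|apply: (bmeasM (cst (-1))); [exact: bmeas_cst|exact: spacing_bmeas]].
  by rewrite pintZ ?mulN1r//; exact: spacing_bmeas.
have bm : bmeas (fun s => k v' s + (- 1) * k v s).
  by apply: bmeasD; [exact: spacing_bmeas|apply: (bmeasM (cst (-1))); [exact: bmeas_cst|exact: spacing_bmeas]].
rewrite E; apply/andP; split; [apply: pint_ge|apply: pint_leM] => // s _;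
  by rewrite mulN1r; case/andP: (kmono _ _ s v0' vv' v'm).
Qed.

(** Integrated form of [sp_mono], for an interval of either orientation. *)
Lemma pint_k_lip v v' a b : 0 <= v <= vm -> 0 <= v' <= vm ->
  `|pint (k v') a b - pint (k v) a b| <= L * `|v' - v| * `|b - a|.
Proof.
wlog vv' : v v' / v <= v'.
  move=> H hv hv'; have [/H|/ltW/H E] := leP v v'; first exact.
  by rewrite distrC [`|v' - v|]distrC; exact: E.
move=> /andP[v0' _] /andP[_ v'm].
wlog ab : a b / a <= b.
  move=> H; have [/H//|/ltW/H E] := leP a b.
  by rewrite [pint (k v') _ _]pint_opp [pint (k v) _ _]pint_opp -opprD normrN [`|b - a|]distrC.
have /andP[h1 h2] := pint_k_mono _ _ _ _ v0' vv' v'm ab.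
rewrite [`|v' - v|]ger0_norm ?subr_ge0// [`|b - a|]ger0_norm ?subr_ge0//.
rewrite ger0_norm//; apply: le_trans h1; rewrite !mulr_ge0 ?subr_ge0//; exact: ltW.
Qed.

Lemma convex_in (l v v' : R) : 0 <= l <= 1 -> 0 <= v <= vm -> 0 <= v' <= vm ->
  0 <= (1 - l) * v + l * v' <= vm.
Proof. by move=> /andP[? ?] /andP[? ?] /andP[? ?]; apply/andP; split; nra. Qed.

Lemma pint_k_conv l v v' a b : 0 <= l <= 1 -> 0 <= v <= vm -> 0 <= v' <= vm -> a <= b ->
  pint (k ((1 - l) * v + l * v')) a b + c * (l * (1 - l)) * (v - v') ^+ 2 * (b - a) <=
  (1 - l) * pint (k v) a b + l * pint (k v') a b.
Proof.
move=> hl hv hv' ab.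
have hmid := convex_in _ _ _ hl hv hv'.
have [bv bv'] := (spacing_bmeas _ hv, spacing_bmeas _ hv').
have b1 := bmeasM (cst (1 - l)) _ (bmeas_cst _) bv.
have b2 := bmeasM (cst l) _ (bmeas_cst _) bv'.
rewrite -(pintZ (1 - l) _ _ _ bv) -(pintZ l _ _ _ bv') -(pintD _ _ _ _ b1 b2).
rewrite -pint_cst -(pintD _ _ _ _ (spacing_bmeas _ hmid) (bmeas_cst _)).
apply: pint_le => //; [|exact: bmeasD|by move=> s _; exact: kconv].
by apply: bmeasD; [exact: spacing_bmeas|exact: bmeas_cst].
Qed.

(** The position of car [a] at time [t] if car [b] drove at the constant speed
    [v] since time 0 and all the cars between them were spaced for the speed
    [v]. *)
Definition candidate : R -> R -> R -> R -> R := locked (fun t a b v => b + v * t - pint (k v) a b).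

Lemma candidateE t a b v : candidate t a b v = b + v * t - pint (k v) a b.
Proof. by rewrite /candidate -lock. Qed.

Lemma candidate_shift t a b v t' a' b' :
  candidate t' a' b' v = candidate t a b v + (b' - b) + v * (t' - t) + pint (k v) a a' - pint (k v) b b'.
Proof. by rewrite !candidateE /pint; ring. Qed.

Lemma candidate_lip_speed t a b v v' : 0 <= v <= vm -> 0 <= v' <= vm ->
  `|candidate t a b v' - candidate t a b v| <= (`|t| + L * `|b - a|) * `|v' - v|.
Proof.
move=> hv hv'.
have -> : candidate t a b v' - candidate t a b v = (v' - v) * t - (pint (k v') a b - pint (k v) a b).
  by rewrite !candidateE; ring.
rewrite (le_trans (ler_normB _ _))// [leRHS]mulrDl; apply: lerD.
  by rewrite normrM mulrC.
by rewrite (le_trans (pint_k_lip _ _ _ _ hv hv'))// mulrAC.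
Qed.

Lemma lipschitz_within (f : R -> R) (C a b : R) :
  (forall x y, a <= x <= b -> a <= y <= b -> `|f y - f x| <= C * `|y - x|) ->
  {within `[a, b], continuous f}.
Proof.
move=> H.
apply/(subspace_continuousP).
move=> x; rewrite /= in_itv/= => xab; apply/cvgrPdist_le => e e0.
have C1 : 0 < `|C| + 1 by rewrite ltr_wpDl.
have d0 : 0 < e / (`|C| + 1) by rewrite divr_gt0.
rewrite near_withinE; apply: filterS (nbhsx_ballx x _ d0) => y; rewrite /ball/= => xy.
rewrite in_itv/= => yab; rewrite distrC (le_trans (H _ _ xab yab))//.
rewrite distrC (@le_trans _ _ ((`|C| + 1) * `|x - y|))//.
  by rewrite ler_wpM2r// (le_trans (ler_norm _))// lerDl.
by rewrite mulrC -ler_pdivlMr// ltW.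
Qed.

Lemma exists_best_speed t a b : exists v, 0 <= v <= vm /\
  forall v', 0 <= v' <= vm -> candidate t a b v' <= candidate t a b v.
Proof.
have [v hv H] := @EVT_max R (candidate t a b) 0 vm (ltW vmp)
  (lipschitz_within _ _ _ _ (fun x y hx hy => candidate_lip_speed t a b x y hx hy)).
exists v; split; first by move: hv; rewrite in_itv.
by move=> v' hv'; apply: H; rewrite in_itv.
Qed.

Definition speed : R -> R -> R -> R := locked (fun t a b => sval (cid (exists_best_speed t a b))).

Lemma speed_in t a b : 0 <= speed t a b <= vm.
Proof. by rewrite /speed -lock; case: cid => v []. Qed.

Lemma speed_max t a b v : 0 <= v <= vm -> candidate t a b v <= candidate t a b (speed t a b).
Proof. by rewrite /speed -lock; case: cid => w [] /= _; apply. Qed.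

(** The maximum over the speeds is the centred rarefaction fan that starts at
    car [b]. *)
Definition best t a b : R := candidate t a b (speed t a b).

Lemma best_diff t a b t' a' b' : best t' a' b' - best t a b <=
  vm * `|t' - t| + k2 * `|a' - a| + (1 + k2) * `|b' - b|.
Proof.
set v := speed t' a' b'; have hv : 0 <= v <= vm := speed_in _ _ _.
have h := speed_max t a b v hv.
have P x y : `|pint (k v) x y| <= k2 * `|y - x|.
  wlog xy : x y / x <= y.
    move=> H; have [/H//|/ltW/H] := leP x y.
    by move=> h'; rewrite pint_opp normrN [`|y - x|]distrC.
  have /andP[h1 h2] := pint_k_bound v x y hv xy.
  rewrite [`|y - x|]ger0_norm ?subr_ge0// ger0_norm//; apply: le_trans h1.
  by rewrite mulr_ge0 ?subr_ge0// ltW.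
rewrite /best -/v (candidate_shift t a b v).
have := P a a'; rewrite ler_norml => /andP[_ p1].
have := P b b'; rewrite ler_norml => /andP[p2 _].
have p3 : v * (t' - t) <= vm * `|t' - t|.
  rewrite (le_trans (ler_norm _))// normrM ler_wpM2r//.
  by case/andP: hv => ? ?; rewrite ger0_norm.
have := ler_norm (b' - b); rewrite /best; lra.
Qed.

Lemma best_lip t a b t' a' b' : `|best t' a' b' - best t a b| <=
  vm * `|t' - t| + k2 * `|a' - a| + (1 + k2) * `|b' - b|.
Proof.
rewrite ler_norml best_diff andbT lerNl opprB.
by have := best_diff t' a' b' t a b; rewrite (distrC t t') (distrC a a') (distrC b b').
Qed.

(** A bound, justified by [best_far], on how far ahead of a car the minimizers
    of its best candidate lie. *)
Definition reach (t : R) : R := vm / (m * v1) * t.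

Lemma reach_ge0 t : 0 <= t -> 0 <= reach t.
Proof. by move=> t0; rewrite mulr_ge0// divr_ge0 ?mulr_ge0// ltW. Qed.

Lemma best_self t a : 0 <= t -> best t a a <= a + vm * t.
Proof.
move=> t0; rewrite /best candidateE /pint subrr subr0 lerD2l ler_wpM2r//.
by case/andP: (speed_in t a a).
Qed.

(** At the largest speed all gaps are at least the initial ones, so the fan of a
    car behind [a] gives [a] no smaller a position than its own fan. *)
Lemma best_left t a b : 0 <= t -> b <= a -> best t a a <= best t a b.
Proof.
move=> t0 ba; apply: (le_trans (best_self _ _ t0)).
apply: (le_trans _ (speed_max t a b vm inm)).
rewrite candidateE pint_opp opprK.
have : 1 * (a - b) <= pint (k vm) b a.
  apply: pint_ge => //; first exact: spacing_bmeas.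
  move=> s _; have /andP[h1 h2] := v0b s; rewrite -(kv0 s).
  have /andP[h3 _] := kmono _ _ s (le_trans (ltW v1p) h1) h2 (lexx _).
  by rewrite -subr_ge0; apply: le_trans h3; rewrite mulr_ge0 ?subr_ge0// ltW.
lra.
Qed.

(** At speed 0 the gaps are shorter than the initial ones by at least the
    fraction [m * v1], so over a long enough stretch even stopping leaves [a]
    farther ahead than its own fan does. *)
Lemma best_far t a b : 0 <= t -> a + reach t < b -> best t a a < best t a b.
Proof.
move=> t0 ab; apply: (le_lt_trans (best_self _ _ t0)).
apply: (lt_le_trans _ (speed_max t a b 0 in0)).
rewrite candidateE mul0r addr0.
have ab' : a <= b by rewrite (le_trans _ (ltW ab))// lerDl reach_ge0.
have : pint (k 0) a b <= (1 - m * v1) * (b - a).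
  apply: pint_leM => //; first exact: spacing_bmeas.
  move=> s _; have /andP[h1 h2] := v0b s.
  have /andP[h3 _] := kmono _ _ s (lexx _) (le_trans (ltW v1p) h1) h2.
  move: h3; rewrite kv0 subr0 => h3.
  by have := ler_wpM2l (ltW mp) h1; lra.
have : vm * t < (m * v1) * (b - a).
  have mv : 0 < m * v1 by rewrite mulr_gt0.
  have : reach t < b - a by rewrite ltrBrDl.
  by rewrite /reach mulrAC ltr_pdivrMr// [X in _ < X]mulrC.
lra.
Qed.

Lemma exists_origin t a : 0 <= t -> exists b, [/\ a <= b, b <= a + reach t & forall b', best t a b <= best t a b'].
Proof.
move=> t0; have ar : a <= a + reach t by rewrite lerDl reach_ge0.
have KL x y : a <= x <= a + reach t -> a <= y <= a + reach t ->
    `|best t a y - best t a x| <= (1 + k2) * `|y - x|.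
  by move=> _ _; have := best_lip t a x t a y; rewrite !subrr !normr0 !mulr0 !add0r.
have [b hb H] := @EVT_min R (best t a) _ _ ar (lipschitz_within _ _ _ _ KL).
move: hb; rewrite in_itv/= => /andP[ab ba]; exists b; split => // b'.
have Ka : best t a b <= best t a a by apply: H; rewrite in_itv/= lexx.
have [b'a|ab'] := leP b' a; first by rewrite (le_trans Ka)// best_left.
have [rb|br] := ltP (a + reach t) b'; first by rewrite (le_trans Ka)// ltW// best_far.
by apply: H; rewrite in_itv/= br ltW.
Qed.

Definition origins t a : set R := [set b | forall b', best t a b <= best t a b'].
(** The largest minimizer: the largest choice is upper semicontinuous in the
    data, hence measurable. *)
Definition origin : R -> R -> R := locked (fun t a => sup (origins t a)).

Lemma originE t a : origin t a = sup (origins t a).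
Proof. by rewrite /origin -lock. Qed.

Lemma origins_le t a b : 0 <= t -> origins t a b -> b <= a + reach t.
Proof.
move=> t0 h; rewrite leNgt; apply/negP => hb.
by have := h a; rewrite leNgt best_far.
Qed.

Lemma origins_ub t a : 0 <= t -> has_ubound (origins t a).
Proof. by move=> t0; exists (a + reach t) => b; exact: origins_le. Qed.

Lemma origin_in t a : 0 <= t -> origins t a (origin t a).
Proof.
move=> t0 b'.
have [b [ab _ hb]] := exists_origin t a t0.
have hs : has_sup (origins t a) by split; [exists b|exact: origins_ub].
apply/ler_addgt0Pr => e e0.
have kk : 0 < 1 + k2 by rewrite addr_gt0.
have d0 : 0 < e / (1 + k2) by rewrite divr_gt0.
have [x xS hx] := sup_adherent d0 hs; rewrite -originE in hx.
have xle : x <= origin t a by rewrite originE; apply: ub_le_sup => //; exact: origins_ub.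
have := best_diff t a x t a (origin t a); rewrite !subrr !normr0 !mulr0 !add0r.
rewrite ger0_norm ?subr_ge0// => h.
have : (1 + k2) * (origin t a - x) <= e.
  by rewrite mulrC -ler_pdivlMr// lerBlDl -lerBlDr; exact: ltW.
by have := xS b'; lra.
Qed.

Lemma origin_ge t a : 0 <= t -> a <= origin t a.
Proof.
move=> t0; have [b [ab _ hb]] := exists_origin t a t0.
by apply: (le_trans ab); rewrite originE; apply: ub_le_sup => //; exact: origins_ub.
Qed.

Lemma origin_le t a : 0 <= t -> origin t a <= a + reach t.
Proof. by move=> t0; apply: origins_le => //; exact: origin_in. Qed.

(** The Lax-Oleinik formula for the Hamilton-Jacobi equation in which the label
    derivative of the position is [k] of its time derivative. *)
Definition position t a : R := best t a (origin t a).
Definition vel t a : R := speed t a (origin t a).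

Lemma vel_in t a : 0 <= vel t a <= vm. Proof. exact: speed_in. Qed.

Lemma position_le t a b : 0 <= t -> position t a <= best t a b.
Proof. by move=> t0; exact: origin_in. Qed.

Lemma position_incr t a a' : 0 <= t -> a <= a' -> k1 * (a' - a) <= position t a' - position t a <= k2 * (a' - a).
Proof.
move=> t0 aa'; apply/andP; split.
  set b := origin t a'; set v := speed t a b; have hv : 0 <= v <= vm := speed_in _ _ _.
  have h1 := position_le t a b t0; have h2 := speed_max t a' b v hv.
  have /andP[h3 _] := pint_k_bound v a a' hv aa'.
  move: h2; rewrite (candidate_shift t a b v) !subrr mulr0 -/(best t a' b) -/(position t a').
  rewrite [pint _ b b]subrr; rewrite /best -/v in h1; lra.
set b := origin t a; set v := speed t a' b; have hv : 0 <= v <= vm := speed_in _ _ _.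
have h1 := position_le t a' b t0; have h2 := speed_max t a b v hv.
have /andP[_ h3] := pint_k_bound v a a' hv aa'.
move: h1; rewrite /best -/v (candidate_shift t a b v) !subrr mulr0 [pint _ b b]subrr.
by rewrite -/(best t a b) -/(position t a) in h2; lra.
Qed.

Lemma position_time t t' a : 0 <= t -> t <= t' -> 0 <= position t' a - position t a <= vm * (t' - t).
Proof.
move=> t0 tt'; have t'0 := le_trans t0 tt'; apply/andP; split.
  set b := origin t' a; set v := speed t a b; have /andP[hv hv'] : 0 <= v <= vm := speed_in _ _ _.
  have h1 := position_le t a b t0; have h2 := speed_max t' a b v (speed_in _ _ _).
  move: h2; rewrite (candidate_shift t a b v) !subrr [pint _ b b]subrr [pint _ a a]subrr -/(best t' a b) -/(position t' a).
  rewrite /best -/v in h1; have : 0 <= v * (t' - t) by rewrite mulr_ge0// subr_ge0.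
  lra.
set b := origin t a; set v := speed t' a b; have /andP[hv hv'] : 0 <= v <= vm := speed_in _ _ _.
have h1 := position_le t' a b t'0; have h2 := speed_max t a b v (speed_in _ _ _).
move: h1; rewrite /best -/v (candidate_shift t a b v) !subrr [pint _ b b]subrr [pint _ a a]subrr.
have : v * (t' - t) <= vm * (t' - t) by rewrite ler_wpM2r// subr_ge0.
by rewrite -/(best t a b) -/(position t a) in h2; lra.
Qed.

Lemma position_ge t a : 0 <= t -> a + v1 * t <= position t a.
Proof.
move=> t0; set b := origin t a.
have ab : a <= b := origin_ge _ _ t0.
have h1 : 0 <= v1 <= vm by have /andP[h h'] := v0b 0; rewrite (le_trans h h') ltW.
apply: (le_trans _ (speed_max t a b v1 h1)); rewrite candidateE.
have : pint (k v1) a b <= 1 * (b - a).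
  apply: pint_leM => //; first exact: spacing_bmeas.
  move=> s _; have /andP[h h'] := v0b s; rewrite -(kv0 s).
  have /andP[h3 _] := kmono _ _ s (ltW v1p) h h'.
  by rewrite -subr_ge0; apply: le_trans h3; rewrite mulr_ge0 ?subr_ge0// ltW.
lra.
Qed.

Lemma position0 a : position 0 a = a.
Proof.
apply/eqP; rewrite eq_le; apply/andP; split; last by have := position_ge 0 a (lexx _); rewrite mulr0 addr0.
by apply: (le_trans (position_le 0 a a (lexx _))); have := best_self 0 a (lexx _); rewrite mulr0 addr0.
Qed.

(** The maximum over the speeds is strict, with a quadratic margin. If [a < b],
    this is strong convexity of [k]. If [a = b], the candidate is affine in the
    speed and the maximum is at the endpoint [vm], where a linear margin
    dominates a quadratic one. *)
Lemma speed_decay t a b : 0 < t -> a <= b -> exists2 q, 0 < q &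
  forall v, 0 <= v <= vm -> candidate t a b v <= best t a b - q * (v - speed t a b) ^+ 2.
Proof.
move=> t0; rewrite le_eqVlt => /predU1P[<-|ab].
  have Fa v : candidate t a a v = a + v * t by rewrite candidateE [pint _ a a]subrr subr0.
  have sm : speed t a a = vm.
    apply/eqP; rewrite eq_le; case/andP: (speed_in t a a) => _ ->/=.
    have := speed_max t a a vm inm; rewrite !Fa lerD2l ler_pM2r//.
  exists (t / vm); first by rewrite divr_gt0.
  move=> v /andP[h0 h1]; rewrite /best !Fa sm.
  have : t / vm * (v - vm) ^+ 2 <= (vm - v) * t.
    have sq : (v - vm) ^+ 2 <= (vm - v) * vm by rewrite expr2; nra.
    have tv : 0 <= t / vm by rewrite divr_ge0// ltW.
    apply: (le_trans (ler_wpM2l tv sq)); rewrite le_eqVlt; apply/orP; left.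
    by apply/eqP; field; rewrite gt_eqF.
  lra.
exists (c / 2 * (b - a)); first by rewrite !mulr_gt0 ?subr_gt0.
move=> v hv; set w := speed t a b; have hw : 0 <= w <= vm := speed_in _ _ _.
have hl : 0 <= (2^-1 : R) <= 1 by lra.
(* Compare the maximum with the value at the midpoint of [v] and [w]. *)
have h1 := speed_max t a b _ (convex_in _ _ _ hl hv hw).
have h2 := pint_k_conv _ v w a b hl hv hw (ltW ab).
rewrite -/w -/(best t a b) in h1.
have E : best t a b = candidate t a b w by [].
move: h1 E; rewrite !candidateE; set I := pint _ _ _ in h2 *; move=> h1 E.
set d2 := (v - w) ^+ 2 in h2 *.
have := h2; have := h1; rewrite E; nra.
Qed.

Lemma candidate_concave t a b l v v' : a <= b -> 0 <= l <= 1 -> 0 <= v <= vm -> 0 <= v' <= vm ->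
  (1 - l) * candidate t a b v + l * candidate t a b v' <= candidate t a b ((1 - l) * v + l * v').
Proof.
move=> ab hl hv hv'; have h := pint_k_conv _ _ _ _ _ hl hv hv' ab.
have h0 : 0 <= c * (l * (1 - l)) * (v - v') ^+ 2 * (b - a).
  have ll : 0 <= l * (1 - l) by case/andP: hl => l0 l1; rewrite mulr_ge0 ?subr_ge0.
  have cl : 0 <= c * (l * (1 - l)) by apply: mulr_ge0 => //; exact: ltW.
  by rewrite mulr_ge0 ?subr_ge0// mulr_ge0 ?sqr_ge0.
rewrite !candidateE; set P1 := pint _ _ _ in h *; set P2 := pint _ _ _ in h *; set P3 := pint _ _ _ in h *.
nra.
Qed.

Lemma young (x d q : R) : 0 < q -> - q * x ^+ 2 + `|x| * d <= d ^+ 2 / (4 * q).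
Proof.
move=> q0; rewrite ler_pdivlMr ?mulr_gt0//.
have := sqr_ge0 (2 * q * `|x| - d); rewrite -(real_normK (num_real x)).
set y := `|x|; rewrite !expr2; nra.
Qed.

(** Near an optimal triple the best candidate is touched from above, up to a
    quadratic error, by the expansion at frozen speed. Changing the speed by
    [w - v] gains at most a product of [w - v] with the displacement and costs a
    multiple of the square of [w - v], and Young's inequality leaves the square
    of the displacement. *)
Lemma touching t a : 0 < t -> exists2 q, 0 < q & forall t' a' b',
  best t' a' b' <= position t a + (b' - origin t a) + vel t a * (t' - t) + pint (k (vel t a)) a a'
    - pint (k (vel t a)) (origin t a) b'
    + q * (`|t' - t| + L * `|a' - a| + L * `|b' - origin t a|) ^+ 2.
Proof.
move=> t0; have ab := origin_ge t a (ltW t0).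
have [q q0 hq] := speed_decay t a _ t0 ab.
exists (4 * q)^-1; first by rewrite invr_gt0 mulr_gt0.
move=> t' a' b'; set b := origin t a; set v := vel t a; have hv : 0 <= v <= vm := speed_in _ _ _.
set w := speed t' a' b'; have hw : 0 <= w <= vm := speed_in _ _ _.
rewrite /best -/w (candidate_shift t a b w).
have h := hq w hw; rewrite -/b -/(vel t a) -/v in h.
have p1 := pint_k_lip v w a a' hv hw; have p2 := pint_k_lip v w b b' hv hw.
have p3 : (w - v) * (t' - t) <= `|w - v| * `|t' - t|.
  by rewrite -normrM ler_norm.
move: p1 p2; rewrite !ler_norml => /andP[_ p1] /andP[p2 _].
have y := young (w - v) (`|t' - t| + L * `|a' - a| + L * `|b' - b|) q q0.
rewrite [(4 * q)^-1 * _]mulrC; rewrite /position -/b; lra.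
Qed.

(** First-order optimality of the origin: the mean of [k (vel t a)] over short
    intervals on its left is at most 1, and on its right at least 1. As
    [k (v0 s) s = 1] and [k] increases with the speed, the speed lies between
    the nearby values of [v0]. *)
Lemma speed_local t a lo hi d : 0 < t -> 0 < d ->
  (forall s, `|s - origin t a| < d -> lo <= v0 s <= hi) ->
  lo <= vel t a <= hi.
Proof.
move=> t0 d0 h; have [q q0 H] := touching t a t0.
set b := origin t a in h H *; set v := vel t a in H *.
have hv : 0 <= v <= vm := speed_in _ _ _.
(* A linear term is not bounded by a quadratic one near 0. *)
have small (x : R) : 0 < x -> ~ (forall y, 0 < y -> y < d -> x * y <= q * (L * y) ^+ 2).
  move=> x0 hx.
  pose y := Num.min (d / 2) (x / (2 * q * L ^+ 2)).
  have y0 : 0 < y by rewrite lt_min !divr_gt0// !mulr_gt0// exprn_gt0.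
  have yd : y < d by rewrite gt_min ltr_pdivrMr// ltr_pMr// ltr1n.
  have := hx y y0 yd; rewrite exprMn (expr2 y) !mulrA ler_pM2r//.
  have : y <= x / (2 * q * L ^+ 2) by rewrite ge_min lexx orbT.
  rewrite ler_pdivlMr ?mulr_gt0 ?exprn_gt0// => h1 h2.
  have : q * L ^+ 2 * y = 2^-1 * (y * (2 * q * L ^+ 2)) by field.
  lra.
have O b' : 0 <= (b' - b) - pint (k v) b b' + q * (L * `|b' - b|) ^+ 2.
  have := H t a b'; rewrite !subrr !normr0 mulr0 !add0r mulr0 [pint _ a a]subrr => {}H.
  have := position_le t a b' (ltW t0); lra.
apply/andP; split; rewrite leNgt; apply/negP => hlt.
  apply: (small (m * (lo - v))); first by rewrite mulr_gt0// subr_gt0.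
  move=> y y0 yd; have := O (b - y).
  rewrite (_ : b - y - b = - y); last by ring.
  rewrite normrN gtr0_norm// pint_opp opprK.
  have : pint (k v) (b - y) b <= (1 - m * (lo - v)) * (b - (b - y)).
    apply: pint_leM; [exact: spacing_bmeas|lra|move=> s hs].
    have /h /andP[s1 s2] : `|s - b| < d by rewrite ltr_norml; lra.
    have /andP[s3 s4] := v0b s.
    have vs : v <= v0 s by lra.
    have hv0 : 0 <= v by case/andP: hv.
    have /andP[H3 _] := kmono v (v0 s) s hv0 vs s4; rewrite kv0 in H3.
    have : m * (lo - v) <= m * (v0 s - v) by apply: ler_wpM2l; [exact: ltW|lra].
    lra.
  lra.
apply: (small (m * (v - hi))); first by rewrite mulr_gt0// subr_gt0.
move=> y y0 yd; have := O (b + y).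
rewrite (_ : b + y - b = y); last by ring.
rewrite gtr0_norm//.
have : (1 + m * (v - hi)) * (b + y - b) <= pint (k v) b (b + y).
  apply: pint_ge; [exact: spacing_bmeas|lra|move=> s hs].
  have /h /andP[s1 s2] : `|s - b| < d by rewrite ltr_norml; lra.
  have /andP[s3 s4] := v0b s.
  have s0 : 0 <= v0 s by exact: le_trans (ltW v1p) s3.
  have vs : v0 s <= v by exact: le_trans s2 (ltW hlt).
  have hvm : v <= vm by case/andP: hv.
  have /andP[H3 _] := kmono (v0 s) v s s0 vs hvm; rewrite kv0 in H3.
  have : m * (v - hi) <= m * (v - v0 s) by apply: ler_wpM2l; [exact: ltW|lra].
  lra.
lra.
Qed.

End LaxOleinik.

(** * The label of the car at a given point *)

Lemma bilipschitz_surjective {R : realType} (f : R -> R) (k1 k2 : R) : 0 < k1 ->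
  (forall a a', a <= a' -> k1 * (a' - a) <= f a' - f a <= k2 * (a' - a)) ->
  forall x, exists a, f a = x.
Proof.
move=> k1p H x; pose D := `|x - f 0| / k1.
have D0 : 0 <= D by rewrite divr_ge0// ltW.
have kD : k1 * D = `|x - f 0| by rewrite mulrC divfK ?gt_eqF.
have cf : {within `[- D, D], continuous f}.
  apply: (@lipschitz_within R f k2) => u w _ _.
  wlog uw : u w / u <= w.
    move=> G; have [/G//|/ltW/G] := leP u w.
    by rewrite distrC [`|u - w|]distrC.
  have /andP[h1 h2] := H _ _ uw; rewrite !ger0_norm ?subr_ge0//.
  by rewrite -subr_ge0 (le_trans _ h1)// mulr_ge0 ?subr_ge0// ltW.
have /andP[h1 _] := H 0 D D0.
have /andP[h2 _] : k1 * (0 - - D) <= f 0 - f (- D) <= k2 * (0 - - D).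
  by apply: H; rewrite oppr_le0.
rewrite subr0 kD in h1; rewrite sub0r opprK kD in h2.
have := ler_norm (x - f 0); have := ler_norm (- (x - f 0)); rewrite normrN => n1 n2.
have [c _ fc] : exists2 c, c \in `[- D, D] & f c = x.
  apply: IVT => //; first by lra.
  have l1 : f (- D) <= x by lra.
  have l2 : x <= f D by lra.
  by rewrite ge_min l1 le_max l2 orbT.
by exists c.
Qed.

Section Label.
Context {R : realType}.
Notation P := (measurableTypeR R * measurableTypeR R)%type.
Context {k : R -> R -> R} {v0 : R -> R} {v1 vm k1 k2 m c L : R}.
Hypothesis hk : spacing k v0 v1 vm k1 k2 m c L.

Let v1p : 0 < v1 := sp_v1 hk.
Let vmp : 0 < vm := sp_vm hk.
Let k1p : 0 < k1 := sp_k1 hk.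
Let mp : 0 < m := sp_m hk.
Let kbnd := sp_bound hk.
Let k12 : k1 <= k2.
Proof.
have in0 : 0 <= (0:R) <= vm by rewrite lexx ltW.
by have /andP[h1 h2] := kbnd 0 0 in0; apply: le_trans h1 h2.
Qed.

Notation position := (position hk).
Notation best := (best hk).
Notation candidate := (@candidate R k).
Notation origin := (origin hk).
Notation vel := (vel hk).
Notation speed := (speed hk).
Notation reach := (@reach R v1 vm m).

(** Clamping the time at 0 extends the labels to a Lipschitz function on the
    whole plane. *)
Definition tpos (t : R) : R := Num.max t 0.

Lemma tpos_ge0 t : 0 <= tpos t. Proof. by rewrite /tpos le_max lexx orbT. Qed.
Lemma tpos_id t : 0 <= t -> tpos t = t. Proof. by move=> h; rewrite /tpos max_l. Qed.
Lemma tpos_lip t t' : `|tpos t' - tpos t| <= `|t' - t|.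
Proof.
have h1 := ler_norm (t' - t); have := ler_norm (- (t' - t)); rewrite normrN => h2.
have h3 := normr_ge0 (t' - t).
rewrite /tpos ler_norml; apply/andP; split;
 by case: (lerP t 0) => h; case: (lerP t' 0) => h'; lra.
Qed.

Lemma exists_label t x : exists a, position (tpos t) a = x.
Proof.
apply: (bilipschitz_surjective (position (tpos t)) k1 k2) => // a a' aa'.
by apply: position_incr => //; exact: tpos_ge0.
Qed.

Definition label : R -> R -> R := locked (fun t x => sval (cid (exists_label t x))).

Lemma position_label t x : position (tpos t) (label t x) = x.
Proof. by rewrite /label -lock; case: cid. Qed.

Lemma label_ge t x a : position (tpos t) a <= x -> a <= label t x.
Proof.
move=> h; rewrite leNgt; apply/negP => la.
have /andP[h1 _] := position_incr hk _ _ _ (tpos_ge0 t) (ltW la).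
rewrite position_label in h1.
have : 0 < k1 * (a - label t x) by rewrite mulr_gt0// subr_gt0.
lra.
Qed.

Lemma label_le t x a : x <= position (tpos t) a -> label t x <= a.
Proof.
move=> h; rewrite leNgt; apply/negP => la.
have /andP[h1 _] := position_incr hk _ _ _ (tpos_ge0 t) (ltW la).
rewrite position_label in h1.
have : 0 < k1 * (label t x - a) by rewrite mulr_gt0// subr_gt0.
lra.
Qed.

Lemma label_unique t x a : position (tpos t) a = x -> label t x = a.
Proof.
by move=> h; apply/eqP; rewrite eq_le label_ge ?label_le// h.
Qed.

Lemma position_lip_time t t' a : 0 <= t -> 0 <= t' -> `|position t' a - position t a| <= vm * `|t' - t|.
Proof.
move=> t0 t'0; wlog tt' : t t' t0 t'0 / t <= t'.
  move=> H; have [/H|/ltW/H] := leP t t'; first exact.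
  by move=> G; rewrite distrC [`|t' - t|]distrC; exact: G.
have /andP[h1 h2] := position_time hk _ _ a t0 tt'.
by rewrite [`|t' - t|]ger0_norm ?subr_ge0// ger0_norm.
Qed.

Lemma position_lip_label t a a' : 0 <= t -> `|position t a' - position t a| <= k2 * `|a' - a|.
Proof.
move=> t0; wlog aa' : a a' / a <= a'.
  move=> H; have [/H//|/ltW/H] := leP a a'.
  by move=> G; rewrite distrC [`|a' - a|]distrC; exact: G.
have /andP[h1 h2] := position_incr hk _ _ _ t0 aa'.
rewrite [`|a' - a|]ger0_norm ?subr_ge0// ger0_norm//.
by apply: le_trans h1; rewrite mulr_ge0 ?subr_ge0// ltW.
Qed.

Lemma label_lip t x t' x' :
  `|label t' x' - label t x| <= (`|x' - x| + vm * `|t' - t|) / k1.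
Proof.
rewrite ler_pdivlMr// mulrC.
have H (a a' : R) : k1 * `|a' - a| <= `|position (tpos t) a' - position (tpos t) a|.
  wlog aa' : a a' / a <= a'.
    move=> H; have [/H//|/ltW/H] := leP a a'.
    by rewrite distrC [`|position _ _ - _|]distrC.
  have /andP[h1 h2] := position_incr hk _ _ _ (tpos_ge0 t) aa'.
  by rewrite [`|a' - a|]ger0_norm ?subr_ge0// (le_trans h1)// ler_norm.
rewrite (le_trans (H _ _))// position_label.
have := position_lip_time _ _ (label t' x') (tpos_ge0 t') (tpos_ge0 t).
have := tpos_lip t t'; rewrite position_label distrC => h1 h2.
rewrite (_ : _ - x = (position (tpos t) (label t' x') - x') + (x' - x)); last by ring.
rewrite (le_trans (ler_normD _ _))// addrC lerD2l (le_trans h2)//.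
by apply: ler_wpM2l; [exact: ltW|].
Qed.

Lemma label_lip2 (z z' : R * R) :
  `|label z'.1 z'.2 - label z.1 z.2| <= (1 + vm) / k1 * (`|z'.1 - z.1| + `|z'.2 - z.2|).
Proof.
apply: (le_trans (label_lip _ _ _ _)).
rewrite mulrAC ler_wpM2r ?invr_ge0 ?(ltW k1p)//.
have := mulr_ge0 (ltW vmp) (normr_ge0 (z'.2 - z.2)).
have := normr_ge0 (z'.1 - z.1); lra.
Qed.

(** The position increases with the label, so its touching from above becomes a
    touching from below of the inverse function. The slopes [vel] in time and
    [k] in the label turn into [- vel / k] in time and [1 / k] in space; the
    latter needs [k (vel t a)] continuous at [a]. *)
Lemma label_subgrad t x : 0 < t ->
  let a := label t x in
  (forall e, 0 < e -> exists2 d, 0 < d & forall s, `|s - a| < d ->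
     `|k (vel t a) s - k (vel t a) a| <= e) ->
  subgrad (fun z => label z.1 z.2) (t, x)
    (- (vel t a / k (vel t a) a)) (k (vel t a) a)^-1.
Proof.
move=> t0 /=; set a := label t x; set v := vel t a => kc e e0 /=.
have hv : 0 <= v <= vm := vel_in hk t a.
have [hv0 hvm] := andP hv.
set kk := k v a.
have kk0 : 0 < kk by have /andP[h _] := kbnd v a hv; exact: lt_le_trans k1p h.
have Xa : position t a = x by rewrite -(position_label t x) tpos_id// ltW.
have [q q0 Hq] := touching hk t a t0.
have s0 : 0 < kk^-1 by rewrite invr_gt0.
pose C1 := kk^-1 * (1 + vm) + e.
have C10 : 0 < C1 by rewrite addr_gt0// mulr_gt0// addr_gt0.
have Lp : 0 <= L.
  have /andP[h1 h2] := sp_mono hk 0 vm 0 (lexx _) (ltW vmp) (lexx _).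
  have := le_trans h1 h2; rewrite subr0 ler_pM2r// => h; apply: le_trans h; exact: ltW.
pose C2 := 1 + L * C1.
have C20 : 0 < C2 by apply: ltr_wpDr => //; rewrite mulr_ge0// ltW.
have ke0 : 0 < kk * e by rewrite mulr_gt0.
have C120 : 0 < kk * e / (2 * C1) by rewrite divr_gt0// mulr_gt0.
have [d1 d10 hd1] := kc _ C120.
pose d2 := kk * e / (2 * q * C2 ^+ 2).
have d20 : 0 < d2 by rewrite divr_gt0// mulr_gt0 ?exprn_gt0// mulr_gt0.
exists (Num.min t (Num.min (d1 / (2 * C1)) (d2 / 2))).
  have q1 : 0 < d1 / (2 * C1) by rewrite divr_gt0// mulr_gt0.
  have q2 : 0 < d2 / 2 by rewrite divr_gt0.
  by rewrite !lt_min t0 q1 q2.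
move=> t' x'; rewrite !lt_min => /andP[ht /andP[ht1 ht2]] /andP[_ /andP[hx1 hx2]].
set dt := t' - t in ht ht1 ht2 *; set dx := x' - x in hx1 hx2 *.
set r := `|dt| + `|dx|.
have r0 : 0 <= r by rewrite addr_ge0.
have rd1 : C1 * r < d1.
  by rewrite mulrC -ltr_pdivlMr// /r; move: ht1 hx1; rewrite invfM mulrA; lra.
have rd2 : r <= d2 by rewrite /r; lra.
(* The increment of the label that is claimed; [key] says that the car [a + u]
   has not passed [x']. *)
pose u := kk^-1 * (dx - v * dt) - e * r.
have uC : `|u| <= C1 * r.
  rewrite /u (le_trans (ler_normB _ _))// [X in _ <= X]mulrDl; apply: lerD; last first.
    by rewrite ger0_norm// mulr_ge0// ltW.
  rewrite normrM (ger0_norm (ltW s0)) -mulrA ler_wpM2l ?(ltW s0)//.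
  rewrite (le_trans (ler_normB _ _))// normrM (ger0_norm hv0).
  have : v * `|dt| <= vm * `|dt| by rewrite ler_wpM2r.
  have := mulr_ge0 (ltW vmp) (normr_ge0 dx); have := normr_ge0 dt; rewrite /r; lra.
have t'0 : 0 < t'.
  by move: ht; rewrite ltr_norml /dt => /andP[]; lra.
have key : position t' (a + u) <= x'.
  apply: (le_trans (position_le hk t' (a + u) (origin t a) (ltW t'0))).
  apply: (le_trans (Hq _ _ _)).
  rewrite -/v Xa !subrr normr0 mulr0 !addr0 [pint _ (origin t a) _]subrr subr0.
  rewrite (_ : a + u - a = u); last by ring.
  rewrite -/dt.
  have : `|pint (k v) a (a + u) - kk * (a + u - a)| <= kk * e / (2 * C1) * `|a + u - a|.
    apply: pint_near; first exact: (spacing_bmeas hk).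
    move=> s hs; apply: hd1; apply: le_lt_trans rd1; apply: le_trans uC.
    move: hs; case: (lerP a (a + u)) => hau /andP[hs1 hs2].
      by rewrite ger0_norm ?subr_ge0// ger0_norm; lra.
    by rewrite ler0_norm ?subr_le0// ler0_norm; lra.
  rewrite (_ : a + u - a = u); last by ring.
  rewrite ler_norml => /andP[_ p1].
  have p2 : kk * e / (2 * C1) * `|u| <= kk * e / 2 * r.
    have -> : kk * e / 2 * r = kk * e / (2 * C1) * (C1 * r) by field; rewrite gt_eqF.
    by rewrite ler_wpM2l// divr_ge0 ?(ltW ke0)// mulr_ge0// ltW.
  have p3 : q * (`|dt| + L * `|u|) ^+ 2 <= kk * e / 2 * r.
    apply: (@le_trans _ _ (q * (C2 * r) ^+ 2)).
      rewrite ler_wpM2l ?(ltW q0)// lerXn2r ?nnegrE ?addr_ge0 ?mulr_ge0 ?(ltW C20)//.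
      have := ler_wpM2l Lp uC; have := normr_ge0 dx; rewrite /C2 /r; lra.
    have -> : q * (C2 * r) ^+ 2 = q * C2 ^+ 2 * r * r by ring.
    rewrite ler_wpM2r//.
    have : q * C2 ^+ 2 * r <= q * C2 ^+ 2 * d2.
      by rewrite ler_wpM2l// mulr_ge0 ?sqr_ge0// ltW.
    move=> /le_trans; apply; rewrite /d2 le_eqVlt; apply/orP; left; apply/eqP.
    by field; rewrite !gt_eqF.
  have p4 : kk * u = dx - v * dt - kk * e * r.
    by rewrite /u mulrBr mulrA mulfV ?gt_eqF// mul1r mulrA.
  rewrite /dx in p4; lra.
have := label_ge t' x' (a + u); rewrite tpos_id ?(ltW t'0)// => /(_ key).
apply: le_trans; rewrite -/dt -/dx -/r /u le_eqVlt; apply/orP; left; apply/eqP.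
by rewrite -/a; ring.
Qed.

Lemma label_continuous : continuous (fun z : R * R => label z.1 z.2).
Proof. exact: (lipschitz_plane_continuous _ _ label_lip2). Qed.

Lemma best_lip_origin t a b t' a' : `|best t' a' b - best t a b| <= vm * `|t' - t| + k2 * `|a' - a|.
Proof.
by have := best_lip hk t a b t' a' b; rewrite subrr normr0 mulr0 addr0.
Qed.

Lemma position_lip2 t a t' a' : 0 <= t -> 0 <= t' ->
  `|position t' a' - position t a| <= vm * `|t' - t| + k2 * `|a' - a|.
Proof.
move=> t0 t'0.
have -> : position t' a' - position t a = (position t' a' - position t a') + (position t a' - position t a) by ring.
by rewrite (le_trans (ler_normD _ _))// lerD ?position_lip_time ?position_lip_label.
Qed.

(** By compactness: if the largest minimizer is below [r], then the best
    candidate exceeds its minimum by a gap on the part of the reachable interval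
    that lies beyond [r], and the gap persists for nearby data. *)
Lemma origin_usc r : open [set z : R * R | origin (tpos z.1) (label z.1 z.2) < r].
Proof.
rewrite openE => z /= zr; rewrite /interior.
set t := tpos z.1 in zr; set a := label z.1 z.2 in zr.
have t0 : 0 <= t := tpos_ge0 _.
pose M := a + reach t + 1.
pose Ca := (1 + vm) / k1.
have Ca0 : 0 <= Ca by rewrite divr_ge0 ?addr_ge0 ?(ltW vmp) ?(ltW k1p).
pose Cr := vm / (m * v1).
have Cr0 : 0 <= Cr by rewrite divr_ge0 ?mulr_ge0 ?(ltW vmp) ?(ltW mp) ?(ltW v1p).
have k20 : 0 <= k2 by rewrite (le_trans (ltW k1p)).
(* Data in a ball of radius [d] differ by multiples of [d], and so do the ends
   of the reachable intervals. *)
have near d (z' : R * R) : ball z d z' ->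
   [/\ `|tpos z'.1 - t| <= d, `|label z'.1 z'.2 - a| <= Ca * (2 * d) &
       label z'.1 z'.2 + reach (tpos z'.1) <= a + reach t + (Ca * 2 + Cr) * d].
  move=> [/= h1 h2]; rewrite /ball/= distrC in h1; rewrite /ball/= distrC in h2.
  have e1 : `|tpos z'.1 - t| <= d by rewrite (le_trans (tpos_lip _ _))// ltW.
  have e2 : `|label z'.1 z'.2 - a| <= Ca * (2 * d).
    by rewrite (le_trans (label_lip2 z z'))// ler_wpM2l//; lra.
  split => //.
  have := ler_norm (tpos z'.1 - t); have := ler_norm (label z'.1 z'.2 - a).
  have : Cr * (tpos z'.1 - t) <= Cr * d.
    by rewrite ler_wpM2l// (le_trans (ler_norm _)).
  have rE y : reach y = Cr * y by [].
  rewrite !rE; lra.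
have olt (z' : R * R) : origin (tpos z'.1) (label z'.1 z'.2) <= label z'.1 z'.2 + reach (tpos z'.1).
  by apply: origin_le; exact: tpos_ge0.
pose d1 := (Ca * 2 + Cr + 1)^-1.
have D1 : 0 < Ca * 2 + Cr + 1 by rewrite ltr_wpDl// addr_ge0// mulr_ge0.
have d10 : 0 < d1 by rewrite invr_gt0.
have d1M (d : R) : 0 <= d -> d <= d1 -> (Ca * 2 + Cr) * d <= 1.
  move=> d0 dd1; apply: (@le_trans _ _ ((Ca * 2 + Cr + 1) * d)); first by lra.
  by rewrite -ler_pdivlMl// mulr1.
have [Mr|rM] := ltP M r.
  apply: filterS (nbhsx_ballx z _ d10) => z' /near[_ _ h] /=.
  apply: (le_lt_trans (olt z')); apply: le_lt_trans Mr; rewrite /M.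
  by have := d1M _ (ltW d10) (lexx _); lra.
have KL x y : r <= x <= M -> r <= y <= M -> `|best t a y - best t a x| <= (1 + k2) * `|y - x|.
  by move=> _ _; have := best_lip hk t a x t a y; rewrite !subrr !normr0 !mulr0 !add0r.
have [b0 hb0 Hb0] := @EVT_min R (best t a) _ _ rM (lipschitz_within _ _ _ _ KL).
have gap : position t a < best t a b0.
  rewrite lt_neqAle (position_le hk _ _ _ t0) andbT.
  apply/eqP => E.
  have : origins hk t a b0.
    by move=> b'; rewrite -E; exact: position_le.
  move/(ub_le_sup (origins_ub hk t a t0)); rewrite -originE.
  by move: hb0; rewrite in_itv/= => /andP[h _]; rewrite leNgt (lt_le_trans zr h).
pose Q := 2 * (vm + k2 * (Ca * 2)) + 1.
have Q0 : 0 < Q by rewrite /Q ltr_wpDl// mulr_ge0// addr_ge0 ?(ltW vmp)// mulr_ge0// mulr_ge0.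
pose g := best t a b0 - position t a.
have g0 : 0 < g by rewrite subr_gt0.
pose d := Num.min d1 (g / (2 * Q)).
have gQ : 0 < g / (2 * Q) by rewrite divr_gt0// mulr_gt0.
have d0 : 0 < d by rewrite lt_min d10 gQ.
apply: filterS (nbhsx_ballx z _ d0) => z' /near[h1 h2 h3] /=.
set t' := tpos z'.1 in h1 h2 h3 *; set a' := label z'.1 z'.2 in h1 h2 h3 *.
have t'0 : 0 <= t' := tpos_ge0 _.
rewrite ltNge; apply/negP => ro.
set b := origin t' a' in ro.
have bM : b <= M.
  have := olt z'; rewrite -/t' -/a' -/b => /le_trans; apply; apply: (le_trans h3).
  have : d <= d1 by rewrite ge_min lexx.
  by move/(d1M _ (ltW d0)); rewrite /M; lra.
have Kb : best t a b0 <= best t a b by apply: Hb0; rewrite in_itv/= ro bM.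
have XK : position t' a' = best t' a' b by [].
have := best_lip_origin t a b t' a'; have := position_lip2 t a t' a' t0 t'0.
rewrite !ler_norml => /andP[_ x1] /andP[x2 _].
have y1 : vm * `|t' - t| <= vm * d by rewrite ler_wpM2l// ltW.
have y2 : k2 * `|a' - a| <= k2 * (Ca * (2 * d)) by rewrite ler_wpM2l.
have y3 : Q * d <= g / 2.
  have : d <= g / (2 * Q) by rewrite ge_min lexx orbT.
  rewrite -(ler_pM2l Q0) => /le_trans; apply.
  rewrite le_eqVlt; apply/orP; left; apply/eqP; field; by rewrite gt_eqF.
rewrite /Q in y3; rewrite /g in y3 g0; rewrite XK in x1; lra.
Qed.

Lemma measurable_label : measurable_fun [set: P] (fun z => label z.1 z.2).
Proof. by apply: continuous_plane_measurable; exact: label_continuous. Qed.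

Lemma measurable_origin : measurable_fun [set: P] (fun z => origin (tpos z.1) (label z.1 z.2)).
Proof.
by apply: measurable_plane_lt => r; apply: open_plane_measurable; exact: origin_usc.
Qed.

Definition label_vel (z : R * R) : R := if 0 < z.1 then vel z.1 (label z.1 z.2) else 0.

Lemma label_velE z : 0 < z.1 -> label_vel z = vel z.1 (label z.1 z.2).
Proof. by rewrite /label_vel => ->. Qed.

Lemma label_vel_in z : 0 <= label_vel z <= vm.
Proof.
by rewrite /label_vel; case: ifP => _; [exact: vel_in|rewrite lexx ltW].
Qed.

Lemma measurable_prim (v : R) : 0 <= v <= vm -> measurable_fun [set: measurableTypeR R] (prim (k v)).
Proof.
move=> hv; apply: nondecreasing_measurable => // x y xy.
have /andP[h _] := pint_k_bound hk v x y hv xy.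
by rewrite -subr_ge0; apply: le_trans h; rewrite mulr_ge0 ?subr_ge0// ltW.
Qed.

Lemma measurable_F (v : R) : 0 <= v <= vm -> measurable_fun [set: P]
  (fun z => candidate (tpos z.1) (label z.1 z.2) (origin (tpos z.1) (label z.1 z.2)) v).
Proof.
move=> hv.
have -> : (fun z => candidate (tpos z.1) (label z.1 z.2) (origin (tpos z.1) (label z.1 z.2)) v) =
  (fun z : R * R => (origin (tpos z.1) (label z.1 z.2) + v * tpos z.1) -
   (prim (k v) (origin (tpos z.1) (label z.1 z.2)) - prim (k v) (label z.1 z.2))).
  by apply/funext => z; rewrite candidateE.
have mt : measurable_fun [set: P] (fun z : R * R => tpos z.1).
  by apply: measurable_maxr => //; exact: measurable_cst.
apply: measurable_funB; first apply: measurable_funD.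
- exact: measurable_origin.
- by apply: measurable_funM => //; exact: measurable_cst.
apply: measurable_funB.
  by apply: (measurableT_comp (measurable_prim _ hv)); exact: measurable_origin.
by apply: (measurableT_comp (measurable_prim _ hv)); exact: measurable_label.
Qed.

(** The candidate is concave in the speed with its only maximum at [vel], so it
    increases strictly up to [vel]. Testing against rational speeds gives
    measurability of [vel], which need not be continuous. *)
Lemma vel_gt t a r : 0 < t -> 0 <= r ->
  (r < vel t a) <-> exists q : rat, [/\ r < ratr q, ratr q <= vm &
     candidate t a (origin t a) r < candidate t a (origin t a) (ratr q)].
Proof.
move=> t0 r0; have ab := origin_ge hk t a (ltW t0).
set b := origin t a in ab *; have /andP[hv0 hvm] := vel_in hk t a.
set v := vel t a in hv0 hvm *.
split => [rv|[q [rq qm Frq]]].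
  have [q0 q00 hq] := speed_decay hk t a b t0 ab.
  have rin : 0 <= r <= vm by rewrite r0 (le_trans (ltW rv)).
  have vin : 0 <= v <= vm by rewrite hv0.
  have Frv : candidate t a b r < candidate t a b v.
    have := hq r rin; rewrite -/(vel t a) -/v -/(candidate t a b v).
    have : 0 < q0 * (r - v) ^+ 2 by rewrite mulr_gt0// exprn_even_gt0//= subr_eq0 lt_eqF.
    rewrite (_ : best t a b = candidate t a b v) //; lra.
  pose C := `|t| + L * `|b - a| + 1.
  have C0 : 0 < C.
    have Lp : 0 <= L.
      have /andP[h1 h2] := sp_mono hk 0 vm 0 (lexx _) (ltW vmp) (lexx _).
      by have := le_trans h1 h2; rewrite subr0 ler_pM2r// => h; apply: le_trans h; exact: ltW.
    by rewrite /C ltr_wpDl// addr_ge0// mulr_ge0.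
  pose g := candidate t a b v - candidate t a b r.
  have g0 : 0 < g by rewrite subr_gt0.
  have lo : Num.max r (v - g / C) < v.
    by rewrite gt_max rv /= ltrBlDr ltrDl divr_gt0.
  have [q] := rat_in_itvoo lo; rewrite in_itv/= gt_max => /andP[/andP[q1 q2] q3].
  exists q; split => //; first by rewrite (le_trans (ltW q3)).
  have qin : 0 <= (ratr q : R) <= vm by rewrite (le_trans r0 (ltW q1)) (le_trans (ltW q3)).
  have := candidate_lip_speed hk t a b v (ratr q) vin qin.
  rewrite ler_norml => /andP[h _].
  have : C * `|ratr q - v| < g.
    rewrite -ltr_pdivlMl// mulrC ltr0_norm ?subr_lt0//; lra.
  have := normr_ge0 (ratr q - v : R); rewrite /C /g in h *; lra.
rewrite ltNge; apply/negP => vr.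
have qin : 0 <= (ratr q : R) <= vm by rewrite qm (le_trans r0 (ltW rq)).
have vin : 0 <= v <= vm by rewrite hv0.
have vq : 0 < ratr q - v by rewrite subr_gt0 (le_lt_trans vr).
pose l := (r - v) / (ratr q - v).
have hl : 0 <= l <= 1.
  rewrite /l divr_ge0 ?subr_ge0 ?(ltW vq) //=; last by rewrite -subr_ge0 ltW.
  by rewrite ler_pdivrMr// mul1r lerD2r ltW.
have E : (1 - l) * v + l * ratr q = r.
  have -> : (1 - l) * v + l * ratr q = v + l * (ratr q - v) by ring.
  by rewrite /l divfK ?gt_eqF// addrC subrK.
have := candidate_concave hk t a b l v (ratr q) ab hl vin qin.
rewrite E; have := speed_max hk t a b _ qin.
rewrite -/(vel t a) -/v => h1 h2.
case/andP: hl => l0 l1.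
have : (1 - l) * candidate t a b (ratr q) <= (1 - l) * candidate t a b v by rewrite ler_wpM2l// subr_ge0.
lra.
Qed.

Lemma measurable_label_vel : measurable_fun [set: P] label_vel.
Proof.
apply: measurable_plane_gt => r.
have [r0|r0] := ltP r 0.
  rewrite (_ : [set z | _] = setT); first exact: measurableT.
  apply/seteqP; split => z //= _.
  by case/andP: (label_vel_in z) => h _; exact: lt_le_trans r0 h.
pose O z := origin (tpos z.1) (label z.1 z.2).
pose G (v : R) (z : R * R) := candidate (tpos z.1) (label z.1 z.2) (O z) v.
have -> : [set z | r < label_vel z] = [set z : P | 0 < z.1] `&`
   \bigcup_(q : rat) (if (r < ratr q) && (ratr q <= vm) then [set z : P | G r z < G (ratr q) z] else set0).
  apply/seteqP; split => z /=.
    rewrite /label_vel; case: ifP => [z0|_]; last by rewrite ltNge r0.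
    move=> /(vel_gt _ _ _ z0 r0)[q [q1 q2 q3]]; split => //; exists q => //.
    by rewrite q1 q2 /= /G /O tpos_id// ltW.
  move=> [z0 [q _]]; case: ifP => // /andP[q1 q2]; rewrite /G /O /= tpos_id ?(ltW z0)// => q3.
  by rewrite /label_vel z0; apply/(vel_gt _ _ _ z0 r0); exists q.
apply: measurableI.
  apply: open_plane_measurable.
  rewrite (_ : [set z | _] = (fun z : R * R => z.1) @^-1` [set x | 0 < x])//.
  by apply: open_comp => [z _|]; [exact: cvg_fst|exact: open_gt].
apply: bigcupT_measurable_rat => q; case: ifP => [/andP[q1 q2]|_]; last exact: measurable0.
have rin : 0 <= r <= vm by rewrite r0 (le_trans (ltW q1)).
have qin : 0 <= (ratr q : R) <= vm by rewrite q2 (le_trans r0 (ltW q1)).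
rewrite (_ : [set z | _] = [set z | 0 < G (ratr q) z - G r z]); last first.
  by apply/seteqP; split => z /=; rewrite subr_gt0.
have mG : measurable_fun [set: P] (fun z => G (ratr q) z - G r z).
  by apply: measurable_funB; exact: measurable_F.
have := mG measurableT `]0, +oo[%classic (measurable_itv _); rewrite setTI.
by rewrite preimage_itvoy.
Qed.

End Label.

(** * The pressure law and its inverse *)

Section Pressure.
Context {R : realType}.

Lemma nonneg_quotient_near (f df : R -> R) (x e : R) : is_derive_nonneg f df -> 0 <= x -> 0 < e ->
  exists2 d, 0 < d & forall y, 0 <= y -> `|y - x| < d -> y != x ->
    `|(f y - f x) / (y - x) - df x| <= e.
Proof.
move=> fd x0 e0; have := fd x x0; move/cvgrPdist_le => /(_ e e0).
rewrite near_withinE near_withinE => /nbhs_ballP[d /= d0 H].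
exists d => // y y0 yd yx; rewrite distrC; apply: H => //.
by rewrite /ball/= distrC.
Qed.

Lemma nonneg_continuous_itv (f df : R -> R) a b : is_derive_nonneg f df -> 0 <= a ->
  {within `[a, b], continuous f}.
Proof.
move=> fd a0; apply/subspace_continuousP => x; rewrite /= in_itv/= => /andP[ax xb].
have x0 := le_trans a0 ax.
have [d d0 H] := nonneg_quotient_near _ _ _ _ fd x0 ltr01.
apply/cvgrPdist_le => e e0; rewrite near_withinE.
have C0 : 0 < `|df x| + 1 by rewrite ltr_wpDl.
have d1 : 0 < Num.min d (e / (`|df x| + 1)) by rewrite lt_min d0 divr_gt0.
apply: filterS (nbhsx_ballx x _ d1) => y; rewrite /ball/= lt_min distrC => /andP[y1 y2].
rewrite in_itv/= => /andP[ay yb].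
have [->|yx] := eqVneq y x; first by rewrite subrr normr0 ltW.
have h := H y (le_trans a0 ay) y1 yx.
rewrite distrC (_ : f y - f x = (f y - f x) / (y - x) * (y - x)); last by rewrite divfK// subr_eq0.
rewrite normrM; apply: (@le_trans _ _ ((`|df x| + 1) * `|y - x|)).
  rewrite ler_wpM2r//.
  have -> : (f y - f x) / (y - x) = df x + ((f y - f x) / (y - x) - df x) by ring.
  by rewrite (le_trans (ler_normD _ _))// lerD2l.
by rewrite mulrC -ler_pdivlMr// ltW.
Qed.

Lemma nonneg_is_derive (f df : R -> R) (x : R) : is_derive_nonneg f df -> 0 < x ->
  is_derive x (1:R) f (df x).
Proof.
move=> fd x0.
have C : (fun h : R => h^-1 *: ((f \o shift x) (h *: (1:R)) - f x)) @ 0^' --> df x.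
  apply/cvgrPdist_le => e e0; have [d d0 H] := nonneg_quotient_near _ _ _ _ fd (ltW x0) e0.
  rewrite near_withinE.
  have d1 : 0 < Num.min d x by rewrite lt_min d0.
  apply: filterS (nbhsx_ballx 0 _ d1) => h; rewrite /ball/= sub0r normrN lt_min => /andP[h1 h2] h0.
  have E : h *: (1:R) + x - x = h by rewrite addrK; exact: mulr1.
  have := H (h *: (1:R) + x); rewrite E => G.
  rewrite distrC (_ : h^-1 *: _ = (f (h *: (1:R) + x) - f x) / h); last exact: mulrC.
  apply: G => //.
    have -> : h *: (1:R) + x = h + x by congr (_ + _); exact: mulr1.
    by move: h2; rewrite ltr_norml => /andP[]; lra.
  by rewrite -subr_eq0 E.
apply: DeriveDef; first by apply/cvg_ex; exists (df x).
by apply/cvg_lim.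
Qed.

Lemma nonneg_MVT (f df : R -> R) a b : is_derive_nonneg f df -> 0 <= a -> a < b ->
  exists2 x, a < x < b & f b - f a = df x * (b - a).
Proof.
move=> fd a0 ab.
have H x : x \in `]a, b[ -> is_derive x 1 f (df x).
  rewrite in_itv/= => /andP[ax _]; apply: nonneg_is_derive => //; exact: le_lt_trans ax.
have [x hx E] := @MVT R f df a b ab H (nonneg_continuous_itv _ _ _ _ fd a0).
by exists x => //; move: hx; rewrite in_itv.
Qed.

Context {p dp ddp : R -> R}.
Hypothesis hp : pressure p dp ddp.

Lemma pressure0 : p 0 = 0. Proof. by case: hp. Qed.

Lemma pressure_lt x y : 0 <= x -> x < y -> p x < p y.
Proof.
case: hp => _ [dp1 _ _] _ dppos _ x0 xy.
have [z /andP[xz zy] E] := nonneg_MVT _ _ _ _ dp1 x0 xy.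
by rewrite -subr_gt0 E mulr_gt0 ?subr_gt0// dppos// (le_lt_trans x0).
Qed.

Lemma pressure_le x y : 0 <= x -> x <= y -> p x <= p y.
Proof. by move=> x0; rewrite le_eqVlt => /predU1P[->//|xy]; apply/ltW/pressure_lt. Qed.

Lemma dp_le x y : 0 <= x -> x <= y -> dp x <= dp y.
Proof.
case: hp => _ [_ dp2 _] _ _ ddpos x0; rewrite le_eqVlt => /predU1P[->//|xy].
have [z /andP[xz zy] E] := nonneg_MVT _ _ _ _ dp2 x0 xy.
by rewrite -subr_ge0 E mulr_ge0 ?subr_ge0 ?(ltW xy)// ddpos// (le_trans x0 (ltW xz)).
Qed.

Lemma pressure_slopes x z y : 0 <= x -> x < z -> z < y ->
  (p z - p x) * (y - z) <= (p y - p z) * (z - x).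
Proof.
case: hp => _ [dp1 _ _] _ _ _ x0 xz zy.
have [s /andP[s1 s2] ->] := nonneg_MVT _ _ _ _ dp1 x0 xz.
have [t /andP[t1 t2] ->] := nonneg_MVT _ _ _ _ dp1 (le_trans x0 (ltW xz)) zy.
have st : dp s <= dp t by apply: dp_le; [exact: le_trans x0 (ltW s1)|lra].
rewrite -!mulrA [(y - z) * _]mulrC ler_wpM2r//.
by rewrite mulr_ge0// subr_ge0 ltW.
Qed.

Lemma pressure_convex l x y : 0 <= l <= 1 -> 0 <= x -> 0 <= y ->
  p ((1 - l) * x + l * y) <= (1 - l) * p x + l * p y.
Proof.
wlog xy : l x y / x <= y.
  move=> H hl x0 y0; have [/H|/ltW/H h] := leP x y; first exact.
  have hl' : 0 <= 1 - l <= 1 by lra.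
  have := h _ hl' y0 x0; rewrite (_ : 1 - (1 - l) = l); last by ring.
  by rewrite addrC [X in _ <= X -> _]addrC.
move=> /andP[l0 l1] x0 y0.
move: l0; rewrite le_eqVlt => /predU1P[<-|l0]; first by rewrite subr0 !mul1r !mul0r !addr0.
move: l1; rewrite le_eqVlt => /predU1P[->|l1]; first by rewrite subrr !mul1r !mul0r !add0r.
move: xy; rewrite le_eqVlt => /predU1P[<-|xy]; first by rewrite -!mulrDl subrK !mul1r.
set z := (1 - l) * x + l * y.
have zx : z - x = l * (y - x) by rewrite /z; ring.
have yz : y - z = (1 - l) * (y - x) by rewrite /z; ring.
have xz : x < z by rewrite -subr_gt0 zx mulr_gt0 ?subr_gt0.
have zy : z < y by rewrite -subr_gt0 yz mulr_gt0 ?subr_gt0.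
have := pressure_slopes _ _ _ x0 xz zy; rewrite zx yz !mulrA ler_pM2r ?subr_gt0//; lra.
Qed.

(** By convexity every slope beyond [x] is at least the slope of the chord from
    0 to [x]. *)
Lemma pressure_chord x y z : 0 < x -> x <= y -> y <= z ->
  p x / x * (z - y) <= p z - p y.
Proof.
move=> x0; rewrite le_eqVlt => /predU1P[<-|xy]; rewrite le_eqVlt => /predU1P[<-|yz];
  rewrite ?subrr ?mulr0//.
  have := pressure_slopes _ _ _ (lexx 0) x0 yz; rewrite pressure0 !subr0.
  by rewrite mulrAC ler_pdivrMr.
have h := pressure_slopes _ _ _ (ltW x0) xy yz.
have := pressure_slopes _ _ _ (lexx 0) x0 xy; rewrite pressure0 !subr0 => h'.
have zy0 : 0 < z - y by rewrite subr_gt0.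
have yx0 : 0 < y - x by rewrite subr_gt0.
rewrite mulrAC ler_pdivrMr// -(ler_pM2r yx0).
have e1 : p x * (y - x) * (z - y) <= (p y - p x) * x * (z - y) by rewrite ler_pM2r.
have e2 : (p y - p x) * (z - y) * x <= (p z - p y) * (y - x) * x by rewrite ler_pM2r.
lra.
Qed.

Lemma pressure_lip M x y : 0 <= x -> x <= y -> y <= M -> p y - p x <= (p (M + 1) - p M) * (y - x).
Proof.
move=> x0; rewrite le_eqVlt => /predU1P[<-|xy] yM; first by rewrite !subrr mulr0.
have M1 : M < M + 1 by rewrite ltrDl.
have yx0 : 0 < y - x by rewrite subr_gt0.
move: yM; rewrite le_eqVlt => /predU1P[E|yM].
  subst M; have := pressure_slopes _ _ _ x0 xy M1.
  by rewrite [y + 1]addrC addrK mulr1.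
have h := pressure_slopes _ _ _ x0 xy yM.
have := pressure_slopes _ _ _ (le_trans x0 (ltW xy)) yM M1.
rewrite [M + 1]addrC addrK mulr1 [1 + M]addrC => h'.
have My0 : 0 < M - y by rewrite subr_gt0.
rewrite -(ler_pM2r My0).
have e1 : (p M - p y) * (y - x) <= (p (M + 1) - p M) * (M - y) * (y - x) by rewrite ler_pM2r.
lra.
Qed.

Lemma pressure_continuous_itv a b : 0 <= a -> {within `[a, b], continuous p}.
Proof. by case: hp => _ [dp1 _ _] _ _ _; exact: nonneg_continuous_itv dp1. Qed.

Lemma exists_density s : 0 <= s -> exists2 r, 0 <= r & p r = s.
Proof.
move=> s0; have p1 : 0 < p 1 by rewrite -pressure0; apply: pressure_lt.
pose M := 1 + s / p 1.
have M1 : 1 <= M by rewrite lerDl divr_ge0// ltW.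
have pM : s <= p M.
  have := pressure_chord 1 1 M ltr01 (lexx _) M1; rewrite divr1 /M [1 + _]addrC addrK.
  by rewrite mulrC divfK ?gt_eqF//; lra.
have [c + pc] : exists2 c, c \in `[0, M] & p c = s.
  apply: IVT; [lra|exact: pressure_continuous_itv|].
  by rewrite pressure0 ge_min s0 le_max pM orbT.
by rewrite in_itv/= => /andP[c0 _]; exists c.
Qed.

Lemma exists_density_max s : exists2 r, 0 <= r & p r = Num.max s 0.
Proof. by apply: exists_density; rewrite le_max lexx orbT. Qed.

(** The inverse of the pressure, extended by 0 to the negative half-line to be
    monotone everywhere. *)
Definition density : R -> R := locked (fun s => s2val (cid2 (exists_density_max s))).

Lemma density_ge0 s : 0 <= density s.
Proof. by rewrite /density -lock; case: cid2. Qed.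

Lemma p_density s : 0 <= s -> p (density s) = s.
Proof. by move=> s0; rewrite /density -lock; case: cid2 => r /= _ ->; rewrite max_l. Qed.

Lemma p_density_max s : p (density s) = Num.max s 0.
Proof. by rewrite /density -lock; case: cid2. Qed.

Lemma pressure_lt_inv x y : 0 <= x -> 0 <= y -> p x < p y -> x < y.
Proof.
move=> x0 y0 h; rewrite ltNge; apply/negP => yx.
by have := pressure_le _ _ y0 yx; rewrite leNgt h.
Qed.

Lemma pressure_le_inv x y : 0 <= x -> 0 <= y -> p x <= p y -> x <= y.
Proof.
move=> x0 y0 h; rewrite leNgt; apply/negP => yx.
by have := pressure_lt _ _ y0 yx; rewrite ltNge h.
Qed.

Lemma density_p r : 0 <= r -> density (p r) = r.
Proof.
move=> r0; have pr : 0 <= p r by rewrite -pressure0; exact: pressure_le.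
apply/eqP; rewrite eq_le; apply/andP; split; apply: pressure_le_inv => //;
  by rewrite ?density_ge0// p_density.
Qed.

Lemma density_le s t : s <= t -> density s <= density t.
Proof.
move=> st; apply: pressure_le_inv; rewrite ?density_ge0// !p_density_max.
by rewrite ge_max !le_max st lexx orbT.
Qed.

Lemma density_gt0 s : 0 < s -> 0 < density s.
Proof.
move=> s0; apply: pressure_lt_inv; rewrite ?density_ge0// pressure0 p_density//.
exact: ltW.
Qed.

Lemma measurable_density : measurable_fun [set: measurableTypeR R] density.
Proof. by apply: nondecreasing_measurable => // x y; exact: density_le. Qed.

(** The inverse of a convex function vanishing at 0 is Lipschitz away from 0. *)
Lemma density_chord s0 s t : 0 < s0 -> s0 <= s -> s <= t ->
  density t - density s <= density s0 / s0 * (t - s).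
Proof.
move=> s00 s0s st; have d0 := density_gt0 _ s00.
have := pressure_chord _ _ _ d0 (density_le _ _ s0s) (density_le _ _ st).
have [s0' s0''] : 0 <= s0 /\ 0 <= s by split; lra.
have t0 : 0 <= t by lra.
rewrite !p_density// => h.
rewrite -(ler_pM2l (divr_gt0 s00 d0)) (le_trans h)// le_eqVlt; apply/orP; left.
by apply/eqP; field; rewrite !gt_eqF.
Qed.

Lemma density_continuous s : 0 < s -> {for s, continuous density}.
Proof.
move=> s0; apply/cvgrPdist_le => e e0.
have s20 : 0 < s / 2 by rewrite divr_gt0.
pose C := density (s / 2) / (s / 2).
have C0 : 0 < C by rewrite divr_gt0// density_gt0.
have d0 : 0 < Num.min (s / 2) (e / C) by rewrite lt_min s20 divr_gt0.
apply: filterS (nbhsx_ballx s _ d0) => t; rewrite /ball/= lt_min => /andP[h1 h2].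
have ht : s / 2 <= t by move: h1; rewrite ltr_norml => /andP[]; lra.
have hs : s / 2 <= s by lra.
have Ce : C * `|s - t| <= e by rewrite mulrC -ler_pdivlMr// ltW.
apply: le_trans Ce.
have [st|/ltW ts] := leP s t.
  rewrite distrC [`|s - t|]distrC !ger0_norm ?subr_ge0 ?density_le//.
  exact: density_chord.
rewrite !ger0_norm ?subr_ge0 ?density_le//; exact: density_chord.
Qed.

Lemma density_slope M s t : 0 <= s -> s <= t -> density t <= M ->
  t - s <= (p (M + 1) - p M) * (density t - density s).
Proof.
move=> s0 st tM; rewrite -[t in X in X <= _]p_density ?(le_trans s0)//.
rewrite -[s in X in X <= _]p_density//.
apply: pressure_lip => //; [exact: density_ge0|exact: density_le].
Qed.

Lemma measurable_pressure d (T : measurableType d) (f : T -> R) : measurable_fun setT f ->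
  (forall x, 0 <= f x) -> measurable_fun setT (fun x => p (f x)).
Proof.
move=> mf f0.
have -> : (fun x => p (f x)) = (fun x => p (Num.max x 0)) \o f.
  by apply/funext => x /=; rewrite max_l.
apply: (measurableT_comp _ mf); apply: nondecreasing_measurable => // x y xy.
by apply: pressure_le; [rewrite le_max lexx orbT|rewrite ge_max !le_max xy lexx orbT].
Qed.

(** Car [s] keeps its value of v + p(rho), so its density at speed [a] is the
    one that the inverse pressure assigns to that value minus [a]; gaps are
    inversely proportional to densities. *)
Definition spacing_ratio (r0 v0 : R -> R) (a s : R) : R := r0 s / density (v0 s + p (r0 s) - a).

(** The exact convexity defect of the reciprocal: it is quadratic in [r - r'],
    hence strong convexity on bounded intervals. *)
Lemma inv_convex (l r r' : R) : 0 <= l <= 1 -> 0 < r -> 0 < r' ->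
  ((1 - l) * r + l * r')^-1 + l * (1 - l) * (r - r') ^+ 2 / (r * r' * ((1 - l) * r + l * r'))
  = (1 - l) / r + l / r'.
Proof.
move=> hl r0 r'0; have d0 : 0 < (1 - l) * r + l * r' by nra.
by field; rewrite !gt_eqF.
Qed.

(** Since the speeds stay below [v2 < w1], all densities stay between two
    positive bounds. As a function of the speed, the density that the inverse
    pressure assigns is decreasing, concave and bi-Lipschitz there, so its
    reciprocal is increasing and strongly convex. *)
Lemma spacing_ratioP (r0 v0 : R -> R) (v1 v2 w1 w2 : R) :
  0 < v1 -> v2 < w1 ->
  measurable_fun [set: measurableTypeR R] r0 -> measurable_fun [set: measurableTypeR R] v0 ->
  (forall s, [/\ 0 < r0 s, v1 <= v0 s <= v2 & w1 <= v0 s + p (r0 s) <= w2]) ->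
  exists k1 k2 m c L, spacing (spacing_ratio r0 v0) v0 v1 v2 k1 k2 m c L.
Proof.
move=> v10 v2w1 mr mv H.
have v20 : 0 < v2 by have [_ /andP[h1 h2] _] := H 0; lra.
have w12 : w1 <= w2 by have [_ _ /andP[h1 h2]] := H 0; lra.
pose rm := density (w1 - v2); pose rM := density w2.
have s00 : 0 < w1 - v2 by rewrite subr_gt0.
have rm0 : 0 < rm by exact: density_gt0.
have rmM : rm <= rM by apply: density_le; lra.
have rM0 : 0 < rM := lt_le_trans rm0 rmM.
pose w s := v0 s + p (r0 s).
have wb s : w1 <= w s <= w2 by have [] := H s.
have r0b s : rm <= r0 s <= rM.
  have [r0s /andP[h1 h2] /andP[h3 h4]] := H s.
  rewrite -(density_p _ (ltW r0s)) /rm /rM.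
  have := pressure_le _ _ (lexx 0) (ltW r0s); rewrite pressure0 => ps.
  by apply/andP; split; apply: density_le; lra.
have db a s : 0 <= a <= v2 -> rm <= density (w s - a) <= rM.
  move=> /andP[a0 a2]; have /andP[h1 h2] := wb s.
  by apply/andP; split; apply: density_le; lra.
have dp0 a s : 0 <= a <= v2 -> 0 < density (w s - a).
  by move=> /(db _ s)/andP[h _]; exact: lt_le_trans h.
pose Cp := p (rM + 1) - p rM.
have Cp0 : 0 < Cp by rewrite subr_gt0; apply: pressure_lt; [exact: ltW|rewrite ltrDl].
pose cp := rm / (w1 - v2).
have cp0 : 0 < cp by rewrite divr_gt0.
have slope a b s : 0 <= a -> a <= b -> b <= v2 ->
    (b - a) / Cp <= density (w s - a) - density (w s - b) <= cp * (b - a).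
  move=> a0 ab b2; have /andP[h1 h2] := wb s.
  have e : (w s - a) - (w s - b) = b - a by ring.
  have hab : w s - b <= w s - a by lra.
  have hb : w1 - v2 <= w s - b by lra.
  have hb0 : 0 <= w s - b by lra.
  have ain : 0 <= a <= v2 by lra.
  have /andP[_ daM] := db a s ain.
  apply/andP; split.
    by rewrite ler_pdivrMr// mulrC -e; exact: density_slope.
  by rewrite -e; exact: density_chord.
have inv_diff a b s : 0 <= a <= v2 -> 0 <= b <= v2 ->
    spacing_ratio r0 v0 b s - spacing_ratio r0 v0 a s =
    r0 s * (density (w s - a) - density (w s - b)) / (density (w s - a) * density (w s - b)).
  move=> ha hb; rewrite /spacing_ratio -/(w s).
  by field; rewrite !gt_eqF ?dp0.
(* [rm] and [rM] bound all densities; [cp] and [Cp] are Lipschitz constants of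
   the inverse pressure on values at least [w1 - v2] and of the pressure on
   [0, rM]. *)
exists (rm / rM), (rM / rm), (rm / (rM ^+ 2 * Cp)), (rm / (Cp ^+ 2 * rM ^+ 3)), (rM * cp / rm ^+ 2).
split => //.
- by rewrite divr_gt0.
- by rewrite divr_gt0// mulr_gt0// exprn_gt0.
- by rewrite divr_gt0// mulr_gt0 ?exprn_gt0.
- move=> a ha; apply: measurable_funM => //.
  apply: measurable_funV_gt0; last by move=> s; exact: dp0.
  apply: (measurableT_comp measurable_density).
  apply: measurable_funB; last exact: measurable_cst.
  apply: measurable_funD => //; apply: measurable_pressure => //.
  by move=> s; have [/ltW] := H s.
- move=> a s ha; have /andP[h1 h2] := r0b s; have /andP[h3 h4] := db a s ha.
  have d0 := dp0 a s ha; rewrite /spacing_ratio -/(w s).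
  apply/andP; split; apply: ler_pM; rewrite ?invr_ge0 ?lef_pV2 ?posrE ?(ltW rm0) ?(ltW rM0) ?(ltW d0)//.
  by rewrite (le_trans (ltW rm0)).
- move=> a b s a0 ab b2.
  have ha : 0 <= a <= v2 by lra.
  have hb : 0 <= b <= v2 by lra.
  rewrite inv_diff//.
  have /andP[h1 h2] := r0b s; have /andP[h3 h4] := db a s ha; have /andP[h5 h6] := db b s hb.
  have [da0 db0] := (dp0 a s ha, dp0 b s hb).
  have /andP[s1 s2] := slope a b s a0 ab b2.
  have ba0 : 0 <= b - a by rewrite subr_ge0.
  apply/andP; split.
    have -> : rm / (rM ^+ 2 * Cp) * (b - a) = rm * ((b - a) / Cp) / (rM * rM).
      by field; rewrite !gt_eqF.
    apply: ler_pM.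
    + by rewrite mulr_ge0 ?divr_ge0// ltW.
    + by rewrite invr_ge0 mulr_ge0// ltW.
    + by apply: ler_pM => //; [exact: ltW|rewrite divr_ge0// ltW].
    + by rewrite lef_pV2 ?posrE ?mulr_gt0//; apply: ler_pM => //; exact: ltW.
  have -> : rM * cp / rm ^+ 2 * (b - a) = rM * (cp * (b - a)) / (rm * rm).
    by field; rewrite !gt_eqF.
  have dd0 : 0 <= density (w s - a) - density (w s - b).
    by rewrite (le_trans _ s1)// divr_ge0// ltW.
  apply: ler_pM.
  + by rewrite mulr_ge0// (le_trans (ltW rm0)).
  + by rewrite invr_ge0 mulr_ge0// ltW.
  + by apply: ler_pM => //; rewrite (le_trans (ltW rm0)).
  + by rewrite lef_pV2 ?posrE ?mulr_gt0//; apply: ler_pM => //; exact: ltW.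
- move=> l a b s hl ha hb.
  set r := density (w s - a); set r' := density (w s - b).
  have [r00 r'0] : 0 < r /\ 0 < r' by split; exact: dp0.
  have /andP[_ rMb] := db a s ha; have /andP[_ r'Mb] := db b s hb.
  rewrite -/r -/r' in rMb r'Mb.
  set mid := (1 - l) * a + l * b.
  have hmid : 0 <= mid <= v2.
    by move: hl ha hb => /andP[? ?] /andP[? ?] /andP[? ?]; rewrite /mid; apply/andP; split; nra.
  set g := (1 - l) * r + l * r'.
  have [l0 l1] := andP hl.
  have g0 : 0 < g by rewrite /g; nra.
  have gM : g <= rM by rewrite /g; nra.
  have /andP[hw1 _] := wb s.
  have gd : g <= density (w s - mid).
    apply: pressure_le_inv; [exact: ltW|exact: density_ge0|].
    rewrite p_density; last by case/andP: hmid; lra.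
    apply: (le_trans (pressure_convex _ _ _ hl (ltW r00) (ltW r'0))).
    rewrite /r /r' !p_density; [|by case/andP: hb; lra|by case/andP: ha; lra].
    by rewrite le_eqVlt; apply/orP; left; apply/eqP; rewrite /mid; ring.
  have rr : (a - b) ^+ 2 <= Cp ^+ 2 * (r - r') ^+ 2.
    wlog ab : a b ha hb @r @r' {mid hmid g g0 gM gd r00 r'0 rMb r'Mb} / a <= b.
      move=> G; have [/(G a b ha hb)//|/ltW/(G b a hb ha)] := leP a b.
      have sym (x y : R) : (x - y) ^+ 2 = (y - x) ^+ 2 by ring.
      by rewrite (sym a) (sym r).
    have /andP[s1 _] := slope a b s (proj1 (andP ha)) ab (proj2 (andP hb)).
    have s2 : b - a <= Cp * (r - r') by rewrite mulrC -ler_pdivrMr.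
    have s3 : 0 <= b - a by rewrite subr_ge0.
    have -> : (a - b) ^+ 2 = (b - a) ^+ 2 by ring.
    by rewrite -exprMn lerXn2r// nnegrE// (le_trans s3).
  have K := inv_convex l r r' hl r00 r'0; rewrite -/g in K.
  have i1 : (density (w s - mid))^-1 <= g^-1.
    by rewrite lef_pV2 ?posrE//; exact: lt_le_trans gd.
  have i2 : (Cp ^+ 2 * rM ^+ 3)^-1 * (l * (1 - l)) * (a - b) ^+ 2 <=
     l * (1 - l) * (r - r') ^+ 2 / (r * r' * g).
    have ll0 : 0 <= l * (1 - l) by rewrite mulr_ge0// subr_ge0.
    have -> : (Cp ^+ 2 * rM ^+ 3)^-1 * (l * (1 - l)) * (a - b) ^+ 2 =
       (l * (1 - l)) * ((a - b) ^+ 2 / Cp ^+ 2) / (rM * rM * rM).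
      by field; rewrite !gt_eqF.
    apply: ler_pM.
    + by rewrite mulr_ge0// divr_ge0 ?sqr_ge0.
    + by rewrite invr_ge0 !mulr_ge0// ltW.
    + by rewrite ler_wpM2l// ler_pdivrMr ?exprn_gt0// mulrC.
    + rewrite lef_pV2 ?posrE ?mulr_gt0//.
      by apply: ler_pM; rewrite ?mulr_ge0 ?(ltW r00) ?(ltW r'0) ?(ltW g0)//; apply: ler_pM; rewrite ?(ltW r00) ?(ltW r'0).
  have /andP[q1 _] := r0b s.
  rewrite /spacing_ratio -/(w s) -/r -/r'.
  have q0 : 0 < r0 s := lt_le_trans rm0 q1.
  have j1 := ler_wpM2l (ltW q0) i1.
  have i20 : 0 <= (Cp ^+ 2 * rM ^+ 3)^-1 * (l * (1 - l)) * (a - b) ^+ 2.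
    have c0 : 0 <= (Cp ^+ 2 * rM ^+ 3)^-1 by rewrite invr_ge0 ltW// mulr_gt0// exprn_gt0.
    have ll0 : 0 <= l * (1 - l) by rewrite mulr_ge0// subr_ge0.
    by rewrite mulr_ge0 ?sqr_ge0// mulr_ge0.
  have j2 : rm * ((Cp ^+ 2 * rM ^+ 3)^-1 * (l * (1 - l)) * (a - b) ^+ 2) <=
       r0 s * (l * (1 - l) * (r - r') ^+ 2 / (r * r' * g)).
    by apply: ler_pM => //; exact: ltW.
  have -> : (1 - l) * (r0 s / r) + l * (r0 s / r') = r0 s * ((1 - l) / r + l / r') by ring.
  rewrite -K mulrDr; lra.
- by move=> s; have [] := H s.
- move=> s; have [r0s _ _] := H s.
  by rewrite /spacing_ratio addrAC subrr add0r density_p ?(ltW r0s)// mulfV// gt_eqF.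
Qed.

End Pressure.

(** * Functions of bounded variation *)

Section Regulated.
Context {R : realType}.

Lemma monotone_left_cvg (f : R -> R) a b r : a < r -> r < b ->
  {in `[a, b] &, nondecreasing_fun f} -> cvg (f x @[x --> r^'-]).
Proof.
move=> ar rb ndf.
have ndf' (x y : R) : a <= x -> y <= b -> x <= y -> f x <= f y.
  by move=> ax yb xy; apply: ndf => //; rewrite in_itv/=; apply/andP; split; lra.
have near_a : \forall s \near r^'-, a <= s by exact: nbhs_left_ge.
apply: nondecreasing_at_left_is_cvgr; apply: filterS near_a => s as_.
  move=> x y; rewrite !in_itv/= => /andP[sx _] /andP[_ yr]; apply: ndf'; lra.
exists (f r) => _ [y + <-]; rewrite /= in_itv/= => /andP[sy yr]; apply: ndf'; lra.
Qed.

Lemma monotone_right_cvg (f : R -> R) a b r : a < r -> r < b ->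
  {in `[a, b] &, nondecreasing_fun f} -> cvg (f x @[x --> r^'+]).
Proof.
move=> ar rb ndf.
have ndf' (x y : R) : a <= x -> y <= b -> x <= y -> f x <= f y.
  by move=> ax yb xy; apply: ndf => //; rewrite in_itv/=; apply/andP; split; lra.
have near_b : \forall s \near r^'+, s <= b by exact: nbhs_right_le.
apply: nondecreasing_at_right_is_cvgr; apply: filterS near_b => s sb.
  move=> x y; rewrite !in_itv/= => /andP[rx _] /andP[_ ys]; apply: ndf'; lra.
exists (f r) => _ [y + <-]; rewrite /= in_itv/= => /andP[ry ys]; apply: ndf'; lra.
Qed.

Lemma monotone_continuous (f : R -> R) a b r : a < r -> r < b ->
  {in `[a, b] &, nondecreasing_fun f} -> ~ discontinuity f r -> {for r, continuous f}.
Proof.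
move=> ar rb ndf dr.
have cl := monotone_left_cvg f a b r ar rb ndf.
have cr := monotone_right_cvg f a b r ar rb ndf.
have E : lim (f x @[x --> r^'-]) = lim (f x @[x --> r^'+]).
  by apply/eqP; apply: contrapT => h; apply: dr; split => //; apply/negP.
have rab : r \in `[a, b] by rewrite in_itv/= !ltW.
have l1 : lim (f x @[x --> r^'-]) <= f r.
  apply: limr_le => //; near=> x.
  have xr : x <= r by near: x; apply: nbhs_left_le.
  apply: ndf => //; rewrite in_itv/=; apply/andP; split; first by near: x; apply: nbhs_left_ge.
  exact: le_trans xr (ltW rb).
have l2 : f r <= lim (f x @[x --> r^'+]).
  apply: limr_ge => //; near=> x.
  have xr : r <= x by near: x; apply: nbhs_right_ge.
  apply: ndf => //; rewrite in_itv/=; apply/andP; split; first exact: le_trans (ltW ar) xr.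
  by near: x; apply: nbhs_right_le.
have Er : lim (f x @[x --> r^'-]) = f r by apply/eqP; rewrite eq_le l1 E l2.
apply/left_right_continuousP; split; first by rewrite -Er.
by rewrite -Er E.
Unshelve. all: by end_near. Qed.

Lemma BV_decomposition (f : R -> R) a b : a <= b -> BV f -> exists g h : R -> R,
  [/\ {in `[a, b] &, nondecreasing_fun g}, {in `[a, b] &, nondecreasing_fun h} &
      {in `[a, b], f =1 g \- h}].
Proof.
move=> ab [M hM].
have bf : bounded_variation a b f.
  apply/bounded_variationP => //; rewrite ge0_fin_numE ?total_variation_ge0//.
  by apply: le_lt_trans (hM a b ab) _; exact: ltry.
exists (fine \o pos_tv a f), (fine \o neg_tv a f); split.
- exact: fine_neg_tv_nondecreasing (bounded_variationN bf).
- exact: fine_neg_tv_nondecreasing bf.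
- exact: bounded_variation_pos_neg_tvE bf.
Qed.

Lemma BV_left_limit (f : R -> R) r : BV f -> cvg (f x @[x --> r^'-]).
Proof.
move=> bf; have [ab [ar rb]] : r - 1 <= r + 1 /\ r - 1 < r /\ r < r + 1 by split; [|split]; lra.
have [g [h [ng nh E]]] := BV_decomposition f _ _ ab bf.
have cg := monotone_left_cvg g _ _ r ar rb ng.
have ch := monotone_left_cvg h _ _ r ar rb nh.
have c : cvg ((g \- h) x @[x --> r^'-]) by exact: is_cvgB.
apply/cvg_ex; exists (lim ((g \- h) x @[x --> r^'-])).
apply: cvg_trans c; apply: near_eq_cvg; near=> x.
apply/esym; apply: E; rewrite in_itv/=; apply/andP; split.
  by near: x; apply: nbhs_left_ge.
by apply: (le_trans _ (ltW rb)); near: x; apply: nbhs_left_le.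
Unshelve. all: by end_near. Qed.

(** On each bounded interval the function is a difference of two nondecreasing
    ones, each with countably many discontinuities; the intervals from [-(n+1)]
    to [n+1] exhaust the line. *)
Lemma BV_continuous (f : R -> R) : BV f ->
  exists2 D : set R, countable D & forall r, ~ D r -> {for r, continuous f}.
Proof.
move=> bf.
have ab (n : nat) : - n.+1%:R <= n.+1%:R :> R by rewrite (@le_trans _ _ 0)// oppr_le0.
pose G n := sval (cid (BV_decomposition f _ _ (ab n) bf)).
pose H n := sval (cid (svalP (cid (BV_decomposition f _ _ (ab n) bf)))).
have GH n : [/\ {in `[(- n.+1%:R : R), n.+1%:R] &, nondecreasing_fun (G n)},
     {in `[(- n.+1%:R : R), n.+1%:R] &, nondecreasing_fun (H n)} &
      {in `[(- n.+1%:R : R), n.+1%:R], f =1 G n \- H n}].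
  exact: (svalP (cid (svalP (cid (BV_decomposition f _ _ (ab n) bf))))).
pose S (i : nat * bool) : set R :=
  [set x | (x \in `](- i.1.+1%:R : R), i.1.+1%:R[) /\ discontinuity (if i.2 then G i.1 else H i.1) x].
exists (\bigcup_i S i).
  apply: bigcup_countable => [|[n []] _]; first exact: countableP.
    by apply: discontinuity_countable; have [] := GH n.
  by apply: discontinuity_countable; have [] := GH n.
move=> r Dr.
have [n rn] : exists n : nat, `|r| < n.+1%:R.
  by exists (Num.truncn `|r|); exact: truncnS_gt.
move: (rn); rewrite ltr_norml => /andP[r1 r2].
have [ng nh E] := GH n.
have cg : {for r, continuous (G n)}.
  apply: (monotone_continuous _ _ _ _ r1 r2 ng) => d; apply: Dr; exists (n, true) => //.
  by split => //=; rewrite in_itv/= r1 r2.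
have ch : {for r, continuous (H n)}.
  apply: (monotone_continuous _ _ _ _ r1 r2 nh) => d; apply: Dr; exists (n, false) => //.
  by split => //=; rewrite in_itv/= r1 r2.
have c : {for r, continuous (G n \- H n)} by apply: continuousB.
have rI : r \in `[(- n.+1%:R : R), n.+1%:R] by rewrite in_itv/= !ltW.
have roo : r \in `](- n.+1%:R : R), n.+1%:R[ by rewrite in_itv/= r1 r2.
rewrite /prop_for/continuous_at E//; apply: cvg_trans c.
apply: near_eq_cvg; near=> x; apply/esym; apply: E.
have xoo : x \in `](- n.+1%:R : R), n.+1%:R[ by near: x; exact: (near_in_itvoo roo).
by apply: subset_itv_oo_cc.
Unshelve. all: by end_near. Qed.

End Regulated.

(** * Null sets of the plane *)

Section Null.
Context {R : realType}.
Notation mu := (@lebesgue_measure R).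
Notation mu2 := (mu \x mu)%E.
Notation P := (measurableTypeR R * measurableTypeR R)%type.

Lemma graph_negligible (f : R -> R) : measurable_fun [set: measurableTypeR R] f ->
  mu2.-negligible [set z : P | z.2 = f z.1].
Proof.
move=> mf.
have mA : measurable ([set z : P | z.2 = f z.1]).
  have mg : measurable_fun [set: P] (fun z : P => (z.2 : R) - f z.1).
    apply: measurable_funB; first exact: measurable_snd.
    by apply: (measurableT_comp mf); exact: measurable_fst.
  rewrite (_ : [set z : P | _] = (fun z : P => (z.2 : R) - f z.1) @^-1` [set 0]).
    by rewrite -[X in measurable X]setTI; apply: mg.
  by apply/seteqP; split => z /= /eqP; rewrite ?subr_eq0 => /eqP //; move=> ->; rewrite subrr.
exists [set z : P | z.2 = f z.1]; split => //.
rewrite /product_measure1; apply: integral0_eq => t _ /=.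
rewrite (_ : xsection _ t = [set f t]); first exact: lebesgue_measure_set1.
by apply/seteqP; split => x; rewrite /xsection/= inE.
Qed.

Lemma countable_negligible (D : set R) (A : R -> set P) : countable D ->
  (forall d, mu2.-negligible (A d)) -> mu2.-negligible (\bigcup_(d in D) A d).
Proof.
move=> /countable_injP[f finj] nA.
have H n : mu2.-negligible (\bigcup_(d in [set d | D d /\ f d = n]) A d).
  have [[d [Dd fd]]|h] := pselect (exists d, D d /\ f d = n).
    apply: negligibleS (nA d) => z [d' [Dd' fd'] Az].
    by rewrite (finj d d') ?inE// fd.
  apply: negligibleS (negligible_set0 _) => z [d [Dd fd] _].
  by case: h; exists d.
apply: negligibleS (negligible_bigcup H) => z [d Dd Az].
by exists (f d) => //; exists d.
Qed.

End Null.

(** * Calculus of subgradients *)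

Section Subgradient.
Context {R : realType}.

(** Subgradients pass from a function to any larger one that agrees with it at
    the point; this is why the maximum of two labels inherits them. *)
Lemma subgrad_le (N A : R * R -> R) z gt gx : (forall z', A z' <= N z') -> N z = A z ->
  subgrad A z gt gx -> subgrad N z gt gx.
Proof.
move=> AN Nz h e e0; have [d d0 hd] := h e e0; exists d => // t x ht hx.
by rewrite Nz (le_trans (hd t x ht hx)).
Qed.

Lemma subgrad_min (N : R * R -> R) z d : 0 < d ->
  (forall z', `|z'.1 - z.1| < d -> `|z'.2 - z.2| < d -> N z <= N z') -> subgrad N z 0 0.
Proof.
move=> d0 h e e0; exists d => // t x ht hx.
rewrite !mul0r !addr0; apply: (le_trans _ (h (t, x) ht hx)).
by rewrite gerBl mulr_ge0 ?addr_ge0// ltW.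
Qed.

Lemma prim_le (g : R -> R) a b : bmeas g -> (forall s, 0 <= g s) -> a <= b -> prim g a <= prim g b.
Proof.
by move=> bg g0 ab; rewrite -subr_ge0 -(mul0r (b - a)); apply: pint_ge.
Qed.

(** Chain rule with a nondecreasing outer function, for which lower bounds
    suffice. *)
Lemma subgrad_prim (g : R -> R) (chi : R * R -> R) z gt gx : bmeas g -> (forall s, 0 <= g s) ->
  {for chi z, continuous g} -> subgrad chi z gt gx ->
  subgrad (prim g \o chi) z (g (chi z) * gt) (g (chi z) * gx).
Proof.
move=> bg g0 cg h e e0.
set a := chi z; pose C := `|gt| + `|gx| + 1.
have C0 : 0 < C by rewrite ltr_wpDl// addr_ge0.
pose e1 := Num.min 1 (e / (2 * (g a + 1))).
have ga1 : 0 < g a + 1 by rewrite ltr_wpDl.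
have e10 : 0 < e1 by rewrite lt_min ltr01 divr_gt0// mulr_gt0.
have e2 : 0 < e / (2 * C) by rewrite divr_gt0// mulr_gt0.
have [d d0 hd] := h e1 e10.
have [d1 /= d10 hd1] : exists2 d1, 0 < d1 & forall s, `|s - a| < d1 -> `|g s - g a| <= e / (2 * C).
  have /cvgrPdist_le/(_ _ e2)/nbhs_ballP[d1 /= d10 H] := cg.
  by exists d1 => // s hs; rewrite distrC; apply: H; rewrite /ball/= distrC.
exists (Num.min d (d1 / (2 * C))); first by rewrite lt_min d0 divr_gt0// mulr_gt0.
move=> t x; rewrite !lt_min => /andP[ht ht1] /andP[hx hx1].
have := hd t x ht hx; set dt := t - z.1 in ht1 *; set dx := x - z.2 in hx1 *.
set r := `|dt| + `|dx|; rewrite -/a => lower.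
have r0 : 0 <= r by rewrite addr_ge0.
pose u := gt * dt + gx * dx - e1 * r.
have e11 : e1 <= 1 by rewrite ge_min lexx.
have uC : `|u| <= C * r.
  rewrite /u (le_trans (ler_normB _ _))// (le_trans (lerD (ler_normD _ _) (lexx _)))//.
  rewrite !normrM (ger0_norm (ltW e10)) (ger0_norm r0).
  have : e1 * r <= 1 * r by rewrite ler_wpM2r.
  have := mulr_ge0 (normr_ge0 gt) (normr_ge0 dx).
  have := mulr_ge0 (normr_ge0 gx) (normr_ge0 dt); rewrite /C /r; lra.
have rd1 : C * r < d1.
  by rewrite mulrC -ltr_pdivlMr// /r; move: ht1 hx1; rewrite invfM mulrA; lra.
have au : a + u <= chi (t, x) by move: lower; rewrite /u; lra.
apply: (le_trans _ (prim_le _ _ _ bg g0 au)).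
have : `|pint g a (a + u) - g a * (a + u - a)| <= e / (2 * C) * `|a + u - a|.
  apply: pint_near => // s hs; apply: hd1; apply: le_lt_trans rd1; apply: le_trans uC.
  move: hs; case: (lerP a (a + u)) => hau /andP[hs1 hs2].
    by rewrite ger0_norm ?subr_ge0// ger0_norm; lra.
  by rewrite ler0_norm ?subr_le0// ler0_norm; lra.
rewrite (_ : a + u - a = u); last by ring.
rewrite ler_norml => /andP[p1 _].
have p2 : e / (2 * C) * `|u| <= e / 2 * r.
  have -> : e / 2 * r = e / (2 * C) * (C * r) by field; rewrite gt_eqF.
  by rewrite ler_wpM2l// ltW.
have p3 : g a * (e1 * r) <= e / 2 * r.
  rewrite mulrA ler_wpM2r//.
  have : (g a + 1) * e1 <= (g a + 1) * (e / (2 * (g a + 1))).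
    by rewrite ler_pM2l// ge_min lexx orbT.
  have -> : (g a + 1) * (e / (2 * (g a + 1))) = e / 2 by field; rewrite gt_eqF.
  move: (ltW e10); lra.
have p4 : g a * u = g a * gt * dt + g a * gx * dx - g a * (e1 * r) by rewrite /u; ring.
rewrite /pint in p1; rewrite /= -/a; lra.
Qed.

End Subgradient.

(** * Local integrability and convergence *)

Section LocalConvergence.
Context {R : realType}.
Notation mu := (@lebesgue_measure R).
Notation mu2 := (mu \x mu)%E.
Notation P := (measurableTypeR R * measurableTypeR R)%type.

Lemma bounded_locally_integrable2 (f : R * R -> R) (M : R) : measurable_fun [set: P] f ->
  (forall z, `|f z| <= M) -> locally_integrable2 f.
Proof.
move=> mf fM K cK _.
have clK : closed K by apply: compact_closed => //; exact: norm_hausdorff.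
have mK : measurable (K : set P).
  by rewrite -[K]setCK; apply: measurableC; apply: open_plane_measurable; rewrite openC.
have [m _ Km] := plane_compact_box K cK.
apply: measurable_bounded_integrable => //.
- apply: le_lt_trans (box_fin m); apply: le_measure; rewrite ?inE//; exact: measurable_box.
- exact: measurable_funTS.
- exists M; split; first by rewrite num_real.
  by move=> N MN z _ /=; rewrite (le_trans (fM z))// ltW.
Qed.

Lemma compact_itv (K : set R) : compact K -> exists2 m, 0 <= m & K `<=` `[- m, m]%classic.
Proof.
move=> /compact_bounded[M [_ hM]]; exists (`|M| + 1); first by rewrite addr_ge0.
move=> x Kx; rewrite /= in_itv/= -ler_norml; apply: (hM (`|M| + 1)) => //.
by rewrite (le_lt_trans (ler_norm _))// ltrDl.
Qed.

Lemma compact_fin (K : set R) : compact K -> (mu K < +oo)%E.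
Proof.
move=> cK; have [m m0 Km] := compact_itv _ cK.
have mI : (mu (`[(- m)%R, m]%classic : set R) < +oo)%E.
  by rewrite lebesgue_measure_itv/=; case: ifP => _; rewrite -?EFinB ltry.
by apply: le_lt_trans mI; apply: le_measure; rewrite ?inE//; exact: compact_measurable.
Qed.

Lemma bounded_integrable (f : R -> R) (M : R) K : measurable_fun [set: measurableTypeR R] f ->
  (forall x, `|f x| <= M) -> compact K -> mu.-integrable K (EFin \o f).
Proof.
move=> mf fM cK; apply: measurable_bounded_integrable => //.
- exact: compact_measurable.
- exact: compact_fin.
- exact: measurable_funTS.
- exists M; split; first by rewrite num_real.
  by move=> N MN z _ /=; rewrite (le_trans (fM z))// ltW.
Qed.

Lemma bounded_locally_integrable (f : R -> R) (M : R) : measurable_fun [set: measurableTypeR R] f ->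
  (forall x, `|f x| <= M) -> locally_integrable setT f.
Proof.
move=> mf fM; split => //; first exact: openT.
move=> K _ cK; have /integrableP[_] := bounded_integrable _ _ _ mf fM cK.
by apply.
Qed.

Lemma bounded_cvg_L1loc (g : R -> R -> R) (g0 : R -> R) (M : R) (E : set R) :
  (forall t, measurable_fun [set: measurableTypeR R] (g t)) ->
  measurable_fun [set: measurableTypeR R] g0 ->
  (forall t x, `|g t x| <= M) -> countable E ->
  (forall x, ~ E x -> g t x @[t --> 0^'+] --> g0 x) ->
  cvg_L1loc g g0.
Proof.
move=> mg mg0 gM cE gg0; split.
  by apply: nearW => t; exact: bounded_locally_integrable (mg t) (gM t).
move=> K cK; apply/cvge_at_rightP => u u0.
have mK : measurable K := compact_measurable cK.
have M0 : 0 <= M by apply: le_trans (gM 0 0).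
have ne : mu.-negligible E by
  exists E; split => //; [apply: countable_measurable|exact: countable_lebesgue_measure0].
have := @dominated_convergence _ _ _ mu K mK (fun n => EFin \o g (u n)) (EFin \o g0) (cst M%:E).
move=> [].
- by move=> n; apply/measurable_EFinP; exact: measurable_funTS.
- by apply/measurable_EFinP; exact: measurable_funTS.
- apply: negligibleS ne => x /= h; apply: contrapT => Ex; apply: h => _.
  apply: cvg_EFin; first exact: nearW.
  by have /cvg_at_rightP := gg0 x Ex; apply.
- by apply: (bounded_integrable (cst M) M) => // x; rewrite ger0_norm.
- by apply: aeW => x n _ /=; rewrite lee_fin.
by move=> _ + _.
Qed.

End LocalConvergence.

(** * Traffic stopped by a permanent red light *)

Section Traffic.
Context {R : realType}.
Notation mu := (@lebesgue_measure R).
Notation mu2 := (mu \x mu)%E.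
Notation P := (measurableTypeR R * measurableTypeR R)%type.
Context {p dp ddp : R -> R}.
Hypothesis hp : pressure p dp ddp.
Notation dens := (density hp).
Context {r0 v0 : R -> R} {v1 v2 w1 w2 : R}.
Hypothesis v10 : 0 < v1.
Hypothesis v2w1 : v2 < w1.
Hypothesis mr0 : measurable_fun [set: measurableTypeR R] r0.
Hypothesis mv0 : measurable_fun [set: measurableTypeR R] v0.
Hypothesis bounds : forall s, [/\ 0 < r0 s, v1 <= v0 s <= v2 & w1 <= v0 s + p (r0 s) <= w2].
Context {D : set R}.
Hypothesis countD : countable D.
Hypothesis contr0 : forall s, ~ D s -> {for s, continuous r0}.
Hypothesis contv0 : forall s, ~ D s -> {for s, continuous v0}.
Context {k1 k2 m c L : R}.
Notation k := (spacing_ratio hp r0 v0).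
Hypothesis hk : spacing k v0 v1 v2 k1 k2 m c L.

Notation position := (position hk).
Notation vel := (vel hk).
Notation label := (label hk).
Notation label_vel := (label_vel hk).
Notation origin := (origin hk).

(** The Lagrangian marker v + p(rho), which each car carries unchanged along its
    path. *)
Definition mark (s : R) : R := v0 s + p (r0 s).

Let v20 : 0 < v2. Proof. exact: sp_vm hk. Qed.
Let k1p : 0 < k1. Proof. exact: sp_k1 hk. Qed.
Let in0 : 0 <= (0:R) <= v2. Proof. by rewrite lexx ltW. Qed.
Let kbnd := sp_bound hk.
Let w10 : 0 < w1. Proof. exact: lt_trans v20 v2w1. Qed.
Let r0_gt0 s : 0 < r0 s. Proof. by have [] := bounds s. Qed.

Lemma mark_bound s : w1 <= mark s <= w2. Proof. by have [] := bounds s. Qed.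

Lemma pressure_continuous_at (x : R) : 0 < x -> {for x, continuous p}.
Proof.
move=> x0; case: hp => _ [dp1 _ _] _ _ _.
apply: differentiable_continuous; apply/derivable1_diffP.
by case: (nonneg_is_derive _ _ _ dp1 x0).
Qed.

Lemma mark_continuous s : ~ D s -> {for s, continuous mark}.
Proof.
move=> Ds; apply: cvgD; first exact: contv0.
by apply: (continuous_comp (contr0 _ Ds)); exact: pressure_continuous_at.
Qed.

Lemma measurable_mark : measurable_fun [set: measurableTypeR R] mark.
Proof.
apply: measurable_funD => //; apply: (measurable_pressure hp) => // s; exact: ltW.
Qed.

Lemma mark_density_gt0 (v s : R) : 0 <= v <= v2 -> 0 < dens (mark s - v).
Proof.
move=> /andP[_ h]; apply: density_gt0; have /andP[h1 _] := mark_bound s; have := v2w1; lra.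
Qed.

Lemma spacing_continuous (v s : R) : 0 <= v <= v2 -> ~ D s -> {for s, continuous (k v)}.
Proof.
move=> hv Ds; have d0 := mark_density_gt0 v s hv.
apply: cvgM; first exact: contr0.
apply: cvgV; first by rewrite gt_eqF.
apply: (@continuous_comp _ _ _ (fun s => mark s - v) dens).
  by apply: cvgB; [exact: mark_continuous|exact: cvg_cst].
apply: density_continuous; have /andP[h1 _] := mark_bound s; case/andP: hv; have := v2w1; lra.
Qed.

Lemma spacing_ratioE v s : k v s = r0 s / dens (mark s - v).
Proof. by []. Qed.

Lemma bmeas_r0 : bmeas r0.
Proof.
split => //; exists (dens w2) => s; rewrite ger0_norm ?(ltW (r0_gt0 s))//.
rewrite -[leLHS](density_p hp _ (ltW (r0_gt0 s))).
apply: density_le; have [_ /andP[h1 _] /andP[_ h2]] := bounds s; have := v10; lra.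
Qed.

Lemma bmeas_mark : bmeas mark.
Proof.
split; first exact: measurable_mark.
exists w2 => s; have /andP[h1 h2] := mark_bound s.
by rewrite ger0_norm// (le_trans (ltW w10)).
Qed.

Lemma exists_queue_label x : exists a, prim (k 0) a = x.
Proof.
apply: (bilipschitz_surjective _ k1 k2) => // a b ab.
exact: (pint_k_bound hk).
Qed.

(** In a queue of stopped cars with car 0 at the origin, car [a] stands at
    [prim (k 0) a]; this is the inverse. *)
Definition queue_label : R -> R := locked (fun x => sval (cid (exists_queue_label x))).

Lemma prim_queue_label x : prim (k 0) (queue_label x) = x.
Proof. by rewrite /queue_label -lock; case: cid. Qed.

Lemma prim0 g : prim g (0:R) = 0.
Proof. by rewrite primE subrr. Qed.

Lemma prim_k_lt (a b : R) : a < b -> prim (k 0) a < prim (k 0) b.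
Proof.
move=> ab; have /andP[h _] := pint_k_bound hk 0 a b in0 (ltW ab).
by rewrite -subr_gt0; apply: lt_le_trans h; rewrite mulr_gt0// subr_gt0.
Qed.

Lemma prim_k_le (a b : R) : a <= b -> prim (k 0) a <= prim (k 0) b.
Proof. by rewrite le_eqVlt => /predU1P[->//|/prim_k_lt/ltW]. Qed.

Lemma prim_k_le_inv (a b : R) : prim (k 0) a <= prim (k 0) b -> a <= b.
Proof. by move=> h; rewrite leNgt; apply/negP => /prim_k_lt; rewrite ltNge h. Qed.

Lemma queue_label_le (x y : R) : x <= y -> queue_label x <= queue_label y.
Proof. by move=> xy; apply: prim_k_le_inv; rewrite !prim_queue_label. Qed.

Lemma queue_label_lt (x y : R) : x < y -> queue_label x < queue_label y.
Proof.
move=> xy; rewrite ltNge; apply/negP => h.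
by have := prim_k_le _ _ h; rewrite !prim_queue_label leNgt xy.
Qed.

Lemma queue_label0 : queue_label 0 = 0.
Proof.
by apply/eqP; rewrite eq_le; apply/andP; split; apply: prim_k_le_inv; rewrite prim_queue_label prim0.
Qed.

Lemma queue_label_lip (x y : R) : `|queue_label y - queue_label x| <= `|y - x| / k1.
Proof.
wlog xy : x y / x <= y.
  by move=> H; have [/H//|/ltW/H] := leP x y; rewrite distrC [`|y - x|]distrC.
have h := queue_label_le _ _ xy; rewrite !ger0_norm ?subr_ge0// ler_pdivlMr// mulrC.
have /andP[+ _] := pint_k_bound hk 0 _ _ in0 h.
by rewrite /pint !prim_queue_label.
Qed.

(** At [x < 0] the car that stands there in the queue at the light. At [x >= 0]
    the value 0 separates the cars that have left before the light from those
    held behind it. *)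
Definition jam_label (x : R) : R := Num.min (queue_label x) 0.

Lemma jam_label_neg (x : R) : x < 0 -> jam_label x = queue_label x /\ queue_label x < 0.
Proof.
by move=> x0; have h : queue_label x < 0 by [rewrite -queue_label0; exact: queue_label_lt]; rewrite /jam_label min_l// ltW.
Qed.

Lemma jam_label_pos (x : R) : 0 <= x -> jam_label x = 0.
Proof. by move=> x0; rewrite /jam_label min_r// -queue_label0 queue_label_le. Qed.

Lemma jam_label_lip (x y : R) : `|jam_label y - jam_label x| <= `|y - x| / k1.
Proof.
apply: le_trans (queue_label_lip x y); rewrite /jam_label.
have := ler_norm (queue_label y - queue_label x); have := ler_norm (- (queue_label y - queue_label x)); rewrite normrN.
rewrite ler_norml; case: (lerP (queue_label y) 0); case: (lerP (queue_label x) 0) => h1 h2 h3 h4;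
  apply/andP; split; have := normr_ge0 (queue_label y - queue_label x); lra.
Qed.

(** Stopped cars are closer to each other than they were initially, so the car
    that stands at [x < 0] in the queue comes from farther behind. *)
Lemma jam_label_lt (x : R) : x != 0 -> jam_label x < x.
Proof.
move=> x0; have [xn|xp] := ltP x 0; last by rewrite jam_label_pos// lt_def x0.
have [-> _] := jam_label_neg _ xn.
suff h : x < prim (k 0) x.
  rewrite ltNge; apply/negP => xj.
  by have := prim_k_le _ _ xj; rewrite prim_queue_label leNgt h.
have : pint (k 0) x 0 <= (1 - m * v1) * (0 - x).
  apply: pint_leM; [exact: (spacing_bmeas hk)|exact: ltW|move=> s _].
  have /andP[h1 h2] := sp_v0 hk s.
  have /andP[+ _] := sp_mono hk 0 (v0 s) s (lexx _) (le_trans (ltW v10) h1) h2.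
  rewrite (sp_k0 hk) subr0.
  have := ler_wpM2l (ltW (sp_m hk)) h1; lra.
rewrite /pint prim0.
have : 0 < m * v1 * (0 - x).
  by rewrite !mulr_gt0 ?subr_gt0//; exact: sp_m hk.
lra.
Qed.

Definition free_label (z : R * R) : R := label z.1 z.2.
(** The queue overrides the free flow where the car that would be at this point
    without the light is behind the one standing there. *)
Definition flow_label (z : R * R) : R := Num.max (free_label z) (jam_label z.2).

Lemma flow_label_lip (z z' : R * R) : `|flow_label z' - flow_label z| <= (1 + v2) / k1 * (`|z'.1 - z.1| + `|z'.2 - z.2|).
Proof.
have h1 := label_lip2 hk z z'.
have h2 : `|jam_label z'.2 - jam_label z.2| <= (1 + v2) / k1 * (`|z'.1 - z.1| + `|z'.2 - z.2|).
  apply: (le_trans (jam_label_lip _ _)); rewrite mulrAC ler_wpM2r ?invr_ge0 ?(ltW k1p)//.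
  have := mulr_ge0 (ltW v20) (addr_ge0 (normr_ge0 (z'.1 - z.1)) (normr_ge0 (z'.2 - z.2))).
  have := normr_ge0 (z'.1 - z.1); lra.
move: h1 h2; rewrite -/(free_label z) -/(free_label z') !ler_norml => /andP[h1 h2] /andP[h3 h4].
rewrite /flow_label; case: (lerP (free_label z') (jam_label z'.2)); case: (lerP (free_label z) (jam_label z.2)) => a1 a2;
  apply/andP; split; lra.
Qed.

Definition free (z : R * R) : bool := jam_label z.2 <= free_label z.
Definition flow_velocity (z : R * R) : R := if free z then label_vel z else 0.
(** The third case is the stretch beyond the light that the last cars to pass
    have already left. *)
Definition flow_density (z : R * R) : R :=
  if free z || (z.2 < 0) then dens (mark (flow_label z) - flow_velocity z) else 0.
Definition flow_mark (z : R * R) : R := mark (flow_label z).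

Lemma flow_velocity_in z : 0 <= flow_velocity z <= v2.
Proof. by rewrite /flow_velocity; case: ifP => _ //; exact: label_vel_in. Qed.

Lemma flow_density_bound z : 0 <= flow_density z <= dens w2.
Proof.
rewrite /flow_density; case: ifP => _; last by rewrite lexx density_ge0.
apply/andP; split; first exact: (density_ge0 hp).
apply: (density_le hp).
have /andP[_ h] := mark_bound (flow_label z); have /andP[h' _] := flow_velocity_in z.
by rewrite lerBlDr (le_trans h)// lerDl.
Qed.

Lemma flow_density_mark z : flow_density z * (flow_velocity z + p (flow_density z)) = flow_density z * flow_mark z.
Proof.
rewrite /flow_density; case: ifP => _; last by rewrite !mul0r.
have /andP[h _] := mark_bound (flow_label z); have /andP[_ h'] := flow_velocity_in z.
have h0 : 0 <= mark (flow_label z) - flow_velocity z by rewrite subr_ge0 (le_trans h')// (le_trans (ltW v2w1)).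
by rewrite (p_density hp _ h0) [flow_velocity z + _]addrC subrK.
Qed.

Lemma flow_label_continuous : continuous flow_label.
Proof. exact: (lipschitz_plane_continuous _ _ flow_label_lip). Qed.

Lemma measurable_flow_label : measurable_fun [set: P] flow_label.
Proof. by apply: continuous_plane_measurable; exact: flow_label_continuous. Qed.

Lemma measurable_flow_mark : measurable_fun [set: P] flow_mark.
Proof. by apply: (measurableT_comp measurable_mark); exact: measurable_flow_label. Qed.

Lemma measurable_free : measurable_fun [set: P] free.
Proof.
apply: measurable_fun_ler; last exact: measurable_label.
apply: continuous_plane_measurable.
apply: (lipschitz_plane_continuous _ k1^-1) => z z'.
apply: (le_trans (jam_label_lip _ _)); rewrite mulrC ler_wpM2l ?invr_ge0 ?(ltW k1p)//.
by rewrite lerDr.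
Qed.

Lemma measurable_flow_velocity : measurable_fun [set: P] flow_velocity.
Proof.
apply: measurable_fun_ifT; [exact: measurable_free|exact: measurable_label_vel|exact: measurable_cst].
Qed.

Lemma measurable_flow_density : measurable_fun [set: P] flow_density.
Proof.
apply: measurable_fun_ifT; last exact: measurable_cst.
  apply: measurable_or; first exact: measurable_free.
  by apply: measurable_fun_ltr => //; exact: measurable_cst.
apply: (measurableT_comp (measurable_density hp)).
apply: measurable_funB; [exact: measurable_flow_mark|exact: measurable_flow_velocity].
Qed.

(** Where [k 0] is continuous, the queue label is differentiable with slope
    [1 / k 0]; near a point of the queue the truncation at 0 is inactive. *)
Lemma jam_label_subgrad (z : R * R) : z.2 < 0 -> ~ D (queue_label z.2) ->
  subgrad (fun z => jam_label z.2) z 0 (k 0 (queue_label z.2))^-1.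
Proof.
move=> z0 Da; set a := queue_label z.2; have [ja a0] := jam_label_neg _ z0.
set kk := k 0 a.
have kk0 : 0 < kk by have /andP[h _] := kbnd 0 a in0; exact: lt_le_trans k1p h.
move=> e e0.
have := spacing_continuous _ _ in0 Da => kc.
pose C := kk^-1 + e.
have C0 : 0 < C by rewrite addr_gt0// invr_gt0.
have ke : 0 < kk * e / C by rewrite divr_gt0// mulr_gt0.
have [d1 /= d10 hd1] : exists2 d1, 0 < d1 & forall s, `|s - a| < d1 -> `|k 0 s - kk| <= kk * e / C.
  have /cvgrPdist_le/(_ _ ke)/nbhs_ballP[d1 /= d10 H] := kc.
  by exists d1 => // s hs; rewrite distrC; apply: H; rewrite /ball/= distrC.
exists (Num.min d1 (- a) / C); first by rewrite divr_gt0// lt_min d10 oppr_gt0.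
move=> t x _; rewrite ltr_pdivlMr// lt_min mulrC.
set dx := x - z.2 => /andP[hx1 hx2].
rewrite mul0r addr0 ja -/a.
pose u := kk^-1 * dx - e * `|dx|.
have uC : `|u| <= C * `|dx|.
  rewrite /u (le_trans (ler_normB _ _))// normrM ger0_norm ?invr_ge0 ?(ltW kk0)//.
  by rewrite [`|e * _|]ger0_norm ?mulr_ge0 ?(ltW e0)// /C mulrDl.
have aux : a + u <= jam_label x.
  have au0 : a + u <= 0.
    have := ler_norm u; lra.
  rewrite /jam_label le_min au0 andbT; apply: prim_k_le_inv; rewrite prim_queue_label.
  have : `|pint (k 0) a (a + u) - kk * (a + u - a)| <= kk * e / C * `|a + u - a|.
    apply: pint_near; first exact: (spacing_bmeas hk).
    move=> s hs; apply: hd1; apply: le_lt_trans hx1; apply: le_trans uC.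
    move: hs; case: (lerP a (a + u)) => hau /andP[hs1 hs2].
      by rewrite ger0_norm ?subr_ge0// ger0_norm; lra.
    by rewrite ler0_norm ?subr_le0// ler0_norm; lra.
  rewrite (_ : a + u - a = u); last by ring.
  rewrite ler_norml => /andP[_ p1].
  have p2 : kk * e / C * `|u| <= kk * e * `|dx|.
    have -> : kk * e * `|dx| = kk * e / C * (C * `|dx|) by field; rewrite gt_eqF.
    by rewrite ler_wpM2l// ltW.
  have p4 : kk * u = dx - kk * e * `|dx|.
    by rewrite /u mulrBr mulrA mulfV ?gt_eqF// mul1r mulrA.
  move: p1; rewrite /pint [prim _ a]prim_queue_label /dx in p4 *; lra.
apply: (le_trans _ aux); rewrite /u.
have : 0 <= e * `|t - z.1| by rewrite mulr_ge0// ltW.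
lra.
Qed.

(** The subgradient comes from the free label, from the queue label, or, in the
    vacuum, from the fact that [flow_label] has its smallest local value 0
    there. In the first two cases the slope in space is [1 / k], which is
    [flow_density] over the initial density of the car. *)
Lemma flow_subgrad (g : R -> R) (z : R * R) : bmeas g -> (forall s, 0 <= g s) ->
  (forall s, ~ D s -> {for s, continuous g}) ->
  0 < z.1 -> ~ D (free_label z) -> (z.2 < 0 -> ~ D (queue_label z.2)) -> z.2 != 0 ->
  subgrad (prim g \o flow_label) z (- (g (flow_label z) / r0 (flow_label z) * flow_density z * flow_velocity z)) (g (flow_label z) / r0 (flow_label z) * flow_density z).
Proof.
move=> bg g0 cg z1 Dl Dj zn0; have [fz|fz] := boolP (free z).
  have chiE : flow_label z = free_label z by rewrite /flow_label max_l.
  have vE : flow_velocity z = vel z.1 (free_label z) by rewrite /flow_velocity fz label_velE.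
  have hv := vel_in hk z.1 (free_label z).
  have kc := spacing_continuous _ _ hv Dl.
  have S : subgrad flow_label z (- (vel z.1 (free_label z) / k (vel z.1 (free_label z)) (free_label z))) (k (vel z.1 (free_label z)) (free_label z))^-1.
    apply: (subgrad_le _ free_label) => //; first by move=> z'; rewrite /flow_label le_max lexx.
    have := label_subgrad hk z.1 z.2 z1; rewrite -/(free_label z) -surjective_pairing.
    apply => e e0; have /cvgrPdist_le/(_ _ e0)/nbhs_ballP[d1 /= d10 H] := kc.
    by exists d1 => // s hs; rewrite distrC; apply: H; rewrite /ball/= distrC.
  have Dc : {for flow_label z, continuous g} by rewrite chiE; exact: cg.
  have S2 := subgrad_prim g flow_label z _ _ bg g0 Dc S.
  have rE : flow_density z = dens (mark (free_label z) - vel z.1 (free_label z)) by rewrite /flow_density fz /= chiE vE.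
  have d0 := mark_density_gt0 _ (free_label z) hv; have r00 := r0_gt0 (free_label z).
  move: S2; rewrite rE vE !chiE spacing_ratioE.
  move: (g (free_label z)) (vel z.1 (free_label z)) (dens (mark (free_label z) - vel z.1 (free_label z))) (r0 (free_label z)) d0 r00.
  move=> ga u d ra d0 ra0.
  have -> : ga * - (u / (ra / d)) = - (ga / ra * d * u) by field; rewrite !gt_eqF.
  by have -> : ga / (ra / d) = ga / ra * d by field; rewrite !gt_eqF.
have chiE : flow_label z = jam_label z.2 by rewrite /flow_label max_r// ltW// ltNge.
have vE : flow_velocity z = 0 by rewrite /flow_velocity (negbTE fz).
have [zneg|zpos] := ltP z.2 0.
  have {}Dj := Dj zneg; have [ja a0] := jam_label_neg _ zneg.
  have S : subgrad flow_label z 0 (k 0 (queue_label z.2))^-1.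
    apply: (subgrad_le _ (fun z => jam_label z.2)) => //; first by move=> z'; rewrite /flow_label le_max lexx orbT.
    exact: jam_label_subgrad.
  have Dc : {for flow_label z, continuous g} by rewrite chiE ja; exact: cg.
  have S2 := subgrad_prim g flow_label z _ _ bg g0 Dc S.
  have rE : flow_density z = dens (mark (queue_label z.2) - 0) by rewrite /flow_density (negbTE fz) zneg /= chiE ja vE.
  have d0 := mark_density_gt0 _ (queue_label z.2) in0; have r00 := r0_gt0 (queue_label z.2).
  move: S2; rewrite rE vE !chiE !ja spacing_ratioE.
  move: (g (queue_label z.2)) (dens (mark (queue_label z.2) - 0)) (r0 (queue_label z.2)) d0 r00.
  move=> ga d ra d0 ra0.
  rewrite !mulr0 oppr0.
  by have -> : ga / (ra / d) = ga / ra * d by field; rewrite !gt_eqF.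
have -> : flow_density z = 0 by rewrite /flow_density (negbTE fz) ltNge zpos.
rewrite vE !mulr0 oppr0.
have z20 : 0 < z.2 by rewrite lt_def zn0.
apply: (subgrad_min _ _ z.2) => // z' _ hz'.
apply: prim_le => //; rewrite chiE (jam_label_pos _ zpos) /flow_label le_max.
rewrite (jam_label_pos z'.2) ?lexx ?orbT//.
by move: hz'; rewrite ltr_norml => /andP[]; lra.
Qed.

(** The bad points lie on the paths of countably many cars, or of their places
    in the queue, or on the line [x = 0]: countably many graphs. *)
Lemma ae_regular : {ae mu2, forall z : P, [/\ ~ D (free_label z), z.2 < 0 -> ~ D (queue_label z.2) & z.2 != 0]}.
Proof.
pose A (d : R) : set P := [set z : P | z.2 = position (tpos z.1) d] `|` [set z : P | z.2 = prim (k 0) d].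
have nA d : mu2.-negligible (A d).
  apply: negligibleU.
    apply: (graph_negligible (fun t => position (tpos t) d)).
    apply: continuous_measurable_fun => t.
    apply/cvgrPdist_lt => e e0.
    have e1 : 0 < e / v2 by rewrite divr_gt0.
    apply: filterS (nbhsx_ballx t _ e1) => s; rewrite /ball/= => h.
    rewrite distrC (le_lt_trans (position_lip_time hk _ _ _ (tpos_ge0 t) (tpos_ge0 s)))//.
    rewrite mulrC -ltr_pdivlMr//; apply: le_lt_trans h; rewrite distrC; exact: tpos_lip.
  by apply: (graph_negligible (fun=> prim (k 0) d)); exact: measurable_cst.
have n0 : mu2.-negligible [set z : P | z.2 = 0 :> R].
  by apply: (graph_negligible (fun=> 0)); exact: measurable_cst.
apply: negligibleS (negligibleU (countable_negligible D A countD nA) n0) => z /= h.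
have [z0|z0] := eqVneq (z.2 : R) 0; first by right.
left; apply: contrapT => nz; apply: h; split => //.
  move=> Dl; apply: nz; exists (free_label z) => //; left; rewrite /= /free_label.
  by rewrite position_label.
by move=> _ Dj; apply: nz; exists (queue_label z.2) => //; right; rewrite /= prim_queue_label.
Qed.

(** Conservation of the quantity that has initial density [g] and is carried by
    the cars: its cumulated amount [prim g] of the label is Lipschitz, and its
    weak gradient is the pair of minus the flux and the density. *)
Lemma flow_weak (g : R -> R) phi : bmeas g -> (forall s, 0 <= g s) ->
  (forall s, ~ D s -> {for s, continuous g}) -> C1c phi ->
  (forall s, g s / r0 s <= w2 + 1) ->
  int2 (fun z => g (flow_label z) / r0 (flow_label z) * flow_density z * dt phi z) +
  int2 (fun z => g (flow_label z) / r0 (flow_label z) * flow_density z * flow_velocity z * dx phi z) = 0.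
Proof.
move=> bg g0 cg cphi gr.
have [G hG] := bg.2.
have G0 : 0 <= G by exact: le_trans (hG 0).
pose q s := g s / r0 s.
have qb s : 0 <= q s <= w2 + 1 by rewrite gr divr_ge0// ltW.
pose gx z := q (flow_label z) * flow_density z.
pose gt z := - (q (flow_label z) * flow_density z * flow_velocity z).
have w21 : 0 <= w2 + 1 by case/andP: (qb 0) => h1 h2; exact: le_trans h1 h2.
have dw : 0 <= dens w2 by exact: (density_ge0 hp).
pose C := (1 + v2) / k1.
have C0 : 0 <= C by rewrite divr_ge0 ?(ltW k1p)// addr_ge0// ltW.
pose M := (w2 + 1) * dens w2 * (1 + v2) + G * C.
have v21 : 0 <= 1 + v2 by rewrite addr_ge0// ltW.
have wd0 : 0 <= (w2 + 1) * dens w2 by rewrite mulr_ge0.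
have wdv : 0 <= (w2 + 1) * dens w2 * v2 by rewrite mulr_ge0// ltW.
have GC : 0 <= G * C by rewrite mulr_ge0.
have mq : measurable_fun [set: P] (fun z => q (flow_label z)).
  apply: (measurableT_comp _ measurable_flow_label); apply: measurable_funM; first by case: bg.
  by apply: measurable_funV_gt0.
have mgx : measurable_fun [set: P] gx by apply: measurable_funM => //; exact: measurable_flow_density.
have mgt : measurable_fun [set: P] gt.
  by apply: measurable_funN; apply: measurable_funM => //; exact: measurable_flow_velocity.
have gxb z : `|gx z| <= (w2 + 1) * dens w2.
  have /andP[q1 q2] := qb (flow_label z); have /andP[r1 r2] := flow_density_bound z.
  by rewrite /gx normrM (ger0_norm q1) (ger0_norm r1); apply: ler_pM.
have gxM z : `|gx z| <= M.
  by apply: (le_trans (gxb z)); rewrite /M mulrDr mulr1 -addrA lerDl addr_ge0.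
have gtM z : `|gt z| <= M.
  have /andP[v1' v2'] := flow_velocity_in z.
  rewrite /gt normrN normrM -/(gx z) (ger0_norm v1').
  apply: (@le_trans _ _ ((w2 + 1) * dens w2 * v2)); first by apply: ler_pM.
  by rewrite /M mulrDr mulr1 addrAC lerDr addr_ge0.
have NL z z' : `|(prim g \o flow_label) z' - (prim g \o flow_label) z| <= M * (`|z'.1 - z.1| + `|z'.2 - z.2|).
  have pl a b : `|prim g b - prim g a| <= G * `|b - a|.
    wlog ab : a b / a <= b.
      by move=> H; have [/H//|/ltW/H] := leP a b; rewrite distrC [`|b - a|]distrC.
    have p1 : pint g a b <= G * (b - a).
      by apply: pint_leM => // s _; exact: le_trans (ler_norm _) (hG s).
    have p2 : 0 * (b - a) <= pint g a b by apply: pint_ge.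
    rewrite -/(pint g a b) [`|b - a|]ger0_norm ?subr_ge0// ger0_norm//.
    by apply: le_trans p2; rewrite mul0r.
  apply: (le_trans (pl _ _)); apply: (le_trans (ler_wpM2l G0 (flow_label_lip z z'))).
  by rewrite mulrA ler_wpM2r ?addr_ge0// /M lerDr mulr_ge0.
have S : {ae mu2, forall z, 0 < z.1 -> subgrad (prim g \o flow_label) z (gt z) (gx z)}.
  apply: ae2S ae_regular => z [h1 h2 h3] z1.
  exact: flow_subgrad.
have W := weak_gradient _ _ _ _ NL mgt mgx gtM gxM S phi cphi.
have bdx : bsupp (dx phi) by have [] := C1c_bsupp phi cphi.
have -> : int2 (fun z => g (flow_label z) / r0 (flow_label z) * flow_density z * flow_velocity z * dx phi z) =
    - int2 (fun z => gt z * dx phi z).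
  rewrite -mulN1r -int2Z; last by apply: (bsuppM _ _ M).
  by congr int2; apply/funext => z; rewrite /gt /q; ring.
by rewrite -W subrr.
Qed.

Lemma label_start (x : R) : label 0 x = x.
Proof. by apply: label_unique; rewrite tpos_id// position0. Qed.

Lemma free_label_start_lip (t x : R) : 0 <= t -> `|free_label (t, x) - x| <= v2 / k1 * t.
Proof.
move=> t0; have := label_lip hk 0 x t x.
by rewrite label_start subrr normr0 add0r subr0 (ger0_norm t0) mulrAC.
Qed.

Lemma free_label_start_cvg (x : R) : free_label (t, x) @[t --> (0:R)^'+] --> x.
Proof.
apply/cvgrPdist_le => e e0.
have C0 : 0 < v2 / k1 by rewrite divr_gt0.
near=> t.
have t0 : 0 < t by near: t; exact: nbhs_right_gt.
have te : t < e / (v2 / k1) by near: t; apply: nbhs_right_lt; rewrite divr_gt0.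
rewrite distrC (le_trans (free_label_start_lip t x (ltW t0)))//.
by rewrite mulrC -ler_pdivlMr// ltW.
Unshelve. all: by end_near. Qed.

(** For [x != 0] the queue label is strictly below [x], which is the free label
    at time 0. *)
Lemma free_start (x : R) : x != 0 -> \forall t \near (0:R)^'+, free (t, x).
Proof.
move=> x0; have jx := jam_label_lt _ x0.
have d0 : 0 < x - jam_label x by rewrite subr_gt0.
have /cvgrPdist_le/(_ _ d0) := free_label_start_cvg x; apply: filterS => t h.
rewrite /free /=; have := ler_norm (x - free_label (t, x)); lra.
Qed.

(** Finite speed of propagation: the car at [x] and its origin both tend to [x],
    so [speed_local] squeezes the speed between values of [v0] near [x]. *)
Lemma flow_velocity_start (x : R) : x != 0 -> ~ D x -> flow_velocity (t, x) @[t --> (0:R)^'+] --> v0 x.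
Proof.
move=> x0 Dx; apply/cvgrPdist_le => e e0.
have [d /= d0 hd] : exists2 d, 0 < d & forall s, `|s - x| < d -> `|v0 s - v0 x| <= e.
  have /cvgrPdist_le/(_ _ e0)/nbhs_ballP[d /= d0 H] := contv0 _ Dx.
  by exists d => // s hs; rewrite distrC; apply: H; rewrite /ball/= distrC.
pose C := v2 / k1 + v2 / (m * v1).
have m0 : 0 < m := sp_m hk.
have C0 : 0 < C by rewrite addr_gt0 ?divr_gt0// mulr_gt0.
near=> t.
have t0 : 0 < t by near: t; exact: nbhs_right_gt.
have td : t < d / 2 / C by near: t; apply: nbhs_right_lt; rewrite !divr_gt0.
have ft : free (t, x) by near: t; exact: free_start.
have tC : C * t < d / 2 by rewrite mulrC -ltr_pdivlMr.
have l1 := free_label_start_lip t x (ltW t0).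
set a := free_label (t, x) in l1 *.
have o1 := origin_ge hk t a (ltW t0).
have o2 : origin t a <= a + v2 / (m * v1) * t := origin_le hk t a (ltW t0).
have oC : `|origin t a - x| <= C * t.
  move: l1; rewrite !ler_norml /C => /andP[l1 l2].
  have p1 : 0 <= v2 / (m * v1) * t by rewrite mulr_ge0 ?(ltW t0)// divr_ge0 ?(ltW v20)// ltW// mulr_gt0.
  apply/andP; split; lra.
have -> : flow_velocity (t, x) = vel t a by rewrite /flow_velocity ft label_velE.
have d20 : 0 < d / 2 by rewrite divr_gt0.
have : v0 x - e <= vel t a <= v0 x + e.
  apply: (speed_local hk t a _ _ (d / 2)) => // s hs.
  have : `|s - x| < d.
    have -> : s - x = (s - origin t a) + (origin t a - x) by ring.
    rewrite (le_lt_trans (ler_normD _ _))//; lra.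
  by move=> /hd; rewrite ler_norml => /andP[? ?]; apply/andP; split; lra.
by rewrite ler_norml => /andP[? ?]; apply/andP; split; lra.
Unshelve. all: by end_near. Qed.

Lemma flow_density_start (x : R) : x != 0 -> ~ D x -> flow_density (t, x) @[t --> (0:R)^'+] --> r0 x.
Proof.
move=> x0 Dx.
have pr : 0 < p (r0 x).
  by rewrite -(pressure0 hp); apply: (pressure_lt hp).
have c1 : mark (free_label (t, x)) @[t --> (0:R)^'+] --> mark x.
  by apply: (cvg_comp (fun t => free_label (t, x)) mark (free_label_start_cvg x)); exact: mark_continuous.
have c2 : mark (free_label (t, x)) - flow_velocity (t, x) @[t --> (0:R)^'+] --> p (r0 x).
  have -> : p (r0 x) = mark x - v0 x by rewrite /mark addrAC subrr add0r.
  by apply: cvgB => //; exact: flow_velocity_start.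
have c3 : dens (mark (free_label (t, x)) - flow_velocity (t, x)) @[t --> (0:R)^'+] --> r0 x.
  rewrite -[X in _ --> X](density_p hp _ (ltW (r0_gt0 x))).
  apply: (cvg_comp (fun t => mark (free_label (t, x)) - flow_velocity (t, x)) dens c2).
  exact: density_continuous.
apply: cvg_trans c3; apply: near_eq_cvg.
have := free_start _ x0; apply: filterS => t ft.
by rewrite /flow_density ft /= /flow_label max_l.
Qed.

(** At a positive time car 0 would be at least at [v1 * t] without the light, so
    the free label at the origin is negative, while the jam label is 0 there;
    both are continuous. *)
Lemma red_light (t : R) : 0 < t -> exists2 d, 0 < d & forall x, `|x| < d -> ~~ free (t, x).
Proof.
move=> t0; have l0 : free_label (t, 0) < 0.
  rewrite ltNge; apply/negP => h.
  have := position_incr hk t _ _ (ltW t0) h => /andP[h1 _].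
  have E : position t (free_label (t, 0)) = 0 by have := position_label hk t 0; rewrite tpos_id// ltW.
  have h2 := position_ge hk t 0 (ltW t0).
  have h3 : 0 < v1 * t by rewrite mulr_gt0.
  have h4 : 0 <= k1 * (free_label (t, 0) - 0) by rewrite mulr_ge0 ?subr_ge0// ltW.
  rewrite E in h1; lra.
exists (k1 * (- free_label (t, 0)) / 2); first by rewrite divr_gt0// mulr_gt0// oppr_gt0.
move=> x xd.
have h1 := label_lip hk t 0 t x.
have h2 := jam_label_lip 0 x.
rewrite !subr0 subrr normr0 mulr0 addr0 in h1; rewrite subr0 (jam_label_pos 0)// subr0 in h2.
have h3 : `|x| / k1 < - free_label (t, 0) / 2.
  by rewrite ltr_pdivrMr// mulrC mulrA.
rewrite /free /= -ltNge.
have := ler_norm (label t x - label t 0); have := ler_norm (- jam_label x); rewrite normrN.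
rewrite -/(free_label (t, x)) -/(free_label (t, 0)) in h1 *; lra.
Qed.

Lemma queue_label_cvg_left (f : R -> R) (l : R) : f x @[x --> (0:R)^'-] --> l ->
  f (queue_label x) @[x --> (0:R)^'-] --> l.
Proof.
move=> /cvgrPdist_le cf; apply/cvgrPdist_le => e e0; have := cf e e0.
rewrite near_withinE => /nbhs_ballP[d /= d0 H].
rewrite near_withinE.
have dk : 0 < d * k1 by rewrite mulr_gt0.
apply: filterS (nbhsx_ballx (0:R) _ dk) => x.
rewrite /ball/= sub0r normrN => xd x0.
have [_ jn] := jam_label_neg _ x0.
apply: H => //; rewrite /ball/= sub0r normrN.
have := queue_label_lip 0 x; rewrite queue_label0 !subr0 => /le_lt_trans; apply.
by rewrite ltr_pdivrMr.
Qed.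

(** Near the light the traffic stands still on the left and there is vacuum on
    the right; the density on the left is a function of the marker of the queued
    car. *)
Lemma flow_trace (t : R) : 0 < t -> cvg (r0 x @[x --> (0:R)^'-]) -> cvg (v0 x @[x --> (0:R)^'-]) ->
  exists rl : R, [/\ flow_density (t, x) @[x --> (0:R)^'-] --> rl, flow_velocity (t, x) @[x --> (0:R)^'-] --> (0:R),
    flow_density (t, x) @[x --> (0:R)^'+] --> (0:R) & flow_velocity (t, x) @[x --> (0:R)^'+] --> (0:R)].
Proof.
move=> t0 cr cv; have [d d0 hd] := red_light _ t0.
set rl := lim (r0 x @[x --> (0:R)^'-]) in cr; set vl := lim (v0 x @[x --> (0:R)^'-]) in cv.
have rl0 : 0 < rl.
  apply: (@lt_le_trans _ _ (dens (w1 - v2))).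
    by apply: density_gt0; rewrite subr_gt0.
  apply: limr_ge => //; apply: nearW => x.
  rewrite -[leRHS](density_p hp _ (ltW (r0_gt0 x))); apply: density_le.
  by have [_ /andP[_ h1] /andP[h2 _]] := bounds x; lra.
have vl0 : v1 <= vl by apply: limr_ge => //; apply: nearW => x; have [_ /andP[]] := bounds x.
have pl0 : 0 < p rl by rewrite -(pressure0 hp); apply: (pressure_lt hp).
have cm : mark x @[x --> (0:R)^'-] --> vl + p rl.
  apply: cvgD => //; apply: (cvg_comp r0 p cr); exact: pressure_continuous_at.
have cd : dens (mark x) @[x --> (0:R)^'-] --> dens (vl + p rl).
  apply: (cvg_comp mark dens cm); apply: density_continuous.
  by rewrite addr_gt0// (lt_le_trans v10).
have cj : dens (mark (queue_label x)) @[x --> (0:R)^'-] --> dens (vl + p rl).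
  exact: (queue_label_cvg_left (fun a => dens (mark a))).
have dn : 0 < d by [].
exists (dens (vl + p rl)); split.
- apply: cvg_trans cj; apply: near_eq_cvg; near=> x.
  have x0 : x < 0 by near: x; exact: nbhs_left_lt.
  have xd : - d < x by near: x; apply: nbhs_left_gt; rewrite oppr_lt0.
  have nf : ~~ free (t, x) by apply: hd; rewrite ltr0_norm// ltrNl.
  rewrite /flow_density /flow_velocity (negbTE nf) /= x0 subr0 /flow_label max_r; last by rewrite ltW// ltNge.
  by have [-> _] := jam_label_neg _ x0.
- apply: cvg_near_cst; near=> x.
  have x0 : x < 0 by near: x; exact: nbhs_left_lt.
  have xd : - d < x by near: x; apply: nbhs_left_gt; rewrite oppr_lt0.
  have nf : ~~ free (t, x) by apply: hd; rewrite ltr0_norm// ltrNl.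
  by rewrite /flow_velocity (negbTE nf).
- apply: cvg_near_cst; near=> x.
  have x0 : 0 < x by near: x; exact: nbhs_right_gt.
  have xd : x < d by near: x; apply: nbhs_right_lt.
  have nf : ~~ free (t, x) by apply: hd; rewrite gtr0_norm.
  by rewrite /flow_density (negbTE nf) /= ltNge (ltW x0).
- apply: cvg_near_cst; near=> x.
  have x0 : 0 < x by near: x; exact: nbhs_right_gt.
  have xd : x < d by near: x; apply: nbhs_right_lt.
  have nf : ~~ free (t, x) by apply: hd; rewrite gtr0_norm.
  by rewrite /flow_velocity (negbTE nf).
Unshelve. all: by end_near. Qed.

Definition sol_density (t x : R) : R := if 0 < t then flow_density (t, x) else r0 x.
Definition sol_velocity (t x : R) : R := if 0 < t then flow_velocity (t, x) else v0 x.

Lemma sol_density_bound t x : 0 <= sol_density t x <= dens w2.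
Proof.
rewrite /sol_density; case: ifP => _; first exact: flow_density_bound.
rewrite (ltW (r0_gt0 x)) /= -[leLHS](density_p hp _ (ltW (r0_gt0 x))).
apply: density_le; have [_ /andP[h1 _] /andP[_ h2]] := bounds x; have := v10; lra.
Qed.

Lemma sol_velocity_bound t x : 0 <= sol_velocity t x <= v2.
Proof.
rewrite /sol_velocity; case: ifP => _; first exact: flow_velocity_in.
by have [_ /andP[h1 ->] _] := bounds x; rewrite andbT (le_trans (ltW v10)).
Qed.

Lemma measurable_tpos : measurable_fun [set: P] (fun z : P => (0:R) < z.1).
Proof. by apply: measurable_fun_ltr => //; exact: measurable_cst. Qed.

Lemma measurable_sol_density : measurable_fun [set: P] (fun z => sol_density z.1 z.2).
Proof.
apply: measurable_fun_ifT; [exact: measurable_tpos| |].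
  by rewrite (_ : (fun z => _) = flow_density); [exact: measurable_flow_density|apply/funext => -[]].
by apply: (measurableT_comp mr0); exact: measurable_snd.
Qed.

Lemma measurable_sol_velocity : measurable_fun [set: P] (fun z => sol_velocity z.1 z.2).
Proof.
apply: measurable_fun_ifT; [exact: measurable_tpos| |].
  by rewrite (_ : (fun z => _) = flow_velocity); [exact: measurable_flow_velocity|apply/funext => -[]].
by apply: (measurableT_comp mv0); exact: measurable_snd.
Qed.

Lemma measurable_sol_pressure : measurable_fun [set: P] (fun z => p (sol_density z.1 z.2)).
Proof.
apply: (measurable_pressure hp); first exact: measurable_sol_density.
by move=> z; case/andP: (sol_density_bound z.1 z.2).
Qed.

Lemma sol_pressure_bound t x : 0 <= p (sol_density t x) <= w2.
Proof.
have /andP[h1 h2] := sol_density_bound t x.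
have w20 : 0 <= w2 by have /andP[a b] := mark_bound 0; rewrite (le_trans (ltW w10))// (le_trans a).
rewrite -[X in X <= _ <= _](pressure0 hp) -[X in _ <= _ <= X](p_density hp _ w20).
by apply/andP; split; apply: (pressure_le hp).
Qed.

Lemma sol_integrable :
  [/\ locally_integrable2 (fun z => u1 (sol_density z.1 z.2) (sol_velocity z.1 z.2)),
      locally_integrable2 (fun z => u2 p (sol_density z.1 z.2) (sol_velocity z.1 z.2)),
      locally_integrable2 (fun z => f1 (sol_density z.1 z.2) (sol_velocity z.1 z.2)) &
      locally_integrable2 (fun z => f2 p (sol_density z.1 z.2) (sol_velocity z.1 z.2))].
Proof.
have mr := measurable_sol_density; have mv := measurable_sol_velocity; have mp := measurable_sol_pressure.
have rb z : `|sol_density z.1 z.2| <= dens w2.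
  by have /andP[h1 h2] := sol_density_bound z.1 z.2; rewrite ger0_norm.
have vb z : `|sol_velocity z.1 z.2| <= v2.
  by have /andP[h1 h2] := sol_velocity_bound z.1 z.2; rewrite ger0_norm.
have wb z : `|sol_velocity z.1 z.2 + p (sol_density z.1 z.2)| <= v2 + w2.
  have /andP[h1 h2] := sol_pressure_bound z.1 z.2.
  by rewrite (le_trans (ler_normD _ _))// lerD// ger0_norm.
have mw : measurable_fun [set: P] (fun z => sol_velocity z.1 z.2 + p (sol_density z.1 z.2)).
  exact: measurable_funD.
split.
- exact: bounded_locally_integrable2 mr rb.
- apply: (bounded_locally_integrable2 _ (dens w2 * (v2 + w2))); first exact: measurable_funM.
  by move=> z; rewrite normrM ler_pM.
- apply: (bounded_locally_integrable2 _ (dens w2 * v2)); first exact: measurable_funM.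
  by move=> z; rewrite normrM ler_pM.
- apply: (bounded_locally_integrable2 _ (dens w2 * v2 * (v2 + w2))).
    by apply: measurable_funM => //; exact: measurable_funM.
  by move=> z; rewrite normrM ler_pM// normrM ler_pM.
Qed.

Definition balance (phi1 phi2 : R * R -> R) (z : R * R) : R :=
  (flow_density z * dt phi1 z + flow_density z * flow_mark z * dt phi2 z) +
  (flow_density z * flow_velocity z * dx phi1 z + flow_density z * flow_mark z * flow_velocity z * dx phi2 z).

Lemma bsupp_balance phi1 phi2 : C1c phi1 -> C1c phi2 ->
  [/\ bsupp (fun z => flow_density z * dt phi1 z), bsupp (fun z => flow_density z * flow_mark z * dt phi2 z),
      bsupp (fun z => flow_density z * flow_velocity z * dx phi1 z) & bsupp (fun z => flow_density z * flow_mark z * flow_velocity z * dx phi2 z)].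
Proof.
move=> /C1c_bsupp[_ bt1 bx1] /C1c_bsupp[_ bt2 bx2].
have mr := measurable_flow_density; have mv := measurable_flow_velocity; have mw := measurable_flow_mark.
have rb z : `|flow_density z| <= dens w2 by have /andP[h1 h2] := flow_density_bound z; rewrite ger0_norm.
have vb z : `|flow_velocity z| <= v2 by have /andP[h1 h2] := flow_velocity_in z; rewrite ger0_norm.
have wb z : `|flow_mark z| <= w2.
  by have /andP[h1 h2] := mark_bound (flow_label z); rewrite ger0_norm// (le_trans (ltW w10)).
split.
- exact: bsuppM bt1 mr rb.
- apply: (bsuppM _ _ (dens w2 * w2)) => //; first exact: measurable_funM.
  by move=> z; rewrite normrM ler_pM.
- apply: (bsuppM _ _ (dens w2 * v2)) => //; first exact: measurable_funM.
  by move=> z; rewrite normrM ler_pM.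
- apply: (bsuppM _ _ (dens w2 * w2 * v2)) => //.
    by apply: measurable_funM => //; exact: measurable_funM.
  by move=> z; rewrite normrM ler_pM// normrM ler_pM.
Qed.

Lemma int2_balance phi1 phi2 : C1c phi1 -> C1c phi2 -> int2 (balance phi1 phi2) = 0.
Proof.
move=> c1 c2; have [b1 b2 b3 b4] := bsupp_balance _ _ c1 c2.
rewrite int2D; [|exact: bsuppD|exact: bsuppD].
rewrite (int2D _ _ b1 b2) (int2D _ _ b3 b4).
have w20 : 0 <= w2 by have /andP[a b] := mark_bound 0; rewrite (le_trans (ltW w10))// (le_trans a).
have r0n s : r0 s != 0 by rewrite gt_eqF.
have F1 : int2 (fun z => flow_density z * dt phi1 z) + int2 (fun z => flow_density z * flow_velocity z * dx phi1 z) = 0.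
  have := flow_weak r0 phi1 bmeas_r0 (fun s => ltW (r0_gt0 s)) contr0 c1 _.
  have E z : r0 (flow_label z) / r0 (flow_label z) = 1 by rewrite divff.
  rewrite (_ : (fun z => _ * dt phi1 z) = (fun z => flow_density z * dt phi1 z)); last first.
    by apply/funext => z; rewrite E mul1r.
  rewrite (_ : (fun z => _ * dx phi1 z) = (fun z => flow_density z * flow_velocity z * dx phi1 z)); last first.
    by apply/funext => z; rewrite E mul1r.
  by apply => s; rewrite divff// lerDr.
have F2 : int2 (fun z => flow_density z * flow_mark z * dt phi2 z) + int2 (fun z => flow_density z * flow_mark z * flow_velocity z * dx phi2 z) = 0.
  have gn s : 0 <= r0 s * mark s.
    by rewrite mulr_ge0 ?(ltW (r0_gt0 s))//; have /andP[h _] := mark_bound s; rewrite (le_trans (ltW w10)).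
  have cg s : ~ D s -> {for s, continuous (fun s => r0 s * mark s)}.
    by move=> Ds; apply: cvgM; [exact: contr0|exact: mark_continuous].
  have := flow_weak (fun s => r0 s * mark s) phi2 (bmeasM _ _ bmeas_r0 bmeas_mark) gn cg c2 _.
  have E z : r0 (flow_label z) * mark (flow_label z) / r0 (flow_label z) = flow_mark z by rewrite mulrAC divff// mul1r.
  rewrite (_ : (fun z => _ * dt phi2 z) = (fun z => flow_density z * flow_mark z * dt phi2 z)); last first.
    by apply/funext => z; rewrite E [flow_mark z * _]mulrC.
  rewrite (_ : (fun z => _ * dx phi2 z) = (fun z => flow_density z * flow_mark z * flow_velocity z * dx phi2 z)); last first.
    by apply/funext => z; rewrite E [flow_mark z * _]mulrC.
  apply => s; rewrite mulrAC divff// mul1r; have /andP[_ h] := mark_bound s.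
  by rewrite (le_trans h)// lerDl.
by rewrite addrACA F1 F2 addr0.
Qed.

Lemma sol_weak phi1 phi2 : C1c phi1 -> C1c phi2 ->
  (\int[mu]_(t in `]0%R, +oo[) \int[mu]_x
    (u1 (sol_density t x) (sol_velocity t x) * dt phi1 (t, x)
     + u2 p (sol_density t x) (sol_velocity t x) * dt phi2 (t, x)
     + (f1 (sol_density t x) (sol_velocity t x) * dx phi1 (t, x)
        + f2 p (sol_density t x) (sol_velocity t x) * dx phi2 (t, x)))%:E = 0)%E.
Proof.
move=> c1 c2; have [b1 b2 b3 b4] := bsupp_balance _ _ c1 c2.
have bb : bsupp (balance phi1 phi2) by apply: bsuppD; exact: bsuppD.
have ib := bsupp_integrable _ bb.
transitivity (\int[mu]_t \int[mu]_x (balance phi1 phi2 (t, x))%:E)%E.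
  rewrite integral_mkcond; apply: eq_integral => t _; rewrite patchE.
  case: ifPn => [|]; rewrite ?inE ?notin_setE /= in_itv/= andbT => t0.
    apply: eq_integral => x _; congr EFin.
    rewrite /balance /u1 /u2 /f1 /f2 /sol_density /sol_velocity t0.
    have := flow_density_mark (t, x); set a := flow_density (t, x); set v := flow_velocity (t, x); set w := flow_mark (t, x) => e.
    have -> : a * v * (v + p a) = a * (v + p a) * v by ring.
    by rewrite e.
  apply/esym; apply: integral0_eq => x _; congr EFin.
  have tn : (t, x).1 <= 0 by rewrite /= leNgt; apply/negP.
  have [e1 e2] := C1c_past _ _ c1 tn; have [e3 e4] := C1c_past _ _ c2 tn.
  by rewrite /balance e1 e2 e3 e4 !mulr0 !addr0.
have -> : (\int[mu]_t \int[mu]_x (balance phi1 phi2 (t, x))%:E)%E =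
    (\int[mu2]_z (balance phi1 phi2 z)%:E)%E.
  exact: (integral12_prod_meas1 ib).
rewrite -[LHS]fineK; last exact: integrable_fin_num.
by rewrite -[fine _]/(int2 (balance phi1 phi2)) int2_balance.
Qed.

Lemma sol_cvg_L1loc : cvg_L1loc sol_density r0 /\ cvg_L1loc sol_velocity v0.
Proof.
pose E (b : bool) := if b then D else [set 0 : R].
have cE : countable (\bigcup_b E b).
  by apply: bigcup_countable => [|[] _]; [exact: countableP|exact: countD|exact: countable1].
have slice (f : R * R -> R) t : measurable_fun [set: P] f ->
    measurable_fun [set: measurableTypeR R] (fun x => f (t, x)).
  by move=> mf; apply: (measurableT_comp mf); exact: pair1_measurable.
have hE x : ~ (\bigcup_b E b) x -> x != 0 /\ ~ D x.
  move=> h; split; last by move=> Dx; apply: h; exists true.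
  by apply/eqP => x0; apply: h; exists false.
split.
  apply: (bounded_cvg_L1loc _ _ (dens w2) _ _ _ _ cE) => //.
  - by move=> t; exact: (slice (fun z => sol_density z.1 z.2) t measurable_sol_density).
  - by move=> t x; have /andP[h1 h2] := sol_density_bound t x; rewrite ger0_norm.
  move=> x /hE[x0 Dx]; apply: cvg_trans (flow_density_start x x0 Dx); apply: near_eq_cvg.
  near=> t; have t0 : 0 < t by near: t; exact: nbhs_right_gt.
  by rewrite /sol_density t0.
apply: (bounded_cvg_L1loc _ _ v2 _ _ _ _ cE) => //.
- by move=> t; exact: (slice (fun z => sol_velocity z.1 z.2) t measurable_sol_velocity).
- by move=> t x; have /andP[h1 h2] := sol_velocity_bound t x; rewrite ger0_norm.
move=> x /hE[x0 Dx]; apply: cvg_trans (flow_velocity_start x x0 Dx); apply: near_eq_cvg.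
near=> t; have t0 : 0 < t by near: t; exact: nbhs_right_gt.
by rewrite /sol_velocity t0.
Unshelve. all: by end_near. Qed.

(** The velocity vanishes on both sides of the light, so both traces of the flux
    are 0. *)
Lemma sol_constrained (q : R) : 0 < q ->
  cvg (r0 x @[x --> (0:R)^'-]) -> cvg (v0 x @[x --> (0:R)^'-]) ->
  constrained_solution p q r0 v0 sol_density sol_velocity.
Proof.
move=> q0 cr cv; split.
- have [i1 i2 i3 i4] := sol_integrable.
  split=> [t x _| | |phi1 phi2]; [|by split|by split|exact: sol_weak].
  by case/andP: (sol_density_bound t x) => ? _; case/andP: (sol_velocity_bound t x).
- apply: aeW => t t0; have [rl [h1 h2 h3 h4]] := flow_trace _ t0 cr cv.
  exists rl, 0, 0, 0; rewrite /sol_density /sol_velocity t0.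
  by rewrite !mulr0 !(ltW q0); split.
- by apply: aeW => x; rewrite /sol_density /sol_velocity ltxx.
- exact: sol_cvg_L1loc.
Qed.

End Traffic.

(** * Existence *)

Theorem theorem5p3 (R : realType) (p dp ddp : R -> R)
    (hp : pressure p dp ddp)
    (q v1 v2 w1 w2 : R)
    (hq : 0 < q)
    (hv : 0 < v1 < v2)
    (hw : 0 < w1 < w2)
    (hvw : v2 < w2)
    (h1 : w2 <= v1 + p (q / v1))
    (h2 : v2 + p (q / v2) <= w2)
    (h3 : forall v : R, v1 <= v <= v2 -> w1 <= v + p (q / v))
    (h4 : exists vbar : R, v1 <= vbar <= v2 /\ vbar + p (q / vbar) < w2)
    (rho_min v_min : R)
    (hmin : domain p v1 v2 w1 w2 (rho_min, v_min))
    (hmin_w : v_min + p rho_min = w1)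
    (hmin_v : v_min = v2)
    (hlambda : lambda1 dp rho_min v_min < 0)
    (rho0 v0 : R -> R)
    (hL1 : locally_integrable setT rho0 /\ locally_integrable setT v0)
    (hBV : BV rho0 /\ BV v0)
    (hD : forall x, domain p v1 v2 w1 w2 (rho0 x, v0 x)) :
  exists rho v : R -> R -> R, constrained_solution p q rho0 v0 rho v.
Proof.
have /andP[v10 v12] := hv.
have rmin0 : 0 < rho_min by case: hmin.
have v2w1 : v2 < w1.
  rewrite -hmin_w hmin_v ltrDl -(pressure0 hp).
  exact: (pressure_lt hp).
have bounds s : [/\ 0 < rho0 s, v1 <= v0 s <= v2 & w1 <= v0 s + p (rho0 s) <= w2].
  by case: (hD s).
have [[mr _ _] [mv _ _]] := hL1.
have [bvr bvv] := hBV.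
have [Dr cDr contr] := BV_continuous _ bvr.
have [Dv cDv contv] := BV_continuous _ bvv.
pose D := \bigcup_(b : bool) (if b then Dr else Dv).
have cD : countable D.
  by apply: bigcup_countable => [|[] _]; [exact: countableP|exact: cDr|exact: cDv].
have contrD s : ~ D s -> {for s, continuous rho0}.
  by move=> Ds; apply: contr => h; apply: Ds; exists true.
have contvD s : ~ D s -> {for s, continuous v0}.
  by move=> Ds; apply: contv => h; apply: Ds; exists false.
have [k1 [k2 [m [c [L hk]]]]] := spacing_ratioP hp _ _ _ _ _ _ v10 v2w1 mr mv bounds.
exists (sol_density hp hk), (sol_velocity hp hk).
apply: (sol_constrained hp v10 v2w1 mr mv bounds cD contrD contvD) => //.
  exact: BV_left_limit.
exact: BV_left_limit.
Qed.
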